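(* Let $1<\alpha\le 2$, let $u\in L^1(\mathbb{R})$, and assume that ${}_{-\infty}D_x^{\alpha+2}u$ and its Fourier transform belong to $L^1(\mathbb{R})$. Let $m\ge 2$ be an integer and let $q_1,\dots,q_m$ and $\gamma_1,\dots,\gamma_m$ be real numbers satisfying the linear system $$\sum_{j=1}^{m}\gamma_j=1,\qquad \sum_{j=1}^{m}\gamma_j\Big(q_j-\frac{\alpha}{2}\Big)=0 .$$ For $h>0$ define the right weighted and shifted Grünwald difference (WSGD) operator by $${}_{R}\mathcal{D}_{h,q_1,\dots,q_m}^{\alpha,\gamma_1,\dots,\gamma_m}u(x)=\sum_{j=1}^{m}\gamma_j B_{h,q_j}^{\alpha}u(x).$$ Then $${}_{R}\mathcal{D}_{h,q_1,\dots,q_m}^{\alpha,\gamma_1,\dots,\gamma_m}u(x)={}_{x}D_{\infty}^{\alpha}u(x)+O(h^2)$$ uniformly for $x\in\mathbb{R}$ as $h\to 0$.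
   Context: For $n-1<\alpha<n$ with $n$ a positive integer, the left and right Riemann–Liouville fractional derivatives of order $\alpha$ on $\mathbb{R}$ are $${}_{-\infty}D_x^{\alpha}u(x)=\frac{1}{\Gamma(n-\alpha)}\frac{d^n}{dx^n}\int_{-\infty}^{x}(x-s)^{n-\alpha-1}u(s)\,ds,\qquad {}_{x}D_{\infty}^{\alpha}u(x)=\frac{(-1)^n}{\Gamma(n-\alpha)}\frac{d^n}{dx^n}\int_{x}^{\infty}(s-x)^{n-\alpha-1}u(s)\,ds;$$ for integer $\alpha=n$ they are $u^{(n)}$ and $(-1)^n u^{(n)}$ respectively. With the Fourier transform $\mathscr{F}[u](\omega)=\hat u(\omega)=\int_{\mathbb{R}}e^{-i\omega x}u(x)\,dx$ one has $\mathscr{F}[{}_{-\infty}D_x^{\alpha}u](\omega)=(i\omega)^{\alpha}\hat u(\omega)$ and $\mathscr{F}[{}_{x}D_{\infty}^{\alpha}u](\omega)=(-i\omega)^{\alpha}\hat u(\omega)$ (principal branches). The normalized Grünwald weights are $w_k^{(\alpha)}=(-1)^k\binom{\alpha}{k}$, $k\ge 0$ (equal to $\frac{\Gamma(k-\alpha)}{\Gamma(-\alpha)\Gamma(k+1)}$ for non-integer $\alpha$). For $q\in\mathbb{R}$ and $h>0$ the right shifted Grünwald difference operator is $B_{h,q}^{\alpha}u(x)=\frac{1}{h^{\alpha}}\sum_{k=0}^{\infty}w_k^{(\alpha)}u\big(x+(k-q)h\big)$. *)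

(* Defs.v *)
From HB Require Import structures.
From mathcomp Require Import all_boot all_order all_algebra.
From mathcomp Require Import all_classical all_reals all_analysis.
From mathcomp.real_closed Require Import complex.

Set Implicit Arguments.
Unset Strict Implicit.
Unset Printing Implicit Defensive.

Import Order.TTheory GRing.Theory Num.Theory.
Import numFieldNormedType.Exports.

Local Open Scope classical_set_scope.
Local Open Scope complex_scope.
Local Open Scope ring_scope.

(* [R[i]] carries no normed-module structure over [R], so operators acting on
   complex-valued functions of a real variable (integrals, derivatives, series,
   all with real kernels or real coefficients) are defined on real-valued
   functions and extended to real and imaginary parts. *)
Definition re_part {R : realType} (f : R -> R[i]) (x : R) : R :=
  complex.Re (f x).
Definition im_part {R : realType} (f : R -> R[i]) (x : R) : R :=
  complex.Im (f x).

Definition cext {R : realType} (T : (R -> R) -> R -> R)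
    (f : R -> R[i]) (x : R) : R[i] :=
  T (re_part f) x +i* T (im_part f) x.

Definition both_parts {R : realType} (P : (R -> R) -> Prop)
    (f : R -> R[i]) : Prop :=
  P (re_part f) /\ P (im_part f).

Definition L1 {R : realType} : (R -> R[i]) -> Prop :=
  both_parts (fun f =>
    (@lebesgue_measure R).-integrable setT (fun x => (f x)%:E)).

Definition cintegral {R : realType} (f : R -> R[i]) : R[i] :=
  Rintegral (@lebesgue_measure R) setT (re_part f) +i*
  Rintegral (@lebesgue_measure R) setT (im_part f).

Definition cis {R : realType} (t : R) : R[i] := cos t +i* sin t.

Definition fourier {R : realType} (f : R -> R[i]) (w : R) : R[i] :=
  cintegral (fun x => cis (- (w * x)) * f x).

Definition Gamma {R : realType} (s : R) : R :=
  Rintegral (@lebesgue_measure R) `]0, +oo[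
    (fun t => t `^ (s - 1) * expR (- t)).

Definition times_derivable {R : realType} (n : nat) (f : R -> R) : Prop :=
  forall (k : nat) (x : R), (k < n)%N -> derivable (derive1n k f) x 1.

(* For [0 < a], the positive integer [n] with [n - 1 < a <= n]. *)
Definition RL_order {R : realType} (a : R) : nat := `|Num.ceil a|%N.

Definition left_kernel {R : realType} (e : R) (f : R -> R) (x s : R) : R :=
  (x - s) `^ e * f s.
Definition right_kernel {R : realType} (e : R) (f : R -> R) (x s : R) : R :=
  (s - x) `^ e * f s.

Definition left_RL_integral {R : realType} (e : R) (f : R -> R) (x : R) : R :=
  Rintegral (@lebesgue_measure R) `]-oo, x[ (left_kernel e f x).
Definition right_RL_integral {R : realType} (e : R) (f : R -> R) (x : R) : R :=
  Rintegral (@lebesgue_measure R) `]x, +oo[ (right_kernel e f x).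

Definition left_RL {R : realType} (a : R) (f : R -> R) (x : R) : R :=
  let n := RL_order a in
  if a == n%:R then derive1n n f x
  else (Gamma (n%:R - a))^-1 * derive1n n (left_RL_integral (n%:R - a - 1) f) x.

Definition right_RL {R : realType} (a : R) (f : R -> R) (x : R) : R :=
  let n := RL_order a in
  if a == n%:R then (-1) ^+ n * derive1n n f x
  else (-1) ^+ n / Gamma (n%:R - a) *
       derive1n n (right_RL_integral (n%:R - a - 1) f) x.

(* [left_RL] and [right_RL] are total; the next two predicates say that the
   integrals converge absolutely and that the [n] classical derivatives exist,
   at every point of the line. *)
Definition left_RL_exists {R : realType} (a : R) (f : R -> R) : Prop :=
  let n := RL_order a in
  if a == n%:R then times_derivable n f
  else (forall x : R, (@lebesgue_measure R).-integrable `]-oo, x[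
          (fun s => (left_kernel (n%:R - a - 1) f x s)%:E)) /\
       times_derivable n (left_RL_integral (n%:R - a - 1) f).

Definition right_RL_exists {R : realType} (a : R) (f : R -> R) : Prop :=
  let n := RL_order a in
  if a == n%:R then times_derivable n f
  else (forall x : R, (@lebesgue_measure R).-integrable `]x, +oo[
          (fun s => (right_kernel (n%:R - a - 1) f x s)%:E)) /\
       times_derivable n (right_RL_integral (n%:R - a - 1) f).

Definition gbinom {R : realType} (a : R) (k : nat) : R :=
  \prod_(i < k) ((a - i%:R) / i.+1%:R).

Definition grunwald_weight {R : realType} (a : R) (k : nat) : R :=
  (-1) ^+ k * gbinom a k.

Definition grunwald_term {R : realType} (a h q : R) (f : R -> R) (x : R)
    (k : nat) : R :=
  grunwald_weight a k * f (x + (k%:R - q) * h).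

Definition right_grunwald {R : realType} (a h q : R) (f : R -> R) (x : R) : R :=
  (h `^ a)^-1 * limn (series (grunwald_term a h q f x)).

Definition right_grunwald_cvg {R : realType} (a h q : R) (f : R -> R) : Prop :=
  forall x : R, cvgn (series (grunwald_term a h q f x)).

Definition right_WSGD {R : realType} (m : nat) (a h : R) (q g : 'I_m -> R)
    (f : R -> R[i]) (x : R) : R[i] :=
  \sum_(j < m) (g j)%:C * cext (right_grunwald a h (q j)) f x.

(* Main.v *)
Require Import Defs.
From HB Require Import structures.
From mathcomp Require Import all_boot all_order all_algebra.
From mathcomp Require Import all_classical all_reals all_analysis.
From mathcomp.real_closed Require Import complex.
From mathcomp Require Import measurable_realfun.
From mathcomp Require Import ring lra.

(** The estimate is a comparison of Fourier multipliers, carried out with real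
    integrals.

    For real f, [cosT f] and [sinT f] are the cosine and sine transforms,
    [phase f w y] = int f(s) cos (y - w s) ds is the real part of
    e^(iy) f^(w), and [amp f w] bounds it in y. Integrating against w^b over
    positive frequencies gives [synth f b phi], the function whose transform is
    |w|^b f^(w) rotated by phi (and by - phi at - w). Differentiating it
    raises b by 1 and phi by pi / 2 ([synth_der]), so that differentiation,
    fractional or not, becomes bookkeeping on the pair (b, phi).

    Two facts carry the theorem. The first is spectral decay
    ([left_RL_spectral_decay]): w^(alpha + 2) [amp f] w is integrable on the
    half-line. Formally the transform of the left derivative is
    (iw)^(alpha + 2) f^, but here the derivative exists only pointwise and
    neither f nor its fractional integral I is smooth or decays in a way that
    permits integrating by parts, and I itself need not be integrable. Instead
    the fourfold difference of I with step pi / w is evaluated in two ways. It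
    is a fourfold moving average of the fourth derivative, and it is a
    threefold difference of the convolution of f with an integrable
    kernel. At the frequency w the difference acts as the factor - 2 and the
    average as a quarter turn with the factor 2 / w ([fdiff_phase],
    [avg_phase]), while the kernel contributes w^(alpha - 2) ([pos_pow_diff_phase]),
    which yields the relation. The fundamental theorem of
    calculus behind the averages holds since the fourth derivative agrees
    almost everywhere with a continuous function ([inversion_ae]), and an
    everywhere differentiable function whose derivative vanishes almost
    everywhere is constant ([derive_ae0_cst]).

    By the decay, v = [synth f 0 0] is a continuous representative of f, and its
    right derivative of order alpha is [synth f alpha (- alpha pi / 2)]
    ([right_RL_synth]); this is the multiplier (- iw)^alpha. The constant
    Gamma (s) e^(i s pi / 2) w^(- s) of the fractional integral is the limit of
    the Laplace integral of t^(s - 1) e^(- (e - iw) t) as e tends to 0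
    ([laplace_damped]).

    The second fact is the expansion of the symbol. With th = w h,
    sum_k w_k e^(i k th) = (1 - e^(i th))^alpha
    = (2 sin (th / 2))^alpha e^(i alpha (th - pi) / 2) ([grunwald_seriesE]),
    so the shifted operator has the multiplier
    h^(- alpha) (- i th)^alpha (1 + i (alpha / 2 - q) th + O(th^2)).
    The two linear conditions on the weights leave 1 + O(th^2) in the weighted
    sum, and the error of the symbol is at most C th^(alpha + 2) for every
    th > 0 ([symbol_estimate]). Integrating it against [amp f] gives
    C h^2 times the integral of w^(alpha + 2) [amp f] ([WSGD_error]), uniformly
    in x. The real and imaginary parts of u are treated separately; integrability
    of the complex transform of the derivative gives that of the sine and cosine
    transforms of both parts, by splitting into even and odd functions of w
    ([fourier_amp]). *)

Set Implicit Arguments.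
Unset Strict Implicit.
Unset Printing Implicit Defensive.

Import Order.TTheory GRing.Theory Num.Theory.
Import numFieldNormedType.Exports.

Local Open Scope classical_set_scope.
Local Open Scope complex_scope.
Local Open Scope ring_scope.

(** * Dominated convergence and Fubini for real-valued integrals *)
Local Notation mu := (@lebesgue_measure _).
Local Notation intg D f := (integrable (@lebesgue_measure _) D (EFin \o f)).

Section measure_tools.
Context {R : realType}.
Implicit Types (D : set (measurableTypeR R)) (f g : R -> R).

Lemma intg_measurable D f : intg D f -> measurable_fun D f.
Proof. by move=> /measurable_int/measurable_EFinP. Qed.

Lemma intg_le D f g : measurable D -> measurable_fun D f ->
  (forall x, D x -> `|f x| <= g x) -> intg D g -> intg D f.
Proof.
move=> mD mf fg ig; apply: le_integrable ig => //.
  exact/measurable_EFinP.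
by move=> x Dx /=; rewrite lee_fin (le_trans (fg x Dx))// ler_norm.
Qed.

Lemma intg_eq D f g : measurable D -> (forall x, D x -> f x = g x) -> intg D f -> intg D g.
Proof.
by move=> mD fg; apply: eq_integrable => // x; rewrite inE => Dx /=; rewrite fg.
Qed.

Lemma eq_Rintegral_on D f g : (forall x, D x -> f x = g x) ->
  \int[mu]_(x in D) f x = \int[mu]_(x in D) g x.
Proof. by move=> fg; apply: eq_Rintegral => x /set_mem; exact: fg. Qed.

Lemma intgM_bounded D f g c : measurable D -> intg D f -> measurable_fun D g ->
  (forall x, D x -> `|g x| <= c) -> intg D (fun x => f x * g x).
Proof.
move=> mD fi mg gc.
apply: (@intg_le _ _ (fun x => c * `|f x|)) => //.
- by apply: measurable_funM => //; exact: intg_measurable.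
- by move=> x Dx; rewrite normrM mulrC ler_wpM2r// gc.
- have := integrableZl mD c (integrable_norm fi).
  by apply: eq_integrable => // x _.
Qed.

Lemma intgD D f g : measurable D -> intg D f -> intg D g ->
  intg D (fun x => f x + g x).
Proof.
by move=> mD fi gi; apply: eq_integrable (integrableD mD fi gi).
Qed.

Lemma intgB D f g : measurable D -> intg D f -> intg D g ->
  intg D (fun x => f x - g x).
Proof.
by move=> mD fi gi; apply: eq_integrable (integrableB mD fi gi).
Qed.

Lemma intgZl D f c : measurable D -> intg D f -> intg D (fun x => c * f x).
Proof. by move=> mD fi; apply: eq_integrable (integrableZl mD c fi). Qed.

Lemma intg_norm D f : measurable D -> intg D f -> intg D (fun x => `|f x|).
Proof. by move=> mD fi; apply: integrable_norm. Qed.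

Lemma Rintegral_dominated_cvg D (F : nat -> R -> R) f g : measurable D ->
  (forall n, measurable_fun D (F n)) ->
  (forall x, D x -> F n x @[n --> \oo] --> f x) ->
  (forall n x, D x -> `|F n x| <= g x) -> intg D g ->
  intg D f /\
  \int[mu]_(x in D) F n x @[n --> \oo] --> \int[mu]_(x in D) f x.
Proof.
move=> mD mF Ff Fg ig.
have mf : measurable_fun D f.
  by apply: (measurable_fun_cvg mF) => x Dx; exact: Ff.
have [] := @dominated_convergence _ _ _ (@lebesgue_measure R) D mD
    (fun n => EFin \o F n) (EFin \o f) (EFin \o g).
- by move=> n; exact/measurable_EFinP.
- exact/measurable_EFinP.
- apply: aeW => x Dx; apply: cvg_EFin; first exact: nearW.
  exact: Ff.
- exact: ig.
- by apply: aeW => x n Dx; rewrite lee_fin; exact: Fg.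
move=> fi _ cv; split => //.
apply: fine_cvg; rewrite /Rintegral fineK//; exact: integrable_fin_num.
Qed.

Lemma le_norm_Rintegral D f g : measurable D -> measurable_fun D f ->
  (forall x, D x -> `|f x| <= g x) -> intg D g ->
  `| \int[mu]_(x in D) f x | <= \int[mu]_(x in D) g x.
Proof.
move=> mD mf fg ig; have fi := intg_le mD mf fg ig.
apply: (le_trans (le_normr_Rintegral mD fi)).
apply: le_Rintegral => //; exact: integrable_norm.
Qed.

(** Domination by a product of two integrable functions gives integrability on
    the plane; the restrictions to [D1] and [D2] are encoded by indicators, so
    that the theorem for the product measure applies. *)
Lemma Rintegral_Fubini D1 D2 (F : measurableTypeR R * measurableTypeR R -> R)
    (a b : R -> R) :
  measurable D1 -> measurable D2 -> measurable_fun setT F ->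
  (forall x y, D1 x -> D2 y -> `|F (x, y)| <= a x * b y) ->
  intg D1 a -> intg D2 b ->
  \int[mu]_(x in D1) \int[mu]_(y in D2) F (x, y) =
  \int[mu]_(y in D2) \int[mu]_(x in D1) F (x, y).
Proof.
move=> mD1 mD2 mF Fab ia ib.
pose G z := F z * (\1_D1 z.1 * \1_D2 z.2).
have mG : measurable_fun setT G.
  apply: measurable_funM => //; apply: measurable_funM.
    by apply: (@measurableT_comp _ _ _ _ _ _ (\1_D1 : measurableTypeR R -> R) _ fst) => //; exact: measurable_indic.
  by apply: (@measurableT_comp _ _ _ _ _ _ (\1_D2 : measurableTypeR R -> R) _ snd) => //; exact: measurable_indic.
have ia' : intg setT (fun x => `|a x| * \1_D1 x).
  have /(integrable_mkcond _ mD1) := integrable_norm ia.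
  apply: eq_integrable => // x _; rewrite /= patchE indicE.
  by case: ifPn => _; rewrite ?mulr1 ?mulr0.
have ib' : intg setT (fun x => `|b x| * \1_D2 x).
  have /(integrable_mkcond _ mD2) := integrable_norm ib.
  apply: eq_integrable => // x _; rewrite /= patchE indicE.
  by case: ifPn => _; rewrite ?mulr1 ?mulr0.
have GE x y : `|G (x, y)| <= (`|a x| * \1_D1 x) * (`|b y| * \1_D2 y).
  rewrite /G /= !indicE; have [/set_mem x1|] := boolP (x \in D1); last first.
    by rewrite !(mulr0, mul0r) normr0.
  have [/set_mem x2|] := boolP (y \in D2); last by rewrite !(mulr0, mul0r) normr0.
  rewrite !mulr1 (le_trans (Fab _ _ x1 x2))//.
  by rewrite (le_trans (ler_norm _))// normrM.
have iG : (@lebesgue_measure R \x @lebesgue_measure R)%E.-integrable setT (EFin \o G).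
  apply/integrable12ltyP; first exact/measurable_EFinP.
  apply: (@le_lt_trans _ _ (\int[@lebesgue_measure R]_x
     ((\int[mu]_y (`|b y| * \1_D2 y))%:E * (`|a x| * \1_D1 x)%:E))%E).
    apply: ge0_le_integral => //=.
    - by move=> x _; exact: integral_ge0.
    - apply: (@measurable_fun_fubini_tonelli_F _ _ _ _ _ _ (fun z => `|(G z)%:E|)%E) => //.
      by apply: measurableT_comp => //; exact/measurable_EFinP.
    - apply/measurable_EFinP; apply: measurable_funM => //.
      exact: intg_measurable ia'.
    - move=> x _; rewrite /Rintegral fineK; last exact: integrable_fin_num ib'.
      rewrite muleC -integralZl//.
      apply: ge0_le_integral => //=.
      + apply/measurable_EFinP; apply: measurableT_comp => //.
        by apply: (measurableT_comp mG).
      + apply: measurable_funeM; exact: (measurable_int _ ib').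
      + by move=> y _; rewrite lee_fin GE.
  rewrite integralZl// lte_mul_pinfty//.
    by rewrite lee_fin; apply: Rintegral_ge0 => y _; rewrite mulr_ge0.
  exact: (integrable_lty _ ia').
have inner1 x : \int[mu]_(y in D2) F (x, y) * \1_D1 x = \int[mu]_y G (x, y).
  rewrite Rintegral_mkcond [in RHS]/G /=.
  rewrite !indicE; have [xD|xD] := boolP (x \in D1); last first.
    rewrite mulr0 (_ : (fun _ => _) = cst 0); last by apply/funext => y; rewrite mul0r mulr0.
    by rewrite Rintegral_cst// mul0r.
  rewrite mulr1; apply: eq_Rintegral => y _; rewrite patchE indicE.
  by case: ifPn => _; rewrite ?(mulr1,mulr0).
have inner2 y : \int[mu]_(x in D1) F (x, y) * \1_D2 y = \int[mu]_x G (x, y).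
  rewrite Rintegral_mkcond [in RHS]/G /=.
  rewrite !indicE; have [xD|xD] := boolP (y \in D2); last first.
    rewrite mulr0 (_ : (fun _ => _) = cst 0); last by apply/funext => x; rewrite !mulr0.
    by rewrite Rintegral_cst// mul0r.
  rewrite mulr1; apply: eq_Rintegral => x _; rewrite patchE indicE.
  by case: ifPn => _; rewrite ?(mulr1,mulr0).
have fG1 x : (\int[mu]_y (G (x, y))%:E)%E \is a fin_num.
  apply: integrable_fin_num => //; apply: (@intg_le setT _ (fun y => (`|a x| * \1_D1 x) * (`|b y| * \1_D2 y))) => //.
    by apply: (measurableT_comp mG).
  exact: intgZl ib'.
have fG2 y : (\int[mu]_x (G (x, y))%:E)%E \is a fin_num.
  apply: integrable_fin_num => //; apply: (@intg_le setT _ (fun x => (`|b y| * \1_D2 y) * (`|a x| * \1_D1 x))) => //.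
    by apply: (measurableT_comp mG).
    by move=> x _; rewrite mulrC.
  exact: intgZl ia'.
rewrite [LHS]Rintegral_mkcond [RHS]Rintegral_mkcond.
transitivity (\int[mu]_x \int[mu]_y G (x, y)).
  apply: eq_Rintegral => x _; rewrite -inner1 patchE indicE.
  by case: ifPn => _; rewrite ?(mulr1,mulr0).
transitivity (\int[mu]_y \int[mu]_x G (x, y)); last first.
  apply: eq_Rintegral => y _; rewrite -inner2 patchE indicE.
  by case: ifPn => _; rewrite ?(mulr1,mulr0).
rewrite /Rintegral.
under eq_integral do rewrite fineK//.
under [in RHS]eq_integral do rewrite fineK//.
by congr fine; exact: (Fubini iG).
Qed.

End measure_tools.

(** * Translations, reflections and convolutions *)

Section lebesgue_symmetries.
Context {R : realType}.
Local Notation mT := (measurableTypeR R).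
Implicit Types (D : set mT) (f g : R -> R).

Lemma measurable_shift (b : R) : measurable_fun setT (fun x : mT => x + b : mT).
Proof. exact: measurable_funD. Qed.

Lemma lebesgue_measure_shift (b : R) (A : set mT) : measurable A ->
  pushforward mu (fun x : mT => x + b : mT) A = mu A.
Proof.
move=> mA; apply/esym/lebesgue_measure_unique => //=.
  exact: measurable_shift.
move=> ? _ [[c d] _ <-].
rewrite /pushforward (_ : _ @^-1` _ = `]c - b, d - b]%classic); last first.
  by apply/seteqP; split => x /=; rewrite !in_itv/= ltrBlDr lerBrDr.
rewrite /= !lebesgue_measure_itv/= !lte_fin ltrD2r -!EFinB.
by rewrite (_ : d - b - (c - b) = d - c)//; ring.
Qed.

(** Translations and reflections preserve Lebesgue measure, so both changes of
    variables follow from the formula for a pushforward measure. *)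
Section invariant.
Variable phi : mT -> mT.
Hypothesis mphi : measurable_fun setT phi.
Hypothesis muphi : forall A : set mT, measurable A -> pushforward mu phi A = mu A.

Lemma intg_comp D f : measurable D -> measurable_fun (setT : set mT) f ->
  intg D f -> intg (phi @^-1` D) (f \o phi).
Proof.
move=> mD mf fi; have mpD : measurable (phi @^-1` D).
  by rewrite -[X in measurable X]setTI; exact: mphi.
apply/integrableP; split.
  apply/measurable_EFinP/measurable_funTS.
  exact: (@measurableT_comp _ _ _ _ _ _ f _ phi).
move/integrableP: fi => [mfD]; apply: le_lt_trans.
rewrite [leRHS](@eq_measure_integral _ _ _ _ (pushforward mu phi)); last first.
  by move=> A mA _; exact/esym/muphi.
rewrite ge0_integral_pushforward//.
by do 2 apply: measurableT_comp => //; exact: measurable_funTS.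
Qed.

Lemma Rintegral_comp D f : measurable D -> measurable_fun (setT : set mT) f ->
  intg D f ->
  \int[mu]_(x in D) f x = \int[mu]_(x in phi @^-1` D) f (phi x).
Proof.
move=> mD mf fi; rewrite /Rintegral; congr fine.
rewrite [LHS](@eq_measure_integral _ _ _ _ (pushforward mu phi)); last first.
  by move=> A mA _; exact/esym/muphi.
rewrite integral_pushforward//; first exact/measurable_EFinP.
exact: intg_comp.
Qed.
End invariant.

Lemma measurable_reflect (b : R) : measurable_fun setT (fun x : mT => b - x : mT).
Proof. exact: measurable_funB. Qed.

Lemma lebesgue_measure_reflect (b : R) (A : set mT) : measurable A ->
  pushforward mu (fun x : mT => b - x : mT) A = mu A.
Proof.
move=> mA; have mB : measurable ((fun x : mT => x + b : mT) @^-1` A).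
  by rewrite -[X in measurable X]setTI; exact: measurable_shift.
rewrite -(lebesgue_measure_shift b mA) -[RHS](lebesgue_measureN mB).
by rewrite /pushforward; congr (lebesgue_measure _); apply/seteqP; split => x /=; rewrite addrC.
Qed.

Lemma intg_shift b f : intg setT f -> intg setT (fun x => f (x + b)).
Proof.
move=> fi; apply: (@intg_comp _ (measurable_shift b) (@lebesgue_measure_shift b) setT f) => //.
exact: intg_measurable fi.
Qed.

Lemma intg_reflect b f : intg setT f -> intg setT (fun x => f (b - x)).
Proof.
move=> fi; apply: (@intg_comp _ (measurable_reflect b) (@lebesgue_measure_reflect b) setT f) => //.
exact: intg_measurable fi.
Qed.

Lemma Rintegral_shift b f : intg setT f -> \int[mu]_x f (x + b) = \int[mu]_x f x.
Proof.
move=> fi; rewrite [RHS](@Rintegral_comp _ (measurable_shift b) (@lebesgue_measure_shift b))//.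
exact: intg_measurable fi.
Qed.

Lemma Rintegral_reflect b f : intg setT f -> \int[mu]_x f (b - x) = \int[mu]_x f x.
Proof.
move=> fi; rewrite [RHS](@Rintegral_comp _ (measurable_reflect b) (@lebesgue_measure_reflect b))//.
exact: intg_measurable fi.
Qed.

End lebesgue_symmetries.

Section convolution.
Context {R : realType}.
Local Notation mT := (measurableTypeR R).
Implicit Types (f g k : R -> R).

Definition conv k f (x : R) : R := \int[mu]_t (k t * f (x - t)).

(** Young's inequality in L^1 together with the weak form of the convolution: for
    bounded [g], Fubini moves the convolution onto [g]. With a cosine for [g]
    this is the product rule for transforms. *)
Lemma conv_integrable k f (g : R -> R) c :
  intg setT k -> intg setT f -> measurable_fun (setT : set mT) g ->
  (forall x, `|g x| <= c) ->
  intg setT (conv k f) /\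
  \int[mu]_x (conv k f x * g x) =
  \int[mu]_t (k t * \int[mu]_x (f x * g (x + t))).
Proof.
move=> ki fi mg gc.
have mk := intg_measurable ki; have mf := intg_measurable fi.
have c0 : 0 <= c by rewrite (le_trans _ (gc 0)).
pose H (z : mT * mT) : R := k z.2 * f (z.1 - z.2).
have mH : measurable_fun setT H.
  apply: measurable_funM; first exact: measurableT_comp.
  by apply: (measurableT_comp mf); exact: measurable_funB.
pose N : R := \int[mu]_x `|f x|.
have fin : (@lebesgue_measure R \x @lebesgue_measure R)%E.-integrable setT (EFin \o H).
  apply/integrable21ltyP; first exact/measurable_EFinP.
  rewrite (_ : (\int[_]_y _)%E = (\int[@lebesgue_measure R]_t (N%:E * `|k t|%:E))%E).
    rewrite integralZl//; last exact: integrable_norm.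
    by rewrite lte_mul_pinfty// ?lee_fin ?Rintegral_ge0//; exact: (integrable_lty _ (integrable_norm ki)).
  apply: eq_integral => t _.
  transitivity (\int[@lebesgue_measure R]_x (`|k t|%:E * `|f (x - t)|%:E))%E.
    by apply: eq_integral => x _; rewrite /H /= normrM EFinM.
  have fti := integrable_norm (intg_shift (- t) fi).
  rewrite integralZl// muleC; congr (_ * _)%E.
  rewrite /N -(Rintegral_shift (- t) (integrable_norm fi)).
  rewrite /Rintegral fineK//; exact: integrable_fin_num fti.
have [mF iF] : measurable_fun setT (fubini_F mu (EFin \o H)) /\
   (@lebesgue_measure R).-integrable setT (fubini_F mu (EFin \o H)).
  by split; [exact: measurable_fubini_F fin|exact: integrable_fubini_F fin].
have convE x : conv k f x = fine (fubini_F mu (EFin \o H) x) by [].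
have iconv : intg setT (conv k f).
  apply: le_integrable iF => //.
    by apply/measurable_EFinP; apply: (measurableT_comp (f:=fine)).
  move=> x _ /=; rewrite convE.
  by case: (fubini_F _ _ x) => [r| |]//=; rewrite normr0 leey.
split => //.
pose Hg (z : mT * mT) : R := H z * g z.1.
have mHg : measurable_fun setT Hg.
  by apply: measurable_funM => //; exact: measurableT_comp.
have iHg : (@lebesgue_measure R \x @lebesgue_measure R)%E.-integrable setT (EFin \o Hg).
  apply: (@le_integrable _ _ _ _ _ _ _ (fun z => c%:E * (EFin \o H) z)%E) => //.
  - exact/measurable_EFinP.
  - move=> z _ /=; rewrite lee_fin !normrM (ger0_norm c0) mulrC ler_wpM2r//.
  - exact: integrableZl.
have := Fubini iHg => E.
transitivity (fine (\int[@lebesgue_measure R]_x \int[@lebesgue_measure R]_y (EFin \o Hg) (x, y))%E).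
  rewrite {1}/Rintegral; congr fine.
  (* For almost every x the section of H is integrable; only there can the
     factor g x be moved inside the real-valued inner integral. *)
  apply: ae_eq_integral => //.
  - apply/measurable_EFinP; apply: measurable_funM => //; exact: intg_measurable iconv.
  - exact: (measurable_fubini_F iHg).
  - have := ae_integrable1 fin.
    apply: filterS => x iHx _ /=.
    rewrite -[RHS](@fineK _ _); last first.
      apply: integrable_fin_num => //.
      have := integrableZr measurableT (g x) iHx.
      by apply: eq_integrable.
    congr EFin; rewrite /conv.
    by rewrite -/(Rintegral mu setT (fun y => H (x,y) * g x)) RintegralZr.
rewrite E /Rintegral; congr fine; apply: eq_integral => t _.
have fgi : intg setT (fun x => f x * g (x + t)).
  apply: (@intgM_bounded _ _ _ _ c) => //.
  by apply: (measurableT_comp mg); exact: measurable_shift.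
have fgi' : intg setT (fun x => f (x - t) * g x).
  have := intg_shift (- t) fgi.
  by apply: eq_integrable => // x _ /=; rewrite subrK.
transitivity (\int[@lebesgue_measure R]_x ((k t)%:E * (f (x - t) * g x)%:E))%E.
  by apply: eq_integral => x _; rewrite /Hg /H /= -mulrA EFinM.
rewrite integralZl// EFinM; congr (_ * _)%E.
rewrite -/(Rintegral mu setT (fun x => f x * g (x + t))) -(Rintegral_shift (- t) fgi).
rewrite /Rintegral fineK; last first.
  apply: integrable_fin_num => //; exact: (intg_shift (- t) fgi).
by apply: eq_integral => x _; rewrite subrK.
Qed.

End convolution.

(** * Derivatives and improper integrals *)

Section derivative_rules.
Context {R : realType}.
Implicit Types (f g : R -> R) (x df dg c : R).

Lemma der_eq f x df df' : is_derive x 1 f df -> df = df' -> is_derive x 1 f df'.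
Proof. by move=> + <-. Qed.

Lemma der_add f g x df dg : is_derive x 1 f df -> is_derive x 1 g dg ->
  is_derive x 1 (fun y => f y + g y) (df + dg).
Proof. by move=> hf hg; exact: is_deriveD. Qed.

Lemma der_sub f g x df dg : is_derive x 1 f df -> is_derive x 1 g dg ->
  is_derive x 1 (fun y => f y - g y) (df - dg).
Proof. by move=> hf hg; exact: is_deriveB. Qed.

Lemma der_opp f x df : is_derive x 1 f df -> is_derive x 1 (fun y => - f y) (- df).
Proof. by move=> hf; exact: is_deriveN. Qed.

Lemma der_mul f g x df dg : is_derive x 1 f df -> is_derive x 1 g dg ->
  is_derive x 1 (fun y => f y * g y) (df * g x + f x * dg).
Proof.
move=> hf hg; apply: (der_eq (is_deriveM hf hg)).
by rewrite /GRing.scale/= addrC mulrC.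
Qed.

Lemma der_scale c f x df : is_derive x 1 f df ->
  is_derive x 1 (fun y => c * f y) (c * df).
Proof. by move=> hf; exact: is_deriveZ. Qed.

Lemma der_cst c x : is_derive x 1 (fun=> c) 0.
Proof. exact: is_derive_cst. Qed.

Lemma der_id x : is_derive x 1 (fun y : R => y) 1.
Proof. exact: is_derive_id. Qed.

Lemma der_comp f g x df dg : is_derive (g x) 1 f df -> is_derive x 1 g dg ->
  is_derive x 1 (fun y => f (g y)) (df * dg).
Proof. by move=> hf hg; exact: (@is_derive1_comp _ f g). Qed.

Lemma der_sum n (f : 'I_n -> R -> R) x (df : 'I_n -> R) :
  (forall i, is_derive x 1 (f i) (df i)) ->
  is_derive x 1 (fun y => \sum_(i < n) f i y) (\sum_(i < n) df i).
Proof.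
by move=> h; rewrite -[X in is_derive _ _ X _]fct_sumE; exact: is_derive_sum.
Qed.

Lemma der_affine c b x : is_derive x 1 (fun y => b + c * y) c.
Proof.
by apply: (der_eq (der_add (der_cst b x) (der_scale c (der_id x)))); rewrite add0r mulr1.
Qed.

End derivative_rules.

Section improper.
Context {R : realType}.
Local Notation mT := (measurableTypeR R).
Implicit Types (D : set mT) (f F : R -> R).

Lemma is_derive_continuous f (x df : R) : is_derive x 1 f df -> {for x, continuous f}.
Proof.
by move=> h; apply/differentiable_continuous/derivable1_diffP; exact: ex_derive.
Qed.

Lemma derive1_is_derive f (x df : R) : is_derive x 1 f df -> derive1 f x = df.
Proof. by move=> h; rewrite derive1E; exact: derive_val. Qed.

(** Two-sided differentiability on the closed segment removes the one-sided
    limit conditions of the general theorem. *)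
Lemma Rintegral_FTC2 (f F : R -> R) (a b : R) : a <= b ->
  (forall x, a <= x <= b -> is_derive x 1 F (f x)) ->
  (forall x, a <= x <= b -> {for x, continuous f}) ->
  intg `[a, b] f /\ \int[mu]_(x in `[a, b]) f x = F b - F a.
Proof.
move=> ab dF cf.
have wc : {within `[a, b], continuous f}.
  by apply: continuous_in_subspaceT => x; rewrite inE/= in_itv/=; exact: cf.
split; first by apply: continuous_compact_integrable => //; exact: segment_compact.
move: ab; rewrite le_eqVlt => /predU1P[<-|ab].
  by rewrite subrr set_itv1 Rintegral_set1.
rewrite /Rintegral (@continuous_FTC2 _ f F a b)//.
  split.
  - move=> x; rewrite in_itv/= => /andP[/ltW ax /ltW xb].
    by have := dF x; rewrite ax xb => /(_ isT) h; exact: ex_derive.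
  - have := dF a; rewrite lexx (ltW ab) => /(_ isT)/is_derive_continuous h.
    exact: cvg_at_right_filter.
  - have := dF b; rewrite lexx (ltW ab) => /(_ isT)/is_derive_continuous h.
    exact: cvg_at_left_filter.
move=> x; rewrite in_itv/= => /andP[/ltW ax /ltW xb].
by apply: derive1_is_derive; apply: dF; rewrite ax xb.
Qed.

(** Improper integrals: [D] is the union of growing segments. A nonnegative
    function with a bounded antiderivative is integrable on [D] by monotone
    convergence; for an integrable function dominated convergence gives the
    integral as the difference of the limits of the antiderivative. *)
Section exhaust.
Variables (D : set mT) (a b : nat -> R) (f F : R -> R).
Hypothesis DE : (D : set R) = \bigcup_n `[a n, b n]%classic.
Hypothesis nd : forall m n x, (m <= n)%N -> a m <= x <= b m -> a n <= x <= b n.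
Hypothesis ab : forall n, a n <= b n.
Hypothesis dF : forall x, D x -> is_derive x 1 F (f x).
Hypothesis cf : forall x, D x -> {for x, continuous f}.

Let inD n x : a n <= x <= b n -> D x.
Proof. by move=> h; rewrite DE; exists n => //=; rewrite in_itv. Qed.

Let mD : measurable D.
Proof. by rewrite DE; apply: bigcup_measurable => n _; exact: measurable_itv. Qed.

Let seg n : intg `[a n, b n] f /\ \int[mu]_(x in `[a n, b n]) f x = F (b n) - F (a n).
Proof.
by apply: Rintegral_FTC2 => // x abx; [apply: dF|apply: cf]; exact: inD abx.
Qed.

Lemma exhaust_measurable : measurable_fun D f.
Proof.
rewrite DE; apply/measurable_fun_bigcup => // n.
by have [/intg_measurable] := seg n.
Qed.

Lemma exhaust_integrable (K : R) : (forall x, D x -> 0 <= f x) ->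
  (forall x, D x -> `|F x| <= K) -> intg D f.
Proof.
move=> f0 FK; apply/integrableP; split.
  apply/measurable_EFinP. exact: exhaust_measurable.
rewrite (_ : (\int[_]_(x in D) _)%E = (\int[mu]_(x in D) (f x)%:E)%E); last first.
  apply: eq_integral => x /set_mem Dx /=; by rewrite ger0_norm// f0.
have nds : nondecreasing_seq (fun n => `[a n, b n]%classic : set mT).
  move=> m n mn; apply/subsetPset => x /=; rewrite !in_itv/=; exact: nd.
have := @ge0_nondecreasing_set_cvg_integral _ mT _ _ (fun x => (f x)%:E)
  (@lebesgue_measure R) nds (fun n => measurable_itv _).
rewrite -DE => cv.
apply: (@le_lt_trans _ _ (K + K)%:E); last by rewrite ltry.
rewrite -(cvg_lim _ (cv _ _))//.
- apply: lime_le.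
    apply/cvg_ex; eexists; apply: cv => n.
      by apply/measurable_EFinP; have [/intg_measurable] := seg n.
    by move=> x; rewrite /= in_itv/= => /inD Dx; rewrite lee_fin f0.
  apply: nearW => n; have [fi fE] := seg n.
  rewrite -(fineK (integrable_fin_num _ fi))// -/(Rintegral _ _ _) fE lee_fin.
  have Da : D (a n) by apply: (@inD n); rewrite lexx ab.
  have Db : D (b n) by apply: (@inD n); rewrite lexx ab.
  by rewrite (le_trans (ler_norm _))// (le_trans (ler_normB _ _))// lerD// FK.
- by move=> n; apply/measurable_EFinP; have [/intg_measurable] := seg n.
- by move=> n x; rewrite /= in_itv/= => /inD Dx; rewrite lee_fin f0.
Qed.

Lemma exhaust_FTC (la lb : R) : intg D f ->
  F (a n) @[n --> \oo] --> la -> F (b n) @[n --> \oo] --> lb ->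
  \int[mu]_(x in D) f x = lb - la.
Proof.
move=> fi Fa Fb.
have mf := intg_measurable fi.
have [||||_ c1] := @Rintegral_dominated_cvg _ D (fun n x => f x * \1_(`[a n, b n]%classic : set mT) x) f (fun x => `|f x|) mD.
- move=> n; apply: measurable_funM => //; exact: measurable_indic.
- move=> x Dx; apply: cvg_near_cst.
  have := Dx; rewrite DE => -[N _ /=]; rewrite in_itv/= => xN.
  exists N => // n /= Nn; rewrite indicE mem_set ?mulr1//= in_itv/=.
  exact: nd xN.
- move=> n x Dx; rewrite normrM indicE; case: (_ \in _) => /=.
    by rewrite normr1 mulr1.
  by rewrite normr0 mulr0.
- exact: integrable_norm.
have c2 : (fun n => \int[mu]_(x in D) (f x * \1_(`[a n, b n]%classic : set mT) x))
    @ \oo --> lb - la.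
  rewrite (_ : (fun _ => _) = (fun n => F (b n) - F (a n))); first exact: cvgB.
  apply/funext => n; have [_ <-] := seg n.
  rewrite [LHS]Rintegral_mkcond [RHS]Rintegral_mkcond.
  apply: eq_Rintegral => x _; rewrite !patchE indicE.
  have [/set_mem /=|_] := boolP (x \in `[a n, b n]%classic); last first.
    by rewrite mulr0; case: ifP.
  by rewrite in_itv/= => /inD Dx; rewrite mem_set// mulr1.
exact: (cvg_unique _ c1 c2).
Qed.
End exhaust.

Lemma exhaust_0y : (`]0, +oo[%classic : set R) = \bigcup_n `[n.+2%:R^-1, n.+2%:R]%classic.
Proof.
apply/seteqP; split => x /=; rewrite ?in_itv/= ?andbT.
  move=> x0; pose N := (Num.bound x + Num.bound x^-1)%N.
  exists N => //=; rewrite in_itv/=; apply/andP; split.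
    rewrite invf_ple ?posrE// (le_trans (ltW (archi_boundP _)))// ?invr_ge0 ?(ltW x0)//.
    by rewrite ler_nat; apply/leqW/leqW; exact: leq_addl.
  rewrite (le_trans (ltW (archi_boundP (ltW x0))))// ler_nat.
  by apply/leqW/leqW; exact: leq_addr.
move=> [n _ /=]; rewrite in_itv/= => /andP[h _]; exact: lt_le_trans h.
Qed.

Lemma exhaust_0y_nd (m n : nat) (x : R) : (m <= n)%N ->
  m.+2%:R^-1 <= x <= m.+2%:R -> n.+2%:R^-1 <= x <= n.+2%:R.
Proof.
move=> mn /andP[a b]; apply/andP; split.
  by rewrite (le_trans _ a)// lef_pV2 ?posrE// ler_nat !ltnS.
by rewrite (le_trans b)// ler_nat !ltnS.
Qed.

Lemma exhaust_0y_le (n : nat) : n.+2%:R^-1 <= (n.+2%:R : R).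
Proof. by rewrite (@le_trans _ _ 1)// ?invf_le1 ?ler1n// ltr0n. Qed.

Lemma exhaust_01 : (`]0, 1]%classic : set R) = \bigcup_n `[n.+2%:R^-1, 1]%classic.
Proof.
apply/seteqP; split => x /=; rewrite ?in_itv/= ?andbT.
  move=> /andP[x0 x1]; pose N := (Num.bound x^-1)%N.
  exists N => //=; rewrite in_itv/= x1 andbT.
  rewrite invf_ple ?posrE// (le_trans (ltW (archi_boundP _)))// ?invr_ge0 ?(ltW x0)//.
  by rewrite ler_nat; apply/leqW/leqW.
move=> [n _ /=]; rewrite !in_itv/= => /andP[h ->]; rewrite andbT; exact: lt_le_trans h.
Qed.

Lemma exhaust_1y : (`[1, +oo[%classic : set R) = \bigcup_n `[1, n.+1%:R]%classic.
Proof.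
apply/seteqP; split => x /=; rewrite ?in_itv/= ?andbT.
  move=> x1; have x0 : 0 <= x by rewrite (le_trans _ x1).
  exists (Num.bound x) => //=; rewrite in_itv/= x1/=.
  by rewrite (le_trans (ltW (archi_boundP x0)))// ler_nat.
by move=> [n _ /=]; rewrite !in_itv/= => /andP[->].
Qed.

Lemma intg_powR01 (p : R) : -1 < p -> intg `]0, 1] (fun t : R => t `^ p).
Proof.
move=> p1; have p0 : 0 < p + 1 by rewrite -ltrBlDr sub0r.
apply: (@exhaust_integrable _ (fun n => n.+2%:R^-1) (fun=> 1) _
   (fun t => (p + 1)^-1 * t `^ (p + 1)) exhaust_01 _ _ _ _ (p + 1)^-1).
- move=> m n x mn /andP[h ->]; rewrite andbT (le_trans _ h)//.
  by rewrite lef_pV2 ?posrE// ler_nat !ltnS.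
- by move=> n; rewrite invf_le1 ?ler1n// ltr0n.
- move=> x /=; rewrite in_itv/= => /andP[x0 _].
  have -> : x `^ p = (p + 1)^-1 * ((p + 1) * x `^ (p + 1 - 1)).
    by rewrite addrK mulKf// gt_eqF.
  by apply: der_scale; exact: is_derive1_powR.
- move=> x /=; rewrite in_itv/= => /andP[x0 _].
  by apply: is_derive_continuous; exact: is_derive1_powR.
- by move=> x _; exact: powR_ge0.
- move=> x /=; rewrite in_itv/= => /andP[x0 x1].
  rewrite normrM (gtr0_norm (powR_gt0 _ _))// gtr0_norm ?invr_gt0//.
  rewrite ger_pMr ?invr_gt0// -[leRHS](powRr0 x); apply: ger_powR; first by rewrite x0.
  exact: ltW.
Qed.

Lemma intg_powR1y (p : R) : p < -1 -> intg `[1, +oo[ (fun t : R => t `^ p).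
Proof.
move=> p1; have p0 : p + 1 < 0 by rewrite -ltrBrDr sub0r.
apply: (@exhaust_integrable _ (fun=> 1) (fun n => n.+1%:R) _
   (fun t => (p + 1)^-1 * t `^ (p + 1)) exhaust_1y _ _ _ _ (- (p + 1)^-1)).
- move=> m n x mn /andP[-> h]; rewrite (le_trans h)//.
  by rewrite ler_nat.
- by move=> n; rewrite ler1n.
- move=> x /=; rewrite in_itv/= => /andP[x1 _].
  have x0 : 0 < x by rewrite (lt_le_trans _ x1).
  have -> : x `^ p = (p + 1)^-1 * ((p + 1) * x `^ (p + 1 - 1)).
    by rewrite addrK mulKf// lt_eqF.
  by apply: der_scale; exact: is_derive1_powR.
- move=> x /=; rewrite in_itv/= => /andP[x1 _].
  have x0 : 0 < x by rewrite (lt_le_trans _ x1).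
  by apply: is_derive_continuous; exact: is_derive1_powR.
- by move=> x _; exact: powR_ge0.
- move=> x /=; rewrite in_itv/= => /andP[x1 _].
  have x0 : 0 < x by rewrite (lt_le_trans _ x1).
  rewrite normrM (gtr0_norm (powR_gt0 _ _))// ltr0_norm ?invr_lt0//.
  rewrite ger_pMr ?oppr_gt0 ?invr_lt0// -[leRHS](powRr0 x); apply: ler_powR => //.
  exact: ltW.
Qed.

Lemma intg_setU D1 D2 f : measurable D1 -> measurable D2 ->
  intg D1 f -> intg D2 f -> intg (D1 `|` D2) f.
Proof.
move=> m1 m2 i1 i2; have m12 : measurable (D1 `|` D2) by exact: measurableU.
have mf : measurable_fun (D1 `|` D2) f.
  by apply/measurable_funU => //; split; exact: intg_measurable.
have j D : measurable D -> intg D f -> intg setT (fun x => `|f x| * \1_D x).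
  move=> mD /integrable_norm/(integrable_mkcond _ mD).
  apply: eq_integrable => // x _; rewrite /= patchE indicE.
  by case: ifPn => _; rewrite ?mulr1 ?mulr0.
have := intgD measurableT (j _ m1 i1) (j _ m2 i2) => /(integrableS measurableT m12 (@subsetT _ _)).
apply: intg_le => // x D12; rewrite !indicE.
have := mulr_ge0 (normr_ge0 (f x)) (ler0n R (x \in D1)).
have := mulr_ge0 (normr_ge0 (f x)) (ler0n R (x \in D2)).
by case: D12 => /mem_set ->; rewrite mulr1 => ? ?; rewrite ?lerDl ?lerDr.
Qed.

End improper.

(** * Laplace transforms of powers *)

Section laplace.
Context {R : realType}.
Local Notation mT := (measurableTypeR R).

(** This is p ln x <= p x at x = a t / p; the true maximum, at t = p / a, is
    smaller by the factor e^(- p). *)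
Lemma powR_expR_bound (p a t : R) : 0 < p -> 0 < a -> 0 < t ->
  t `^ p * expR (- (a * t)) <= expR (- (p * ln (a / p))).
Proof.
move=> p0 a0 t0; have d0 : 0 < a / p := divr_gt0 a0 p0.
rewrite /powR gt_eqF// -expRD ler_expR.
have lE : ln (a / p * t) = ln (a / p) + ln t by rewrite (@lnM _ (a / p)) ?posrE.
have := ln_sublinear (mulr_gt0 d0 t0); rewrite lE => /ltW.
rewrite -(ler_pM2l p0) mulrDr mulrA.
by rewrite (mulrC p (a / p)) divfK ?gt_eqF//; lra.
Qed.

Lemma measurable_laplace (s a : R) (D : set mT) :
  measurable_fun D (fun t => t `^ (s - 1) * expR (- (a * t))).
Proof.
apply: measurable_funTS; apply: measurable_funM.
  exact: measurable_powR.
apply: measurableT_comp => //; apply: measurableT_comp => //.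
Qed.

Lemma intg_laplace (s a : R) : 0 < s -> 0 < a ->
  intg `]0, +oo[ (fun t => t `^ (s - 1) * expR (- (a * t))).
Proof.
move=> s0 a0; apply: (@integrableS _ _ _ _ (`]0, 1]%classic `|` `[1, +oo[%classic : set mT)) => //.
- by apply: measurableU.
- move=> x /=; rewrite !in_itv/= !andbT => x0; have [x1|x1] := leP x 1.
    by left; rewrite x0.
  by right; exact: ltW.
apply: intg_setU => //.
  apply: (@intg_le _ _ _ (fun t => t `^ (s - 1))) => //.
  - exact: measurable_laplace.
  - move=> x /=; rewrite in_itv/= => /andP[x0 _].
    rewrite ger0_norm ?mulr_ge0 ?powR_ge0 ?expR_ge0// ler_piMr ?powR_ge0//.
    by rewrite -expR0 ler_expR oppr_le0 mulr_ge0// ltW.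
  - by apply: intg_powR01; lra.
have s1 : 0 < s + 1 by lra.
apply: (@intg_le _ _ _ (fun t => expR (- ((s + 1) * ln (a / (s + 1)))) * t `^ (- 2))) => //.
- exact: measurable_laplace.
- move=> x /=; rewrite in_itv/= andbT => x1.
  have x0 : 0 < x by rewrite (lt_le_trans _ x1).
  rewrite ger0_norm ?mulr_ge0 ?powR_ge0 ?expR_ge0//.
  rewrite (_ : s - 1 = s + 1 + (- 2)); last by lra.
  rewrite powRD; last by rewrite (gt_eqF x0) implybT.
  rewrite mulrAC ler_wpM2r ?powR_ge0//.
  exact: powR_expR_bound.
- by apply: intgZl => //; apply: intg_powR1y; lra.
Qed.

(** Substitution t -> r t: Lebesgue measure is [r] times its own pushforward
    under the dilation, by uniqueness on intervals. *)
Lemma GammaE (s r : R) : 0 < s -> 0 < r ->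
  \int[mu]_(t in `]0, +oo[) (t `^ (s - 1) * expR (- (r * t))) =
  Gamma s * r `^ (- s).
Proof.
move=> s0 r0.
have mphi : measurable_fun setT (fun x : mT => r * x : mT) by exact: measurable_funM.
pose pf : {measure set mT -> \bar R} :=
  measure_function_pushforward__canonical__measure_function_Measure (@lebesgue_measure R) mphi.
pose nu := mscale (NngNum (ltW r0)) pf.
have muphi (A : set mT) : measurable A -> mu A = nu A.
  move=> mA; apply: lebesgue_measure_unique mA => _ [[c d] _ <-].
  have E : (fun x : mT => r * x : mT) @^-1` `]c, d] = `]c / r, d / r]%classic.
    by apply/seteqP; split => x /=; rewrite !in_itv/= ltr_pdivrMr// ler_pdivlMr// !(mulrC x).
  transitivity (r%:E * lebesgue_measure (`](c / r)%R, (d / r)%R]%classic : set mT))%E; last first.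
    by rewrite -E.
  rewrite /= !lebesgue_measure_itv/= !lte_fin ltr_pM2r ?invr_gt0//.
  case: (c < d); rewrite ?mule0// -!EFinB -EFinM.
  by congr EFin; field; rewrite gt_eqF.
pose D : set mT := `]0, +oo[%classic.
have mD : measurable D by exact: measurable_itv.
have pD : (fun x : mT => r * x : mT) @^-1` D = D.
  by rewrite /D; apply/seteqP; split => x /=; rewrite !in_itv/= !andbT pmulr_rgt0.
pose g (t : R) := t `^ (s - 1) * expR (- t).
have g0 t : 0 <= g t by rewrite mulr_ge0 ?powR_ge0 ?expR_ge0.
have mg : measurable_fun D (EFin \o g).
  apply/measurable_EFinP; have := @measurable_laplace s 1 D.
  by congr measurable_fun; apply/funext => t; rewrite mul1r.
have iD := intg_laplace s0 r0.
have GE : (\int[mu]_(t in D) (g t)%:E)%E =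
   (r%:E * ((r `^ (s - 1))%:E * \int[mu]_(t in D) (t `^ (s - 1) * expR (- (r * t)))%:E))%E.
  rewrite (@eq_measure_integral _ _ _ D nu); last by move=> A mA _; exact: muphi.
  rewrite ge0_integral_mscale//; last by move=> t _; rewrite lee_fin.
  congr (_ * _)%E; rewrite ge0_integral_pushforward//; last first.
    by move=> t _; rewrite lee_fin.
  rewrite pD -integralZl//; apply: eq_integral => t /set_mem; rewrite /D/= in_itv/= andbT => t0.
  by rewrite -EFinM /g/= powRM ?(ltW r0) ?(ltW t0)// mulrA.
have fD := integrable_fin_num mD iD.
rewrite /Gamma /Rintegral -/D GE !fineM//; last by rewrite fin_numM.
rewrite /= mulrA mulr_powRB1 ?(ltW r0)// powRN mulrAC mulfV ?mul1r//.
by rewrite gt_eqF// powR_gt0.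
Qed.

Lemma Gamma_gt0 (s : R) : 0 < s <= 1 -> 0 < Gamma s.
Proof.
move=> /andP[s0 s1].
have i1 : intg `]0, +oo[ (fun t => t `^ (s - 1) * expR (- t)).
  have := intg_laplace s0 ltr01; apply: eq_integrable => // t _ /=; by rewrite mul1r.
have sub : (`]0, 1]%classic : set mT) `<=` `]0, +oo[%classic.
  by move=> x /=; rewrite !in_itv/= => /andP[->].
apply: (@lt_le_trans _ _ (\int[mu]_(t in `]0%R, 1%R]) (expR (- 1)))).
  rewrite Rintegral_cst//= lebesgue_measure_itv/= lte01 mulr_gt0 ?expR_gt0//.
  by rewrite -EFinB/= subr0.
apply: (@le_trans _ _ (\int[mu]_(t in `]0%R, 1%R]) (t `^ (s - 1) * expR (- t)))).
  apply: le_Rintegral => //.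
  - apply: measurable_bounded_integrable => //.
      by rewrite /= lebesgue_measure_itv/= lte01 -EFinB ltry.
    by exists (expR (-1)); split => // M h x _; rewrite ger0_norm ?expR_ge0// ltW.
  - exact: (integrableS _ _ sub).
  - move=> x /=; rewrite in_itv/= => /andP[x0 x1].
    rewrite -[leLHS]mul1r ler_pM ?expR_ge0//.
      by rewrite -[leLHS](powRr0 x) ger_powR ?x0//; lra.
    by rewrite ler_expR lerN2.
rewrite /Gamma /Rintegral fine_le//.
- apply: integrable_fin_num => //; exact: (integrableS _ _ sub).
- exact: integrable_fin_num.
- apply: ge0_subset_integral => //.
    apply/measurable_EFinP; exact: (intg_measurable i1).
  by move=> t _; rewrite lee_fin mulr_ge0 ?powR_ge0 ?expR_ge0.
Qed.

End laplace.

Lemma cvg_inv2 {R : realType} : (fun n => n.+2%:R^-1 : R) @ \oo --> (0 : R).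
Proof. by have := @cvg_harmonic R; rewrite -cvg_shiftS. Qed.

Lemma cvg_atan_div {R : realType} (z : R) : 0 < z ->
  (fun n => atan (z / n.+2%:R^-1)) @ \oo --> pi / 2.
Proof.
move=> z0; apply: (@cvg_comp _ _ _ (fun n => z / n.+2%:R^-1) (@atan R)); last exact: cvgy_atan.
apply/cvgryPge => A; near=> n; rewrite invrK -ler_pdivrMl//.
near: n; exists (Num.bound `|z^-1 * A|) => // n /= hn.
rewrite (le_trans (ler_norm _))// (le_trans (ltW (archi_boundP (normr_ge0 _))))//.
by rewrite ler_nat; apply/leqW/leqW.
Unshelve. all: by end_near. Qed.

Lemma measurable_fun_cos {R : realType} d (T : measurableType d) (D : set T) (g : T -> R) :
  measurable_fun D g -> measurable_fun D (fun x => cos (g x)).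
Proof.
move=> mg; apply: (@measurableT_comp _ _ _ _ _ _ (@cos R)) => //.
by apply: continuous_measurable_fun; exact: continuous_cos.
Qed.

Lemma measurable_fun_sin {R : realType} d (T : measurableType d) (D : set T) (g : T -> R) :
  measurable_fun D g -> measurable_fun D (fun x => sin (g x)).
Proof.
move=> mg; apply: (@measurableT_comp _ _ _ _ _ _ (@sin R)) => //.
by apply: continuous_measurable_fun; exact: continuous_sin.
Qed.

(** The Laplace transform at the complex argument rho e^(- i th) is computed by
    rotation. Turning the phase back by s th makes the integral [N th] of
    [f th t] constant: differentiating in th under the integral sign gives [df],
    which is also the t-derivative of [Psi], and [Psi] vanishes at both ends of
    the half-line. At th = 0 the integral is a Gamma function. *)
Section laplace_angle.
Context {R : realType}.
Local Notation mT := (measurableTypeR R).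
Variables (s rho y : R).
Hypotheses (s0 : 0 < s) (rho0 : 0 < rho).
Local Notation D := (`]0, +oo[%classic : set mT).

Let f (th t : R) : R := t `^ (s - 1) * expR (- (rho * cos th * t)) *
  cos (y - s * th + rho * sin th * t).

Let df (th t : R) : R := t `^ (s - 1) * expR (- (rho * cos th * t)) *
  (rho * sin th * t * cos (y - s * th + rho * sin th * t) +
   (s - rho * cos th * t) * sin (y - s * th + rho * sin th * t)).

Let Psi (th t : R) : R := t `^ s * expR (- (rho * cos th * t)) *
  sin (y - s * th + rho * sin th * t).

Let f_der (th t : R) : is_derive th 1 (f ^~ t) (df th t).
Proof.
have dA : is_derive th 1 (fun th => - (rho * cos th * t)) (rho * sin th * t).
  apply: (der_eq (der_opp (der_mul (der_scale rho (is_derive_cos th)) (der_cst t th)))).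
  by ring.
have dB : is_derive th 1 (fun th => y - s * th + rho * sin th * t) (- s + rho * cos th * t).
  apply: (der_eq (der_add (der_sub (der_cst y th) (der_scale s (der_id th)))
    (der_mul (der_scale rho (is_derive_sin th)) (der_cst t th)))).
  by ring.
apply: (der_eq (der_mul (der_scale (t `^ (s - 1)) (der_comp (is_derive_expR _) dA))
                        (der_comp (is_derive_cos _) dB))).
by rewrite /df; ring.
Qed.

Let Psi_der (th t : R) : 0 < t -> is_derive t 1 (Psi th) (df th t).
Proof.
move=> t0.
have dA : is_derive t 1 (fun t => - (rho * cos th * t)) (- (rho * cos th)).
  by apply: (der_eq (der_opp (der_scale (rho * cos th) (der_id t)))); ring.
have dB : is_derive t 1 (fun t => y - s * th + rho * sin th * t) (rho * sin th).
  exact: der_affine.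
apply: (der_eq (der_mul (der_mul (is_derive1_powR s t0) (der_comp (is_derive_expR _) dA))
                        (der_comp (is_derive_sin _) dB))).
have -> : t `^ s = t * t `^ (s - 1) by rewrite mulr_powRB1// ltW.
by rewrite /df; ring.
Qed.

Let df_cont (th t : R) : 0 < t -> {for t, continuous (df th)}.
Proof.
move=> t0; rewrite /df.
have c1 : {for t, continuous (fun t : R => t `^ (s - 1))}.
  by apply: is_derive_continuous; exact: is_derive1_powR.
have cm (a : R) : {for t, continuous (fun t : R => a * t)}.
  by apply: is_derive_continuous; exact: (der_scale a (der_id t)).
have ca (a b : R) : {for t, continuous (fun t : R => b + a * t)}.
  exact: (is_derive_continuous (der_affine a b t)).
have ce : {for t, continuous (fun t : R => expR (- (rho * cos th * t)))}.
  exact: (is_derive_continuous (der_comp (is_derive_expR _) (der_opp (der_scale (rho * cos th) (der_id t))))).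
have cc : {for t, continuous (fun t : R => cos (y - s * th + rho * sin th * t))}.
  exact: (is_derive_continuous (der_comp (is_derive_cos _) (der_affine _ _ t))).
have cs : {for t, continuous (fun t : R => sin (y - s * th + rho * sin th * t))}.
  exact: (is_derive_continuous (der_comp (is_derive_sin _) (der_affine _ _ t))).
apply: cvgM; first exact: cvgM.
apply: cvgD; apply: cvgM => //.
- exact: cm.
- by apply: cvgB; [exact: cvg_cst|exact: cm].
Qed.

Let mD : measurable D. Proof. exact: measurable_itv. Qed.

Let mf (th : R) : measurable_fun D (f th).
Proof.
apply: measurable_funM; first exact: measurable_laplace.
apply: measurable_funTS; apply: measurable_fun_cos.
by apply: measurable_funD => //; exact: measurable_funM.
Qed.

Variable th1 : R.
Hypotheses (th10 : 0 <= th1) (th12 : th1 < pi / 2).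

(* An angle strictly between th1 and pi / 2: on ]- th2, th2[ the exponentials
   decay at the common rate rho * cos th2, as domination requires. *)
Let th2 := (th1 + pi / 2) / 2.

Let th2_lt : th1 < th2 < pi / 2.
Proof. by rewrite /th2; apply/andP; split; have := th12; lra. Qed.

Let c := cos th2.

Let c0 : 0 < c.
Proof.
apply: cos_gt0_pihalf; have /andP[h1 ->] := th2_lt; rewrite andbT.
by have := @pi_gt0 R; have := th10; lra.
Qed.

Let cos_lb (th : R) : th \in `]- th2, th2[ -> c <= cos th.
Proof.
rewrite in_itv/= => /andP[a b]; rewrite -(cos_norm th) /c.
have /andP[h1 h2] := th2_lt.
have n1 : `|th| < th2 by rewrite ltr_norml a b.
have p0 := @pi_gt0 R; have n0 := normr_ge0 th; have t1 := th10.
by apply/ltW; rewrite ltr_cos// in_itv/= ?n0/=; lra.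
Qed.

Let e_le (th t : R) : th \in `]- th2, th2[ -> 0 < t ->
  expR (- (rho * cos th * t)) <= expR (- (rho * c * t)).
Proof.
move=> /cos_lb h t0; rewrite ler_expR lerN2.
by apply: ler_wpM2r; [exact: ltW|apply: ler_wpM2l => //; exact: ltW].
Qed.

Let G (t : R) := t `^ (s - 1) * expR (- (rho * c * t)) * (s + 2 * rho * `|t|).

Let intG : intg D G.
Proof.
have rc0 : 0 < rho * c by rewrite mulr_gt0.
have s1 : 0 < s + 1 by have := s0; lra.
have := intgD mD (intgZl s mD (intg_laplace s0 rc0)) (intgZl (2 * rho) mD (intg_laplace s1 rc0)).
apply: intg_eq => // t /=; rewrite in_itv/= andbT => t0.
by rewrite /G (gtr0_norm t0) addrK -(mulr_powRB1 (ltW t0) s0); ring.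
Qed.

Let f_le (th t : R) : th \in `]- th2, th2[ -> D t -> `|f th t| <= t `^ (s - 1) * expR (- (rho * c * t)).
Proof.
move=> hth /=; rewrite in_itv/= andbT => t0.
rewrite /f normrM ger0_norm ?mulr_ge0 ?powR_ge0 ?expR_ge0//.
apply: le_trans (ler_piMr _ (cos_max _)) _.
  by rewrite mulr_ge0 ?powR_ge0 ?expR_ge0.
by apply: ler_wpM2l; [exact: powR_ge0|exact: e_le].
Qed.

Let df_le (th t : R) : th \in `]- th2, th2[ -> D t -> `|df th t| <= G t.
Proof.
move=> hth /=; rewrite in_itv/= andbT => t0.
have p0 : 0 <= t `^ (s - 1) * expR (- (rho * cos th * t)).
  by rewrite mulr_ge0 ?powR_ge0 ?expR_ge0.
rewrite /df /G normrM (ger0_norm p0) ler_pM//.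
  by apply: ler_wpM2l; [exact: powR_ge0|exact: e_le].
have rt : 0 <= rho * t by rewrite ltW// mulr_gt0.
have b1 (a x : R) : `|a| <= 1 -> `|rho * a * t * x| <= rho * t * `|x|.
  move=> ha; rewrite (_ : rho * a * t * x = rho * t * (a * x)); last by ring.
  by rewrite normrM (ger0_norm rt) ler_wpM2l// normrM ler_piMl.
rewrite (le_trans (ler_normD _ _))//.
rewrite (gtr0_norm t0).
have k1 := b1 (sin th) (cos (y - s * th + rho * sin th * t)) (sin_max _).
have k2 := b1 (cos th) (sin (y - s * th + rho * sin th * t)) (cos_max _).
have l1 : rho * t * `|cos (y - s * th + rho * sin th * t)| <= rho * t by rewrite ler_piMr// cos_max.
have l2 : rho * t * `|sin (y - s * th + rho * sin th * t)| <= rho * t by rewrite ler_piMr// sin_max.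
rewrite mulrBl.
have l3 : `|s * sin (y - s * th + rho * sin th * t)| <= s.
  by rewrite normrM (gtr0_norm s0) ler_piMr ?sin_max// ltW.
have := ler_normB (s * sin (y - s * th + rho * sin th * t)) (rho * cos th * t * sin (y - s * th + rho * sin th * t)).
by move: k1 k2 l1 l2 l3; rewrite -mulrA; lra.
Qed.

Let intf (th : R) : th \in `]- th2, th2[ -> intg D (f th).
Proof.
move=> hth; apply: (intg_le mD (mf th) (fun t => @f_le th t hth)).
by apply: intg_laplace => //; rewrite mulr_gt0.
Qed.

Let N (th : R) := \int[mu]_(t in D) f th t.

Let intdf0 (th : R) : th \in `]- th2, th2[ -> \int[mu]_(t in D) df th t = 0.
Proof.
move=> hth.
have dP t : D t -> is_derive t 1 (Psi th) (df th t).
  by rewrite /= in_itv/= andbT => t0; exact: Psi_der.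
have dc t : D t -> {for t, continuous (df th)}.
  by rewrite /= in_itv/= andbT => t0; exact: df_cont.
have mdf := exhaust_measurable exhaust_0y exhaust_0y_le dP dc.
have idf : intg D (df th) := intg_le mD mdf (fun t => @df_le th t hth) intG.
have ct0 : 0 < rho * cos th by rewrite mulr_gt0// (lt_le_trans c0)// cos_lb.
have Psi_le t : 0 < t -> `|Psi th t| <= t `^ s * expR (- (rho * cos th * t)).
  move=> t0; rewrite /Psi normrM ger0_norm ?mulr_ge0 ?powR_ge0 ?expR_ge0//.
  by rewrite ler_piMr ?sin_max// mulr_ge0 ?powR_ge0 ?expR_ge0.
rewrite (exhaust_FTC exhaust_0y exhaust_0y_nd exhaust_0y_le dP dc idf (la := 0) (lb := 0)) ?subr0//.
- apply/cvgr0Pnorm_le => e e0; near=> n.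
  have np : 0 < n.+2%:R^-1 :> R by rewrite invr_gt0.
  apply: (le_trans (Psi_le _ np)).
  apply: (@le_trans _ _ (n.+2%:R^-1 `^ s : R)).
    rewrite ler_piMr ?powR_ge0//.
    by rewrite -expR0 ler_expR oppr_le0 mulr_ge0// ltW.
  near: n.
  have h : (fun n => n.+2%:R^-1 `^ s : R) @ \oo --> (0 : R).
    apply: ((cvg_at_rightP (fun t : R => t `^ s) 0 0).1 (powR_cvg0 s0)).
    by split; [move=> n; rewrite invr_gt0|exact: cvg_inv2].
  move/cvgr0Pnorm_le : h => /(_ e e0); apply: filterS => n.
  by rewrite ger0_norm ?powR_ge0.
- set K := expR (- ((s + 1) * ln (rho * cos th / (s + 1)))).
  have s1 : 0 < s + 1 by have := s0; lra.
  have bd n : `|Psi th n.+2%:R| <= K * n.+2%:R^-1.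
    have np : 0 < n.+2%:R :> R by [].
    rewrite (le_trans (Psi_le _ np))// ler_pdivlMr// mulrAC.
    have -> : n.+2%:R `^ s * n.+2%:R = n.+2%:R `^ (s + 1).
      by rewrite -[RHS](mulr_powRB1 (ltW np) s1) addrK mulrC.
    exact: powR_expR_bound.
  apply: (@squeeze_cvgr _ _ _ _ (fun n => - (K * n.+2%:R^-1)) (fun n => K * n.+2%:R^-1)).
  + by apply: nearW => n; rewrite -ler_norml.
  + by rewrite -oppr0; apply: cvgN; rewrite -(mulr0 K); apply: cvgM; [exact: cvg_cst|exact: cvg_inv2].
  + by rewrite -(mulr0 K); apply: cvgM; [exact: cvg_cst|exact: cvg_inv2].
Unshelve. all: by end_near. Qed.

Let N_der (th : R) : th \in `]- th2, th2[ -> is_derive th 1 N 0.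
Proof.
move=> hth.
have d1E x t : partial1of2 f x t = df x t by apply: derive1_is_derive; exact: f_der.
have I (x : R) : `]- th2, th2[%classic x -> x \in `]- th2, th2[ by [].
have G0 t : 0 <= G t.
  by rewrite /G mulr_ge0// ?mulr_ge0 ?powR_ge0 ?expR_ge0// addr_ge0 ?mulr_ge0// ltW.
have H1 (x t : R) : `]- th2, th2[%classic x -> D t -> derivable (f ^~ t) x 1.
  by move=> _ _; have := f_der x t => ?; exact: ex_derive.
have H2 (x t : R) : `]- th2, th2[%classic x -> D t -> `|partial1of2 f x t| <= G t.
  by move=> /I hx Dt; rewrite d1E; exact: df_le.
have H3 (x : R) : `]- th2, th2[%classic x -> intg D (f x) by move=> /I; exact: intf.
have := @derivable_under_integral R _ mT mu f D mD th (- th2) th2 hth H3 H1 G G0 intG H2.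
have := @differentiation_under_integral R _ mT mu f D mD th (- th2) th2 hth H3 H1 G G0 intG H2.
rewrite (_ : \int[mu]_(t in D) _ = 0); last first.
  rewrite -[RHS](intdf0 hth); congr (Rintegral _ _ _).
  by apply/funext => t; exact: d1E.
by move=> h1 h2; split => //; rewrite -derive1E.
Qed.

Lemma laplace_angle_cst : N th1 = N 0.
Proof.
have /andP[h1 h2] := th2_lt; have h0 := th10.
have inI x : 0 <= x <= th1 -> x \in `]- th2, th2[.
  by rewrite in_itv/= => /andP[a b]; lra.
have [||z _] := @MVT_segment R N (fun=> 0) 0 th1 th10.
- move=> x; rewrite in_itv/= => /andP[a b]; apply: N_der; apply: inI.
  by rewrite !ltW.
- apply: continuous_in_subspaceT => x; rewrite inE/= in_itv/= => /inI /N_der.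
  exact: is_derive_continuous.
by rewrite mul0r => /eqP; rewrite subr_eq0 => /eqP.
Qed.

End laplace_angle.

Lemma laplace_angle {R : realType} (s rho y th : R) : 0 < s -> 0 < rho ->
  0 <= th < pi / 2 ->
  \int[mu]_(t in `]0, +oo[) (t `^ (s - 1) * expR (- (rho * cos th * t)) *
     cos (y + rho * sin th * t)) = Gamma s * rho `^ (- s) * cos (y + s * th).
Proof.
move=> s0 r0 /andP[t0 t1].
have := @laplace_angle_cst R s rho (y + s * th) s0 r0 th t0 t1.
rewrite (_ : y + s * th - s * th = y); last by ring.
move=> ->.
rewrite -GammaE// -RintegralZr//; last exact: intg_laplace.
by apply: eq_Rintegral_on => t _; rewrite cos0 sin0 !mulr0 mulr1 mul0r subr0 addr0.
Qed.

Section damped.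
Context {R : realType}.

(** The modulus of e + iw, whose argument is [atan (w / e)]; written with
    the cosine because the rotation lemma needs polar coordinates. *)
Definition damp (e w : R) : R := e / cos (atan (w / e)).

Lemma damp_polar (e w : R) : 0 < e -> 0 < w ->
  [/\ damp e w * cos (atan (w / e)) = e, damp e w * sin (atan (w / e)) = w &
   w <= damp e w <= w + e].
Proof.
move=> e0 w0; set th := atan (w / e); rewrite /damp -/th.
have c0 : 0 < cos th by apply: cos_gt0_pihalf; rewrite atan_gtNpi2 atan_ltpi2.
have E1 : e / cos th * cos th = e by rewrite divfK// gt_eqF.
have sE : sin th = w / e * cos th.
  by rewrite -(atanK (w / e)) -/th /tan divfK// gt_eqF.
have E2 : e / cos th * sin th = w.
  by rewrite sE; field; rewrite !gt_eqF.
have r0 : 0 < e / cos th by rewrite divr_gt0.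
split => //; apply/andP; split.
  rewrite -[leLHS]E2 ler_piMr// ?ltW//; exact: sin_le1.
rewrite -(ler_pXn2r (n := 2))// ?nnegrE ?ltW ?addr_gt0//.
have -> : (e / cos th) ^+ 2 = (e / cos th * sin th) ^+ 2 + (e / cos th * cos th) ^+ 2.
  by rewrite -[LHS]mulr1 -(cos2Dsin2 th); ring.
rewrite E1 E2 sqrrD; have := mulr_gt0 w0 e0; lra.
Qed.

(** The damped integral: the parameter e - iw has positive real part, hence
    an argument inside the half-plane where rotation applies. *)
Lemma laplace_damped (s e w y : R) : 0 < s -> 0 < e -> 0 < w ->
  \int[mu]_(t in `]0, +oo[) (t `^ (s - 1) * expR (- (e * t)) * cos (y + w * t)) =
  Gamma s * damp e w `^ (- s) * cos (y + s * atan (w / e)).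
Proof.
move=> s0 e0 w0; have [E1 E2 /andP[wr _]] := damp_polar e0 w0.
have r0 : 0 < damp e w by rewrite (lt_le_trans w0).
have := @laplace_angle R s (damp e w) y (atan (w / e)) s0 r0.
rewrite E1 E2 => -> //.
by rewrite atan_ltpi2 andbT -(@atan0 R) le_atan// divr_ge0// ltW.
Qed.

Lemma damp_le (s e w : R) : 0 < s -> 0 < e -> 0 < w -> damp e w `^ (- s) <= w `^ (- s).
Proof.
move=> s0 e0 w0; have [_ _ /andP[wr _]] := damp_polar e0 w0.
have r0 : 0 < damp e w by rewrite (lt_le_trans w0).
by rewrite !powRN lef_pV2 ?posrE ?powR_gt0// ge0_ler_powR// ?nnegrE ltW.
Qed.

(** As the damping disappears the modulus tends to w and the argument to
    pi / 2, which is how the phase s pi / 2 of fractional integration arises. *)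
Lemma damp_cvg (s w y : R) : 0 < s -> 0 < w ->
  (fun n => Gamma s * damp n.+2%:R^-1 w `^ (- s) * cos (y + s * atan (w / n.+2%:R^-1)))
   @ \oo --> Gamma s * w `^ (- s) * cos (y + s * (pi / 2)).
Proof.
move=> s0 w0.
have dw : (fun n => damp n.+2%:R^-1 w) @ \oo --> w.
  apply: (@squeeze_cvgr _ _ _ _ (fun=> w) (fun n => w + n.+2%:R^-1)).
  - by apply: nearW => n; have [] := @damp_polar n.+2%:R^-1 w; rewrite ?invr_gt0.
  - exact: cvg_cst.
  - by rewrite -[X in _ --> X]addr0; apply: cvgD; [exact: cvg_cst|exact: cvg_inv2].
apply: cvgM.
  apply: cvgM; first exact: cvg_cst.
  apply: (@cvg_comp _ _ _ (fun n => damp n.+2%:R^-1 w) (fun t : R => t `^ (- s))).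
    exact: dw.
  exact: is_derive_continuous (is_derive1_powR (- s) w0).
apply: (@cvg_comp _ _ _ (fun n => y + s * atan (w / n.+2%:R^-1)) (@cos R)); last exact: continuous_cos.
apply: cvgD; first exact: cvg_cst.
by apply: cvgM; [exact: cvg_cst|exact: cvg_atan_div].
Qed.

End damped.

(** * Cosine and sine transforms and their synthesis *)

Section transform.
Context {R : realType}.
Local Notation mT := (measurableTypeR R).
Implicit Types (f g k : R -> R) (w x y : R).

Definition cosT f w : R := \int[mu]_x (f x * cos (w * x)).
Definition sinT f w : R := \int[mu]_x (f x * sin (w * x)).
Definition phase f w y : R := cosT f w * cos y + sinT f w * sin y.
Definition amp f w : R := `|cosT f w| + `|sinT f w|.

Lemma measurable_lin w b (D : set mT) : measurable_fun D (fun x : R => b + w * x).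
Proof. by apply: measurable_funTS; apply: measurable_funD => //; exact: measurable_funM. Qed.

Lemma measurable_scal w (D : set mT) : measurable_fun D (fun x : R => w * x).
Proof. by apply: measurable_funTS; exact: measurable_funM. Qed.

Lemma intg_cos f w b : intg setT f -> intg setT (fun x => f x * cos (b + w * x)).
Proof.
move=> fi; apply: (@intgM_bounded _ _ _ _ 1) => //.
  by apply: measurable_fun_cos; exact: measurable_lin.
by move=> x _; exact: cos_max.
Qed.

Lemma intg_cos0 f w : intg setT f -> intg setT (fun x => f x * cos (w * x)).
Proof. by move=> /(intg_cos w 0); apply: intg_eq => // x _; rewrite add0r. Qed.

Lemma intg_sin0 f w : intg setT f -> intg setT (fun x => f x * sin (w * x)).
Proof.
move=> fi; apply: (@intgM_bounded _ _ _ _ 1) => //.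
  by apply: measurable_fun_sin; exact: measurable_scal.
by move=> x _; exact: sin_max.
Qed.

Lemma phaseE f w y : intg setT f ->
  \int[mu]_x (f x * cos (y - w * x)) = phase f w y.
Proof.
move=> fi; rewrite /phase /cosT /sinT.
rewrite -!RintegralZr//; [|exact: intg_sin0|exact: intg_cos0].
rewrite -RintegralD//.
- by apply: eq_Rintegral_on => x _; rewrite cosB; ring.
- apply: (intg_eq _ _ (intgZl (cos y) _ (intg_cos0 w fi))) => // x _; exact: mulrC.
- apply: (intg_eq _ _ (intgZl (sin y) _ (intg_sin0 w fi))) => // x _; exact: mulrC.
Qed.

Lemma amp_ge0 f w : 0 <= amp f w.
Proof. by rewrite addr_ge0. Qed.

Lemma phase_le f w y : `|phase f w y| <= amp f w.
Proof.
rewrite /phase (le_trans (ler_normD _ _))// /amp !normrM.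
by apply: lerD; rewrite ler_piMr// ?cos_max ?sin_max.
Qed.

Lemma amp_le f w : intg setT f -> amp f w <= 2 * \int[mu]_x `|f x|.
Proof.
move=> fi; rewrite mulr2n mulrDl mul1r; apply: lerD; apply: le_norm_Rintegral => //.
- exact: (intg_measurable (intg_cos0 w fi)).
- by move=> x _; rewrite normrM ler_piMr// cos_max.
- exact: integrable_norm.
- exact: (intg_measurable (intg_sin0 w fi)).
- by move=> x _; rewrite normrM ler_piMr// sin_max.
- exact: integrable_norm.
Qed.

Lemma cosT_continuous f : intg setT f -> continuous (cosT f).
Proof.
move=> fi w; have hw : w \in `]w - 1, w + 1[.
  by rewrite in_itv/= ltrDl ltrBlDr ltrDl ltr01.
apply: (@continuity_under_integral R _ mT mu (fun w x => f x * cos (w * x)) setT measurableT (w - 1) (w + 1) _ _ (fun x => `|f x|)) => //.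
- by move=> x _; exact: intg_cos0.
- apply: aeW => x _ v _; apply: cvgM; first exact: cvg_cst.
  apply: (is_derive_continuous (der_comp (is_derive_cos _) (der_mul (der_id v) (der_cst x v)))).
- exact: integrable_norm.
- by move=> v _; apply: aeW => x _; rewrite normrM ler_piMr// cos_max.
- exact/mem_set.
Qed.

Lemma sinT_continuous f : intg setT f -> continuous (sinT f).
Proof.
move=> fi w; have hw : w \in `]w - 1, w + 1[.
  by rewrite in_itv/= ltrDl ltrBlDr ltrDl ltr01.
apply: (@continuity_under_integral R _ mT mu (fun w x => f x * sin (w * x)) setT measurableT (w - 1) (w + 1) _ _ (fun x => `|f x|)) => //.
- by move=> x _; exact: intg_sin0.
- apply: aeW => x _ v _; apply: cvgM; first exact: cvg_cst.
  apply: (is_derive_continuous (der_comp (is_derive_sin _) (der_mul (der_id v) (der_cst x v)))).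
- exact: integrable_norm.
- by move=> v _; apply: aeW => x _; rewrite normrM ler_piMr// sin_max.
- exact/mem_set.
Qed.

Lemma measurable_cosT f (D : set mT) : intg setT f -> measurable_fun D (cosT f).
Proof.
by move=> fi; apply: measurable_funTS; apply: continuous_measurable_fun; exact: cosT_continuous.
Qed.

Lemma measurable_sinT f (D : set mT) : intg setT f -> measurable_fun D (sinT f).
Proof.
by move=> fi; apply: measurable_funTS; apply: continuous_measurable_fun; exact: sinT_continuous.
Qed.

Lemma measurable_amp f (D : set mT) : intg setT f -> measurable_fun D (amp f).
Proof.
by move=> fi; apply: measurable_funD; apply: measurableT_comp => //; [exact: measurable_cosT|exact: measurable_sinT].
Qed.

Lemma measurable_phase f (d : measure_display) (T : measurableType d) (D : set T) (a b : T -> mT) :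
  intg setT f -> measurable_fun D a -> measurable_fun D b ->
  measurable_fun D (fun z => phase f (a z) (b z)).
Proof.
move=> fi ma mb; apply: measurable_funD; apply: measurable_funM.
- by apply: (@measurableT_comp _ _ _ T mT mT (cosT f) D a) => //; exact: measurable_cosT.
- exact: measurable_fun_cos.
- by apply: (@measurableT_comp _ _ _ T mT mT (sinT f) D a) => //; exact: measurable_sinT.
- exact: measurable_fun_sin.
Qed.

(** This is the real part of e^(iy) k^(w) f^(w), with f^(w) = cosT - i sinT;
    the factor - i becomes the shift of y by - pi / 2. *)
Lemma phase_conv k f w y : intg setT k -> intg setT f ->
  phase (conv k f) w y = cosT f w * phase k w y + sinT f w * phase k w (y - pi / 2).
Proof.
move=> ki fi.
have mc : measurable_fun (setT : set mT) (fun x => cos (y - w * x)).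
  by apply: measurable_fun_cos; apply: measurable_funB => //; exact: measurable_scal.
have cb x : `|cos (y - w * x)| <= 1 by exact: cos_max.
have [ic] := conv_integrable ki fi mc cb.
rewrite phaseE// => ->.
rewrite -!phaseE// -!RintegralZl//.
- rewrite -RintegralD//.
  + apply: eq_Rintegral_on => t _; rewrite -addrAC cosBpihalf.
    rewrite mulrCA (mulrCA (sinT f w)) -mulrDr; congr (_ * _).
    rewrite -[RHS]/(phase f w (y - w * t)) -phaseE//.
    by apply: eq_Rintegral_on => x _; congr (_ * cos _); ring.
  + apply: intgZl => //; apply: (intg_eq _ _ (intg_cos (- w) y ki)) => // x _.
    by rewrite mulNr.
  + apply: intgZl => //; apply: (intg_eq _ _ (intg_cos (- w) (y - pi / 2) ki)) => // x _.
    by rewrite mulNr.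
- apply: (intg_eq _ _ (intg_cos (- w) (y - pi / 2) ki)) => // x _.
  by rewrite mulNr.
- apply: (intg_eq _ _ (intg_cos (- w) y ki)) => // x _.
  by rewrite mulNr.
Qed.

Definition synth f b phi x : R :=
  pi^-1 * \int[mu]_(w in `]0, +oo[) (w `^ b * phase f w (w * x + phi)).

Local Notation D := (`]0, +oo[%classic : set mT).
Let mD : measurable D. Proof. exact: measurable_itv. Qed.

Lemma amp_powR0 f : intg D (amp f) -> intg D (fun w => w `^ 0 * amp f w).
Proof. by apply: intg_eq => // u _; rewrite powRr0 mul1r. Qed.

Lemma synth_measurable f b phi x : intg setT f ->
  measurable_fun D (fun w => w `^ b * phase f w (w * x + phi)).
Proof.
move=> fi; apply: measurable_funM; first exact: measurable_funTS (measurable_powR _).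
apply: measurable_phase => //; apply: measurable_funTS; apply: measurable_funD => //.
exact: measurable_funM.
Qed.

Lemma synth_le f b phi x w : `|w `^ b * phase f w (w * x + phi)| <= w `^ b * amp f w.
Proof. by rewrite normrM (ger0_norm (powR_ge0 _ _)) ler_wpM2l ?powR_ge0// phase_le. Qed.

Lemma synth_integrable f b phi x : intg setT f -> intg D (fun w => w `^ b * amp f w) ->
  intg D (fun w => w `^ b * phase f w (w * x + phi)).
Proof.
by move=> fi; apply: intg_le => //; [exact: synth_measurable|move=> w _; exact: synth_le].
Qed.

Lemma phase_der f w y : is_derive y 1 (phase f w) (phase f w (y + pi / 2)).
Proof.
apply: (der_eq (der_add (der_scale (cosT f w) (is_derive_cos y)) (der_scale (sinT f w) (is_derive_sin y)))).
by rewrite /phase cosDpihalf sinDpihalf.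
Qed.

Lemma synth_continuous f b phi : intg setT f -> intg D (fun w => w `^ b * amp f w) ->
  continuous (synth f b phi).
Proof.
move=> fi ai x; have hx : x \in `]x - 1, x + 1[.
  by rewrite in_itv/= ltrDl ltrBlDr ltrDl ltr01.
apply: cvgM; first exact: cvg_cst.
apply: (@continuity_under_integral R _ mT mu (fun x w => w `^ b * phase f w (w * x + phi)) D mD
  (x - 1) (x + 1) _ _ (fun w => w `^ b * amp f w)) => //.
- by move=> v _; exact: synth_integrable.
- apply: aeW => w _ v _; apply: cvgM; first exact: cvg_cst.
  apply: (is_derive_continuous (der_comp (phase_der _ _ _) (der_add (der_scale w (der_id v)) (der_cst phi v)))).
- by move=> v _; apply: aeW => w _; exact: synth_le.
- exact/mem_set.
Qed.

Lemma synth_bounded f b phi x : intg setT f -> intg D (fun w => w `^ b * amp f w) ->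
  `|synth f b phi x| <= pi^-1 * \int[mu]_(w in D) (w `^ b * amp f w).
Proof.
move=> fi ai; rewrite normrM gtr0_norm ?invr_gt0 ?pi_gt0// ler_wpM2l ?invr_ge0 ?pi_ge0//.
by apply: le_norm_Rintegral => //; [exact: synth_measurable|move=> w _; exact: synth_le].
Qed.

(** Differentiation under the integral sign: each derivative brings down a factor
    w and advances the cosine and the sine by a quarter turn. *)
Lemma synth_der f b phi x : intg setT f -> intg D (fun w => w `^ b * amp f w) ->
  intg D (fun w => w `^ (b + 1) * amp f w) ->
  is_derive x 1 (synth f b phi) (synth f (b + 1) (phi + pi / 2) x).
Proof.
move=> fi ai ai1; have hx : x \in `]x - 1, x + 1[.
  by rewrite in_itv/= ltrDl ltrBlDr ltrDl ltr01.
pose F x w := w `^ b * phase f w (w * x + phi).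
have dF (v w : R) : D w -> is_derive v 1 (F ^~ w) (w `^ (b + 1) * phase f w (w * v + (phi + pi / 2))).
  rewrite /= in_itv/= andbT => w0.
  apply: (der_eq (der_scale (w `^ b) (der_comp (phase_der f w _) (der_add (der_scale w (der_id v)) (der_cst phi v))))).
  rewrite addr0 mulr1 addrA powRD; last by rewrite (gt_eqF w0) implybT.
  by rewrite powRr1 ?ltW//; ring.
have d1E (v w : R) : D w -> partial1of2 F v w = w `^ (b + 1) * phase f w (w * v + (phi + pi / 2)).
  by move=> Dw; apply: derive1_is_derive; exact: dF.
have H1 (v w : R) : `]x - 1, x + 1[%classic v -> D w -> derivable (F ^~ w) v 1.
  by move=> _ Dw; have := dF v w Dw => ?; exact: ex_derive.
have H2 (v w : R) : `]x - 1, x + 1[%classic v -> D w -> `|partial1of2 F v w| <= w `^ (b + 1) * amp f w.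
  by move=> _ Dw; rewrite d1E//; exact: synth_le.
have H3 (v : R) : `]x - 1, x + 1[%classic v -> intg D (F v) by move=> _; exact: synth_integrable.
have G0 w : 0 <= w `^ (b + 1) * amp f w by rewrite mulr_ge0 ?powR_ge0 ?amp_ge0.
have h1 := @derivable_under_integral R _ mT mu F D mD x (x - 1) (x + 1) hx H3 H1 _ G0 ai1 H2.
have h2 := @differentiation_under_integral R _ mT mu F D mD x (x - 1) (x + 1) hx H3 H1 _ G0 ai1 H2.
apply: der_scale; split => //; rewrite -derive1E h2.
by apply: eq_Rintegral_on => w Dw; exact: d1E.
Qed.

End transform.

(** * Fourier inversion *)

Section inversion.
Context {R : realType}.
Local Notation mT := (measurableTypeR R).
Local Notation D := (`]0, +oo[%classic : set mT).
Let mD : measurable D. Proof. exact: measurable_itv. Qed.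

(** The Laplace transform of the cosine; dividing by pi gives the Poisson
    kernel of the half-plane. *)
Definition poisson (e z : R) : R := e / (e ^+ 2 + z ^+ 2).

Lemma poisson_continuous e : 0 < e -> continuous (poisson e).
Proof.
move=> e0 z; have p0 : e ^+ 2 + z ^+ 2 != 0.
  by rewrite gt_eqF// ltr_pwDl ?exprn_gt0 ?sqr_ge0.
apply: cvgM; first exact: cvg_cst.
apply: cvgV => //; apply: cvgD; first exact: cvg_cst.
exact: exprn_continuous.
Qed.

Lemma intg_exp (e : R) : 0 < e -> intg D (fun w => expR (- (e * w))).
Proof.
move=> e0; have := intg_laplace ltr01 e0; apply: intg_eq => // w _.
by rewrite subrr powRr0 mul1r.
Qed.

Lemma expR_inv_cvg (e : R) : 0 < e -> (fun n => expR (- (e * n.+2%:R))) @ \oo --> (0 : R).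
Proof.
move=> e0; apply: (@squeeze_cvgr _ _ _ _ (fun=> 0) (fun n => e^-1 * n.+2%:R^-1)).
- apply: nearW => n; rewrite expR_ge0/= expRN -invfM lef_pV2 ?posrE ?expR_gt0 ?mulr_gt0//.
  by rewrite (le_trans _ (expR_ge1Dx _))// lerDr.
- exact: cvg_cst.
- by rewrite -(mulr0 e^-1); apply: cvgM; [exact: cvg_cst|exact: cvg_inv2].
Qed.

Lemma poisson_laplace (e z : R) : 0 < e ->
  \int[mu]_(w in D) (expR (- (e * w)) * cos (z * w)) = poisson e z.
Proof.
move=> e0; have p0 : e ^+ 2 + z ^+ 2 != 0.
  by rewrite gt_eqF// ltr_pwDl ?exprn_gt0 ?sqr_ge0.
pose F w := (e ^+ 2 + z ^+ 2)^-1 * (expR (- (e * w)) * (z * sin (z * w) - e * cos (z * w))).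
have dE (w : R) : is_derive w 1 (fun w => expR (- (e * w))) (expR (- (e * w)) * - (e * 1)).
  exact: (der_comp (is_derive_expR _) (der_opp (der_scale e (der_id w)))).
have dS (w : R) : is_derive w 1 (fun w => sin (z * w)) (cos (z * w) * (z * 1)).
  exact: (der_comp (is_derive_sin _) (der_scale z (der_id w))).
have dC (w : R) : is_derive w 1 (fun w => cos (z * w)) (- sin (z * w) * (z * 1)).
  exact: (der_comp (is_derive_cos _) (der_scale z (der_id w))).
have dF (w : R) : is_derive w 1 F (expR (- (e * w)) * cos (z * w)).
  apply: (der_eq (der_scale _ (der_mul (dE w) (der_sub (der_scale z (dS w)) (der_scale e (dC w)))))).
  by rewrite /GRing.scale/=; field.
have cf (w : R) : {for w, continuous (fun w => expR (- (e * w)) * cos (z * w))}.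
  exact: (is_derive_continuous (der_mul (dE w) (dC w))).
have fi : intg D (fun w => expR (- (e * w)) * cos (z * w)).
  apply: (@intgM_bounded _ _ _ _ 1) => //; first exact: intg_exp.
    by apply: measurable_fun_cos; exact: measurable_scal.
  by move=> x _; exact: cos_max.
rewrite (exhaust_FTC exhaust_0y exhaust_0y_nd exhaust_0y_le (fun w _ => dF w) (fun w _ => cf w) fi (la := F 0) (lb := 0)).
- by rewrite /F /poisson !mulr0 oppr0 expR0 sin0 cos0; field.
- apply: (@cvg_comp _ _ _ (fun n => n.+2%:R^-1 : R) F); first exact: cvg_inv2.
  exact: (is_derive_continuous (dF 0)).
- rewrite -(mulr0 (e ^+ 2 + z ^+ 2)^-1); apply: cvgM; first exact: cvg_cst.
  apply/cvgr0Pnorm_le => d d0.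
  have k0 : 0 < `|z| + e by rewrite ltr_wpDl.
  have := expR_inv_cvg e0 => /cvgr0Pnorm_le /(_ (d / (`|z| + e)) (divr_gt0 d0 k0)).
  apply: filterS => n; rewrite ger0_norm ?expR_ge0// ler_pdivlMr// => h.
  rewrite normrM ger0_norm ?expR_ge0// (le_trans _ h)// ler_wpM2l ?expR_ge0//.
  rewrite (le_trans (ler_normB _ _))// !normrM (gtr0_norm e0) lerD//.
    by rewrite ler_piMr// sin_max.
  by rewrite ler_piMr ?cos_max// ltW.
Qed.

Variable f : R -> R.
Hypotheses (fi : intg setT f) (ai : intg D (amp f)).

Let v := synth f 0 0.

Let ai0 := amp_powR0 ai.

Let P (e x : R) := \int[mu]_(w in D) (expR (- (e * w)) * phase f w (w * x)).

Let damped_measurable (e x : R) : measurable_fun D (fun w => expR (- (e * w)) * phase f w (w * x)).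
Proof.
apply: measurable_funM.
  by apply: measurableT_comp => //; apply: measurableT_comp => //; exact: measurable_scal.
by apply: measurable_phase => //; apply: measurable_funM.
Qed.

Let damped_le (e x w : R) : 0 < e -> D w -> `|expR (- (e * w)) * phase f w (w * x)| <= amp f w.
Proof.
move=> e0; rewrite /= in_itv/= andbT => w0.
rewrite normrM ger0_norm ?expR_ge0// -[leRHS]mul1r ler_pM ?expR_ge0 ?phase_le//.
by rewrite -expR0 ler_expR oppr_le0 mulr_ge0// ltW.
Qed.

Let P_poisson (e x : R) : 0 < e -> P e x = \int[mu]_y (f y * poisson e (x - y)).
Proof.
move=> e0.
transitivity (\int[mu]_(w in D) \int[mu]_y (expR (- (e * w)) * (f y * cos (w * x - w * y)))).
  apply: eq_Rintegral_on => w Dw; rewrite -phaseE// RintegralZl//.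
  by apply: (intg_eq _ _ (intg_cos (- w) (w * x) fi)) => // y _; rewrite mulNr.
rewrite (@Rintegral_Fubini _ D setT (fun z : mT * mT => expR (- (e * z.1)) * (f z.2 * cos (z.1 * x - z.1 * z.2)))
   (fun w => expR (- (e * w))) (fun y => `|f y|)) => //.
- apply: eq_Rintegral_on => y _; rewrite -poisson_laplace// -RintegralZl//.
    by apply: eq_Rintegral_on => w _ /=; rewrite mulrCA; congr (_ * (_ * cos _)); ring.
  apply: (@intgM_bounded _ _ _ _ 1) => //; first exact: intg_exp.
    by apply: measurable_fun_cos; exact: measurable_scal.
  by move=> w _; exact: cos_max.
- apply: measurable_funM.
    apply: measurableT_comp => //; apply: measurableT_comp => //; apply: measurable_funM => //.
  apply: measurable_funM.
    by apply: (measurableT_comp (intg_measurable fi)).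
  apply: measurable_fun_cos; apply: measurable_funB; apply: measurable_funM => //.
- move=> w y _ _ /=; rewrite normrM ger0_norm ?expR_ge0// ler_wpM2l ?expR_ge0//.
  by rewrite normrM ler_piMr// cos_max.
- exact: intg_exp.
- exact: integrable_norm.
Qed.

Let int_poisson (e a b y : R) : 0 < e -> a <= b ->
  intg `[a, b] (fun x => poisson e (x - y)) /\
  \int[mu]_(x in `[a, b]) poisson e (x - y) = atan ((b - y) / e) - atan ((a - y) / e).
Proof.
move=> e0 ab.
apply: (@Rintegral_FTC2 R (fun x => poisson e (x - y)) (fun x => atan ((x - y) / e)) a b ab).
  move=> x _.
  apply: (der_eq (der_comp (is_derive1_atan _) (der_mul (der_sub (der_id x) (der_cst y x)) (der_cst e^-1 x)))).
  rewrite /poisson; field; rewrite (gt_eqF e0) andbT gt_eqF// ltr_pwDl ?exprn_gt0 ?sqr_ge0//.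
move=> x _; apply: (@continuous_comp _ _ _ (fun x => x - y) (poisson e)).
  by apply: cvgB; [exact: cvg_id|exact: cvg_cst].
exact: poisson_continuous.
Qed.

Let int_P (e a b : R) : 0 < e -> a <= b ->
  \int[mu]_(x in `[a, b]) P e x =
  \int[mu]_y (f y * (atan ((b - y) / e) - atan ((a - y) / e))).
Proof.
move=> e0 ab; under eq_Rintegral do rewrite P_poisson//.
have mp : measurable_fun (setT : set (mT * mT)) (fun z => poisson e (z.1 - z.2)).
  have mp0 : measurable_fun (setT : set mT) (poisson e) by exact: (continuous_measurable_fun (poisson_continuous e0)).
  have ms : measurable_fun (setT : set (mT * mT)) (fun z => z.1 - z.2 : mT) by exact: measurable_funB.
  exact: (measurableT_comp mp0 ms).
have pb z : `|poisson e z| <= e^-1.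
  have q0 : 0 < e ^+ 2 + z ^+ 2 by rewrite ltr_pwDl ?exprn_gt0 ?sqr_ge0.
  rewrite /poisson ger0_norm; last by rewrite divr_ge0// ltW.
  rewrite ler_pdivrMr// mulrDr expr2 mulKf ?gt_eqF//.
  by rewrite lerDl mulr_ge0 ?sqr_ge0// invr_ge0 ltW.
rewrite (@Rintegral_Fubini _ `[a, b]%classic setT (fun z : mT * mT => f z.2 * poisson e (z.1 - z.2))
   (fun=> e^-1) (fun y => `|f y|)) => //.
- by apply: eq_Rintegral_on => y _; have [ip <-] := int_poisson y e0 ab; rewrite -RintegralZl.
- apply: measurable_funM; last exact: mp.
  by apply: (measurableT_comp (intg_measurable fi)).
- by move=> x y _ _ /=; rewrite normrM mulrC ler_wpM2r.
- apply: continuous_compact_integrable; first exact: segment_compact.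
  by apply: continuous_subspaceT => x; exact: cvg_cst.
- exact: integrable_norm.
Qed.

Let P_lim (x : R) : (fun n => P n.+2%:R^-1 x) @ \oo --> pi * v x.
Proof.
rewrite /v /synth mulrA mulfV ?gt_eqF ?pi_gt0// mul1r.
apply: (@Rintegral_dominated_cvg _ D (fun n w => expR (- (n.+2%:R^-1 * w)) * phase f w (w * x)) _ (amp f) mD _ _ _ ai).2.
- by move=> n; exact: damped_measurable.
- move=> w _; rewrite powRr0 addr0; apply: cvgM; last exact: cvg_cst.
  have E1 : 1 = expR (- (0 * w)) :> R by rewrite mul0r oppr0 expR0.
  rewrite [X in _ --> X]E1.
  apply: (@cvg_comp _ _ _ (fun n => - (n.+2%:R^-1 * w)) (@expR R)); last exact: continuous_expR.
  by apply: cvgN; apply: cvgM; [exact: cvg_inv2|exact: cvg_cst].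
- by move=> n w; apply: damped_le; rewrite invr_gt0.
Qed.

Let P_bound (e x : R) : 0 < e -> `|P e x| <= \int[mu]_(w in D) amp f w.
Proof.
by move=> e0; apply: le_norm_Rintegral => // w; exact: damped_le.
Qed.

Let atan_limN (z : R) : z < 0 -> (fun n => atan (z / n.+2%:R^-1)) @ \oo --> - (pi / 2).
Proof.
move=> z0; have z0' : 0 < - z by rewrite oppr_gt0.
rewrite (_ : (fun _ => _) = (fun n => - atan (- z / n.+2%:R^-1))); last first.
  by apply/funext => n; rewrite mulNr atanN opprK.
by apply: cvgN; exact: cvg_atan_div.
Qed.

Let P_measurable (e : R) (E : set mT) : 0 < e -> measurable_fun E (P e).
Proof.
move=> e0; apply: measurable_funTS; apply: continuous_measurable_fun => x.
have hx : x \in `]x - 1, x + 1[ by rewrite in_itv/= ltrDl ltrBlDr ltrDl ltr01.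
apply: (@continuity_under_integral R _ mT mu (fun x w => expR (- (e * w)) * phase f w (w * x)) D mD (x - 1) (x + 1) _ _ (amp f)) => //.
- by move=> z _; apply: intg_le ai => // w; exact: damped_le.
- apply: aeW => w _ z _; apply: cvgM; first exact: cvg_cst.
  exact: (is_derive_continuous (der_comp (phase_der f w _) (der_scale w (der_id z)))).
- by move=> z _; apply: aeW => w; exact: damped_le.
- exact/mem_set.
Qed.

(** Abel summation. With the factor e^(- e w) the synthesis integral is the
    Poisson integral of f, whose integral over [a, b] is that of f against a
    difference of arctangents. As e tends to 0 this difference tends to pi
    times the indicator of [a, b] (except at the two end points), while the
    damped integral converges boundedly to pi v. *)
Lemma inversion_int (a b : R) : a <= b ->
  \int[mu]_(x in `[a, b]) v x = \int[mu]_(x in `[a, b]) f x.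
Proof.
move=> ab.
have vc : continuous v by exact: synth_continuous.
have vi : intg `[a, b] v.
  apply: continuous_compact_integrable; first exact: segment_compact.
  exact: continuous_subspaceT.
have ninv n : 0 < n.+2%:R^-1 :> R by rewrite invr_gt0.
have ic c : intg `[a, b] (fun=> c).
  apply: continuous_compact_integrable; first exact: segment_compact.
  by apply: continuous_subspaceT => x; exact: cvg_cst.
have [||||| _ L1] := @Rintegral_dominated_cvg R `[a, b]%classic (fun n => P n.+2%:R^-1) (fun x => pi * v x)
   (fun=> \int[mu]_(w in D) amp f w) _.
- exact: measurable_itv.
- by move=> n; exact: P_measurable.
- by move=> x _; exact: P_lim.
- by move=> n x _; exact: P_bound.
- exact: ic.
pose E : set mT := ~` [set a; b].
have mab : measurable ([set a; b] : set mT) by exact: measurableU.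
have mE : measurable E by exact: measurableC.
pose A n y := atan ((b - y) / n.+2%:R^-1) - atan ((a - y) / n.+2%:R^-1).
have mA n (S : set mT) : measurable_fun S (A n).
  apply: measurable_funTS; apply: continuous_measurable_fun => y; apply: cvgB.
    exact: (is_derive_continuous (der_comp (is_derive1_atan _) (der_mul (der_sub (der_cst b y) (der_id y)) (der_cst _ y)))).
  exact: (is_derive_continuous (der_comp (is_derive1_atan _) (der_mul (der_sub (der_cst a y) (der_id y)) (der_cst _ y)))).
have bA n y : `|A n y| <= pi.
  rewrite /A; set s := atan _; set t := atan _.
  have := @atan_gtNpi2 R ((b - y) / n.+2%:R^-1); have := @atan_ltpi2 R ((b - y) / n.+2%:R^-1).
  have := @atan_gtNpi2 R ((a - y) / n.+2%:R^-1); have := @atan_ltpi2 R ((a - y) / n.+2%:R^-1).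
  by rewrite -/s -/t ler_norml; lra.
have [|||| _ L2] := @Rintegral_dominated_cvg R E (fun n y => f y * A n y) (fun y => f y * (pi * \1_(`[a, b]%classic : set mT) y))
   (fun y => `|f y| * pi) mE.
- by move=> n; apply: measurable_funM => //; apply: measurable_funTS; exact: (intg_measurable fi).
- move=> y Ey; apply: cvgM; first exact: cvg_cst.
  have [ya yb] : y != a /\ y != b by split; apply/eqP => yE; apply: Ey; [left|right].
  have [ay|] := ltP a y; last rewrite le_eqVlt (negPf ya)/= => ay.
    have [yb'|] := ltP y b; last rewrite le_eqVlt eq_sym (negPf yb)/= => yb'.
      rewrite indicE mem_set/=; last by rewrite in_itv/= !ltW.
      rewrite mulr1 (_ : pi = pi / 2 - - (pi / 2) :> R); last by field.
      by apply: cvgB; [apply: cvg_atan_div; rewrite subr_gt0|apply: atan_limN; rewrite subr_lt0].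
    rewrite indicE memNset/=; last by rewrite in_itv/= (leNgt y b) yb' andbF.
    rewrite mulr0 (_ : 0 = - (pi / 2) - - (pi / 2) :> R); last by ring.
    by apply: cvgB; apply: atan_limN; rewrite subr_lt0.
  rewrite indicE memNset/=; last by rewrite in_itv/= leNgt ay.
  rewrite mulr0 (_ : 0 = (pi / 2) - (pi / 2) :> R); last by ring.
  by apply: cvgB; apply: cvg_atan_div; rewrite subr_gt0// (lt_le_trans ay).
- by move=> n y _; rewrite normrM ler_wpM2l.
- apply: (@integrableS _ _ _ _ setT) => //.
  by apply: (intg_eq _ _ (intgZl pi _ (integrable_norm fi))) => // y _ /=; exact: mulrC.
have toE g : intg setT g -> \int[mu]_y g y = \int[mu]_(y in E) g y.
  move=> gi; rewrite /Rintegral (negligible_integral mab _ gi)//; first by rewrite setTD.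
  by apply: null_set_setU => //; exact: lebesgue_measure_set1.
have Leq : (fun n => \int[mu]_(x in `[a, b]) P n.+2%:R^-1 x) = (fun n => \int[mu]_(y in E) (f y * A n y)).
  apply/funext => n; rewrite int_P// toE//.
  apply: (@intgM_bounded _ _ _ _ pi) => //; first exact: (mA n).
  by move=> y _; exact: (bA n).
rewrite Leq in L1; have := cvg_unique _ L1 L2.
rewrite RintegralZl// -toE; last first.
  apply: (@intgM_bounded _ _ _ _ pi) => //.
  - by apply: measurable_funM => //; exact: measurable_indic.
  - move=> y _; rewrite indicE normrM ger0_norm ?pi_ge0// ler_piMr ?pi_ge0//.
    by case: (_ \in _); rewrite ?normr1 ?normr0.
have -> : \int[mu]_y (f y * (pi * \1_(`[a, b]%classic : set mT) y)) = pi * \int[mu]_(x in `[a, b]) f x.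
  rewrite -RintegralZl//; last exact: (integrableS _ _ _ fi).
  rewrite [RHS]Rintegral_mkcond; apply: eq_Rintegral => y _; rewrite patchE indicE.
  by case: ifP => _; rewrite ?mulr1 ?mulr0// mulrC.
by move=> piE; apply: (mulfI (lt0r_neq0 (pi_gt0 R))); exact: piE.
Qed.

(** Equal integrals over all segments: Lebesgue differentiation of the primitive
    of f, together with continuity of v, identifies f with v. *)
Lemma inversion_ae : {ae mu, forall x, f x = synth f 0 0 x}.
Proof.
have vc : continuous v by exact: synth_continuous.
have fy y : intg `]-oo, y] f by exact: (integrableS _ _ _ fi).
have lf : locally_integrable setT f by apply: open_integrable_locally => //; exact: openT.
have := FTC1Ny fy lf; apply: filterS; first exact: (ae_filter_ringOfSetsType mu).
move=> x [] _ /= <-.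
have itv y : x - 1 < y -> \int[mu]_(t in `]-oo, y]) f t =
   \int[mu]_(t in `]-oo, x - 1]) f t + \int[mu]_(t in `[x - 1, y]) v t.
  move=> xy; rewrite inversion_int ?ltW//.
  have := @Rintegral_itvB R f -oo%O (BRight y) (x - 1) (fy y).
  rewrite bnd_simp => /(_ isT) h.
  rewrite -(Rintegral_itv_obnd_cbnd); last exact: (integrableS _ _ _ fi).
  by rewrite -h ?bnd_simp ?ltW// addrC subrK.
have viu : intg `[x - 1, x + 1] v.
  apply: continuous_compact_integrable; first exact: segment_compact.
  exact: continuous_subspaceT.
have x1 : x < x + 1 by rewrite ltrDl.
have x2 : x - 1 < x by rewrite ltrBlDr ltrDl.
have [dG GE] := @continuous_FTC1_closed R v (x - 1) x (x + 1) x1 viu x2 (vc x).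
have dG' : is_derive x 1 (fun y => \int[mu]_(t in `[x - 1, y]) v t) (v x).
  by split; [exact: dG|rewrite -derive1E; exact: GE].
have := derive1_is_derive (der_add (der_cst (\int[mu]_(t in `]-oo, x - 1]) f t) x) dG').
rewrite add0r => vE.
rewrite -[RHS]/(v x) -vE !derive1E; apply: near_eq_derive.
near=> y; rewrite itv//.
near: y; exact: lt_nbhsr.
Unshelve. all: by end_near. Qed.

End inversion.

(** * Functions whose derivative vanishes almost everywhere *)

(** Let N be the null set where the derivative may fail to vanish, covered by open
    sets O k of measure at most e / 2^k, and let [S n x y] add up the measures of
    O k on ]x, y] for k < n. Near a point z of N with |F'(z)| < n the first n
    sets contain a neighbourhood of z, so [S n] grows there with slope n and
    dominates the increment of F; near the other points the slope e is enough.
    The resulting bound e (b - a) + 2 e is arbitrarily small. *)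
Section derivative_zero_ae.
Context {R : realType}.
Local Notation mT := (measurableTypeR R).

Lemma derivable_lipschitz (F : R -> R) (z c : R) : derivable F z 1 ->
  `|derive1 F z| < c ->
  exists2 d, 0 < d & forall y, `|y - z| < d -> `|F y - F z| <= c * `|y - z|.
Proof.
move=> dF Fc; have dz : is_derive z 1 F (derive1 F z).
  by split => //; rewrite derive1E.
have /is_derive1_caratheodory[g [gE cg gz]] := dz.
have : \forall y \near z, `|g y| < c.
  have cn : (fun y => `|g y|) @ z --> `|g z| by exact: cvg_norm.
  by apply: (cvgr_lt _ cn); rewrite gz.
move=> /nbhs_ballP[d /= d0 hd]; exists d => // y yz.
rewrite gE normrM ler_wpM2r// ltW//; apply: hd.
by rewrite /ball/= distrC.
Qed.

Variables (F : R -> R) (a b : R).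
Hypothesis dF : forall x : R, a <= x <= b -> derivable F x 1.
Variables (N : set mT).
Hypothesis mN : measurable N.
Hypothesis N0 : mu N = 0%E.
Hypothesis F0 : forall x : R, a <= x <= b -> ~ N x -> derive1 F x = 0.
Variables (e : R) (e0 : 0 < e).
Variable O : nat -> set R.
Hypothesis oO : forall k, open (O k).
Hypothesis NO : forall k, N `<=` O k.
Hypothesis muO : forall k, (mu (O k) <= (e / (2 ^ k)%:R)%:E)%E.

Let mO k : measurable (O k : set mT). Proof. exact: open_measurable. Qed.

Let g k (x y : R) : R := fine (mu (O k `&` `]x, y]%classic)).

Let mg k x y : measurable (O k `&` `]x, y]%classic : set mT).
Proof. by apply: measurableI => //; exact: mO. Qed.

Let g_le k x y : (mu (O k `&` `]x, y]%classic) <= (e / (2 ^ k)%:R)%:E)%E.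
Proof.
apply: le_trans (muO k); apply: le_measure; rewrite ?inE//.
Qed.

Let g_fin k x y : mu (O k `&` `]x, y]%classic) \is a fin_num.
Proof.
by rewrite ge0_fin_numE// (le_lt_trans (g_le k x y))// ltry.
Qed.

Let g_ge0 k x y : 0 <= g k x y.
Proof. exact: fine_ge0. Qed.

Let g_ub k x y : g k x y <= e / (2 ^ k)%:R.
Proof. by rewrite -lee_fin /g fineK//; exact: g_le. Qed.

Let g_add k (x y z : R) : x <= y -> y <= z -> g k x z = g k x y + g k y z.
Proof.
move=> xy yz; rewrite /g -fineD//; congr fine.
rewrite -measureU//.
- rewrite -setIUr; congr (mu (_ `&` _)); apply/seteqP; split => t /=; rewrite !in_itv/=.
    by move=> /andP[xt tz]; have [ty|ty] := leP t y; [left|right]; rewrite ?xt ?tz.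
  by case=> /andP[h1 h2]; rewrite ?h1 ?h2 ?andbT ?(le_trans h2)// (le_lt_trans xy).
- apply/seteqP; split => t //= -[[_]]; rewrite !in_itv/= => /andP[_ ty] [_ /andP[yt _]].
  by move: (lt_le_trans yt ty); rewrite ltxx.
Qed.

Let g_sub k (x y : R) : x <= y -> `[x, y]%classic `<=` O k -> g k x y = y - x.
Proof.
move=> xy sub; rewrite /g setIidr; last first.
  by move=> t ht; apply: sub; move: ht; rewrite /= !in_itv/= => /andP[/ltW-> ->].
rewrite lebesgue_measure_itv/= lte_fin; move: xy; rewrite le_eqVlt => /predU1P[->|->].
  by rewrite ltxx subrr.
by rewrite -EFinB.
Qed.

Let S n x y : R := \sum_(k < n) g k x y.

Let S_add n (x y z : R) : x <= y -> y <= z -> S n x z = S n x y + S n y z.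
Proof.
by move=> xy yz; rewrite /S -big_split/=; apply: eq_bigr => k _; exact: g_add.
Qed.

Let S_mono (m n : nat) (x y : R) : (m <= n)%N -> S m x y <= S n x y.
Proof.
move=> mn; rewrite /S -!(big_mkord xpredT (fun k => g k x y)).
by rewrite [leRHS](big_cat_nat (leq0n m) mn)/= lerDl sumr_ge0.
Qed.

Let S_ub n x y : S n x y <= e * 2.
Proof.
apply: (@le_trans _ _ (\sum_(k < n) e / (2 ^ k)%:R)).
  by apply: ler_sum => k _; exact: g_ub.
suff -> : \sum_(k < n) e / (2 ^ k)%:R = e * (2 - 2 / (2 ^ n)%:R).
  by apply: ler_wpM2l; [exact: ltW|rewrite gerBl divr_ge0].
elim: n => [|n IH]; first by rewrite big_ord0 expn0 divr1 subrr mulr0.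
rewrite big_ord_recr/= IH expnS natrM; field.
by rewrite pnatr_eq0 expn_eq0.
Qed.

Let local (z : R) : a <= z <= b -> exists2 d, 0 < d & exists n, forall M (x y : R), (n <= M)%N ->
  x <= z -> z <= y -> z - x < d -> y - z < d -> (x = z \/ y = z) ->
  `|F y - F x| <= e * (y - x) + S M x y.
Proof.
move=> zab; have [Nz|Nz] := pselect (N z); last first.
  have [d d0 h] := @derivable_lipschitz F z e (@dF z zab) ltac:(by rewrite F0 ?zab// normr0).
  exists d => //; exists 0 => M x y _ xz zy zx yz xy.
  have S0 : 0 <= S M x y by rewrite sumr_ge0.
  have xley : x <= y by rewrite (le_trans xz).
  rewrite (@le_trans _ _ (e * (y - x)))// ?lerDl//.
  case: xy => E; subst z.
    have := h y; rewrite ger0_norm ?subr_ge0//; exact.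
  have := h x; rewrite distrC (distrC (F x)) ger0_norm ?subr_ge0//; exact.
pose n := (Num.bound `|derive1 F z|).+1.
have [d d0 h] := @derivable_lipschitz F z n%:R (@dF z zab) ltac:(rewrite (lt_le_trans (archi_boundP _))// ler_nat//).
have [r r0 hr] : exists2 r, 0 < r & forall k, (k < n)%N -> forall t, `|t - z| < r -> O k t.
  elim: n {h} => [|m [r r0 hr]]; first by exists 1.
  have /nbhs_ballP[r' /= r'0 hr'] : nbhs z (O m).
    by apply: open_nbhs_nbhs; split; [exact: oO|exact: NO].
  exists (Num.min r r'); first by rewrite lt_min r0.
  move=> k; rewrite ltnS leq_eqVlt => /predU1P[-> t|km t]; rewrite lt_min => /andP[h1 h2].
    by apply: hr'; rewrite /ball/= distrC.
  exact: hr km _ h1.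
exists (Num.min d r); first by rewrite lt_min d0.
exists n => M x y nM xz zy; rewrite !lt_min => /andP[zx zx'] /andP[yz yz'] xy.
have xley : x <= y by rewrite (le_trans xz).
have Sn : S n x y = n%:R * (y - x).
  rewrite /S (eq_bigr (fun=> y - x)); last first.
    move=> k _; apply: g_sub => // t /=; rewrite in_itv/= => /andP[xt ty].
    apply: (hr k) => //; rewrite ltr_norml; lra.
  by rewrite sumr_const card_ord mulr_natl.
apply: (@le_trans _ _ (S n x y)).
  rewrite Sn; case: xy => E; subst z.
    have := h y; rewrite ger0_norm ?subr_ge0//; exact.
  have := h x; rewrite distrC (distrC (F x)) ger0_norm ?subr_ge0//; exact.
by rewrite (le_trans (S_mono x y nM))// lerDr mulr_ge0 ?subr_ge0// ltW.
Qed.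

(** The local estimates are chained by real induction: the supremum of the
    points up to which some [S n] controls the increment is attained, and
    cannot be smaller than b. *)
Lemma real_induction_bound : a <= b -> `|F b - F a| <= e * (b - a) + e * 2.
Proof.
move=> ab.
pose A := [set x | a <= x <= b /\ exists n, `|F x - F a| <= e * (x - a) + S n a x].
have Aa : A a.
  split; first by rewrite lexx.
  by exists 0; rewrite !subrr normr0 mulr0 add0r sumr_ge0.
have hA : has_sup A by split; [exists a|exists b => x [/andP[]]].
pose z := sup A.
have az : a <= z by exact: ub_le_sup hA.2 _ Aa.
have zb : z <= b by apply: ge_sup => [|x [/andP[]]]; first by exists a.
have [d d0 [n hn]] := @local z ltac:(by rewrite az zb).
have Az : A z.
  split; first by rewrite az.
  have [x [/andP[ax xb] [m hm]] xz] := sup_adherent d0 hA; rewrite -/z in xz.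
  have xz' : x <= z by apply: ub_le_sup hA.2 _ _; split; [rewrite ax|exists m].
  exists (maxn n m).
  have := hn (maxn n m) x z (leq_maxl _ _) xz' (lexx _) ltac:(lra) ltac:(lra) (or_intror erefl).
  have := S_mono a x (leq_maxr n m).
  rewrite (S_add _ ax xz').
  have := ler_normD (F z - F x) (F x - F a); rewrite addrA subrK.
  lra.
suff -> : b = z.
  case: Az => _ [m hm]; rewrite (le_trans hm)// lerD2l; exact: S_ub.
apply/eqP; rewrite eq_le zb andbT leNgt; apply/negP => zb'.
case: Az => _ [m hm].
pose y := Num.min b (z + d / 2).
have zy : z < y by rewrite lt_min zb' ltrDl divr_gt0.
have yd : y - z < d.
  have : y <= z + d / 2 by rewrite ge_min lexx orbT.
  by lra.
suff /(ub_le_sup hA.2) : A y by rewrite leNgt zy.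
split; first by rewrite (le_trans az (ltW zy)) ge_min lexx.
exists (maxn n m).
have := hn (maxn n m) z y (leq_maxl _ _) (lexx _) (ltW zy) ltac:(lra) yd (or_introl erefl).
have := S_mono a z (leq_maxr n m).
rewrite (S_add _ az (ltW zy)).
have := ler_normD (F y - F z) (F z - F a); rewrite addrA subrK.
lra.
Qed.

End derivative_zero_ae.

(** The hypothesis of differentiability at every point of the segment is what
    excludes the Cantor function. *)
Lemma derive_ae0_cst {R : realType} (F : R -> R) (a b : R) : a <= b ->
  (forall x, a <= x <= b -> derivable F x 1) ->
  {ae @lebesgue_measure R, forall x, a <= x <= b -> derive1 F x = 0} ->
  F a = F b.
Proof.
move=> ab dF [N [mN N0 NF]].
apply/eqP; rewrite eq_sym -subr_eq0 -normr_le0; apply/ler_addgt0Pl => d d0.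
rewrite addr0.
pose e := d / (b - a + 2).
have k0 : 0 < b - a + 2 by lra.
have e0 : 0 < e by rewrite divr_gt0.
have ex k : exists U : set R, [/\ open U, N `<=` U & (lebesgue_measure U <= (e / (2 ^ k)%:R)%:E)%E].
  have p : 0 < e / (2 ^ k)%:R by rewrite divr_gt0// ltr0n expn_gt0.
  have [|U [oU NU UN]] := @lebesgue_regularity_outer R N _ mN _ p.
    by rewrite [X in (X < _)%E]N0 ltry.
  exists U; split => //.
  rewrite -(setDUK NU) (le_trans (measureU2 _ _ _))//.
  - by apply: measurableD => //; exact: open_measurable.
  - by rewrite [X in (X + _)%E]N0 add0e ltW.
pose O k := projT1 (cid (ex k)).
have hO k : [/\ open (O k), N `<=` O k & (lebesgue_measure (O k) <= (e / (2 ^ k)%:R)%:E)%E].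
  exact: (projT2 (cid (ex k))).
have F0 (x : R) : a <= x <= b -> ~ N x -> derive1 F x = 0.
  by move=> xab; apply: contra_notP => h; apply: NF => /(_ xab).
have := @real_induction_bound R F a b dF N F0 e e0 O (fun k => let: And3 h _ _ := hO k in h)
  (fun k => let: And3 _ h _ := hO k in h) (fun k => let: And3 _ _ h := hO k in h) ab.
by rewrite -mulrDr divfK// gt_eqF.
Qed.

(** * Differences and moving averages in frequency space *)

Section differences.
Context {R : realType}.
Local Notation mT := (measurableTypeR R).
Implicit Types (F G f g : R -> R) (h x w y : R).

Definition fdiff h F x : R := F (x + h) - F x.
Definition avg h F x : R := \int[mu]_(t in `[x, x + h]) F t.

Lemma intg_continuous_seg F (a b : R) : continuous F -> intg `[a, b] F.
Proof.
move=> cF; apply: continuous_compact_integrable; first exact: segment_compact.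
exact: continuous_subspaceT.
Qed.

Lemma fdiff_avg h F F' : 0 <= h -> (forall x : R, is_derive x 1 F (F' x)) ->
  continuous F' -> fdiff h F = avg h F'.
Proof.
move=> h0 dF cF'; apply/funext => x.
have xh : x <= x + h by rewrite lerDl.
have [_ E] := @Rintegral_FTC2 R F' F x (x + h) xh (fun z _ => dF z) (fun z _ => cF' z).
by rewrite /avg E.
Qed.

Lemma fdiff_continuous h F : continuous F -> continuous (fdiff h F).
Proof.
move=> cF x; apply: cvgB; last exact: cF.
apply: (@continuous_comp _ _ _ (fun x => x + h) F); last exact: cF.
by apply: cvgD; [exact: cvg_id|exact: cvg_cst].
Qed.

Lemma avg_shift h F x : continuous F ->
  \int[mu]_(t in `[x, x + h]) F (t + h) = avg h F (x + h).
Proof.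
move=> cF; rewrite /avg.
rewrite [RHS](@Rintegral_comp R _ (measurable_shift h) (@lebesgue_measure_shift R h))//.
- have -> // : (fun t : mT => t + h : mT) @^-1` `[x + h, x + h + h] = `[x, x + h]%classic.
  by apply/seteqP; split => t /=; rewrite !in_itv/= !lerD2r.
- exact: continuous_measurable_fun.
- exact: intg_continuous_seg.
Qed.

(** Differences commute with averages, both being convolutions with compactly
    supported measures; so each difference can be matched with one derivative. *)
Lemma avg_fdiff h F : continuous F -> avg h (fdiff h F) = fdiff h (avg h F).
Proof.
move=> cF; apply/funext => x; rewrite /fdiff -avg_shift// /avg.
rewrite RintegralB//; last exact: intg_continuous_seg.
apply: intg_continuous_seg => t; apply: (@continuous_comp _ _ _ (fun x => x + h) F); last exact: cF.
by apply: cvgD; [exact: cvg_id|exact: cvg_cst].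
Qed.

Lemma fdiff4_avg4 h (I0 I1 I2 I3 I4 : R -> R) : 0 <= h ->
  (forall x : R, is_derive x 1 I0 (I1 x)) ->
  (forall x : R, is_derive x 1 I1 (I2 x)) ->
  (forall x : R, is_derive x 1 I2 (I3 x)) ->
  continuous I3 -> fdiff h I3 = avg h I4 ->
  fdiff h (fdiff h (fdiff h (fdiff h I0))) = avg h (avg h (avg h (avg h I4))).
Proof.
move=> h0 d0 d1 d2 c3 d3.
have cont F F' : (forall x : R, is_derive x 1 F (F' x)) -> continuous F.
  by move=> dF x; exact: (is_derive_continuous (dF x)).
have c1 := cont _ _ d1; have c2 := cont _ _ d2.
have cd F : continuous F -> continuous (fdiff h F) by exact: fdiff_continuous.
rewrite (fdiff_avg h0 d0 c1) -(avg_fdiff h c1) -(avg_fdiff h (cd _ c1)).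
rewrite -(avg_fdiff h (cd _ (cd _ c1))) (fdiff_avg h0 d1 c2).
rewrite -(avg_fdiff h c2) -(avg_fdiff h (cd _ c2)) (fdiff_avg h0 d2 c3).
by rewrite -(avg_fdiff h c3) d3.
Qed.

(** The average over [x, x + h] is a convolution with the indicator of
    [- h, 0]. *)
Definition box h : R -> R := \1_(`[- h, 0]%classic : set R).

Lemma box_intg h : intg setT (box h).
Proof. exact: integrable_indic_itv. Qed.

Lemma avg_conv h F : intg setT F -> avg h F = conv (box h) F.
Proof.
move=> Fi; apply/funext => x; rewrite /conv /avg.
rewrite -(@Rintegral_reflect R x (fun t => box h t * F (x - t))); last first.
  have mb : measurable_fun (setT : set mT) (box h) by exact: (intg_measurable (box_intg h)).
  apply: (intg_eq _ _ (@intgM_bounded R setT (fun t => F (x - t)) (box h) 1 measurableT (intg_reflect x Fi) mb _)) => //.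
    by move=> t _; exact: mulrC.
  by move=> t _; rewrite /box indicE; case: (_ \in _); rewrite ?normr1 ?normr0.
rewrite [LHS]Rintegral_mkcond; apply: eq_Rintegral => t _.
rewrite patchE /box indicE subKr.
have -> : (t \in `[x, x + h]%classic) = (x - t \in `[- h, 0]%classic).
  apply/idP/idP => /set_mem/=; rewrite in_itv/= => hh; apply/mem_set; rewrite /= in_itv/=; lra.
by case: ifP => _; rewrite ?mul1r ?mul0r.
Qed.

Lemma box_phase w y : 0 < w -> phase (box (pi / w)) w y = - 2 * sin y / w.
Proof.
move=> w0; have h0 : 0 < pi / w by rewrite divr_gt0// pi_gt0.
rewrite -phaseE; last exact: box_intg.
have -> : \int[mu]_x (box (pi / w) x * cos (y - w * x)) =
    \int[mu]_(x in `[- (pi / w), 0]) cos (y - w * x).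
  rewrite [RHS]Rintegral_mkcond; apply: eq_Rintegral => t _.
  rewrite patchE /box indicE.
  by case: ifP => _; rewrite ?mul1r ?mul0r.
have [|||_ ->] := @Rintegral_FTC2 R (fun x => cos (y - w * x)) (fun x => - (sin (y - w * x) / w)) (- (pi / w)) 0.
- by rewrite oppr_le0 ltW.
- move=> x _.
  apply: (der_eq (der_opp (der_mul (der_comp (is_derive_sin _) (der_sub (der_cst y x) (der_scale w (der_id x)))) (der_cst w^-1 x)))).
  by field; rewrite gt_eqF.
- move=> x _; exact: (is_derive_continuous (der_comp (is_derive_cos _) (der_sub (der_cst y x) (der_scale w (der_id x))))).
have -> : y - w * - (pi / w) = y + pi by field; rewrite gt_eqF.
by rewrite mulr0 subr0 sinDpi; ring.
Qed.

Lemma avg_intg h F : intg setT F -> intg setT (avg h F).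
Proof.
move=> Fi; rewrite avg_conv//.
by have [] := @conv_integrable R (box h) F (fun=> 0) 0 (box_intg h) Fi
   (measurable_cst _) (fun _ => ltac:(by rewrite normr0)).
Qed.

(** At the frequency w the average over half a period pi / w is a quarter turn
    with the factor 2 / w. *)
Lemma avg_phase w y F : 0 < w -> intg setT F ->
  phase (avg (pi / w) F) w y = 2 / w * phase F w (y + pi / 2).
Proof.
move=> w0 Fi; rewrite avg_conv// phase_conv//; last exact: box_intg.
rewrite !box_phase// sinBpihalf /phase cosDpihalf sinDpihalf.
by field; rewrite gt_eqF.
Qed.

Lemma fdiff_intg h F : intg setT F -> intg setT (fdiff h F).
Proof. by move=> Fi; apply: intgB => //; exact: intg_shift. Qed.

Lemma shift_phase h w y F : intg setT F -> phase (fun x => F (x + h)) w y = phase F w (y + w * h).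
Proof.
move=> Fi; rewrite -!phaseE//; last exact: intg_shift.
rewrite -[LHS](Rintegral_shift (- h)).
  by apply: eq_Rintegral_on => x _; rewrite subrK; congr (_ * cos _); ring.
apply: (intg_eq _ _ (intg_cos (- w) y (intg_shift h Fi))) => // x _; by rewrite mulNr.
Qed.

Lemma phaseB w y F G : intg setT F -> intg setT G ->
  phase (fun x => F x - G x) w y = phase F w y - phase G w y.
Proof.
move=> Fi Gi; rewrite -!phaseE//; last exact: intgB.
have ic H : intg setT H -> intg setT (fun x => H x * cos (y - w * x)).
  by move=> Hi; apply: (intg_eq _ _ (intg_cos (- w) y Hi)) => // x _; rewrite mulNr.
rewrite -RintegralB//; [|exact: ic|exact: ic].
by apply: eq_Rintegral_on => x _; rewrite mulrBl.
Qed.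

Lemma phaseZ w y c F : intg setT F ->
  phase (fun x => c * F x) w y = c * phase F w y.
Proof.
move=> Fi; rewrite -!phaseE//; last exact: intgZl.
rewrite -RintegralZl//.
  by apply: eq_Rintegral_on => x _; rewrite mulrA.
by apply: (intg_eq _ _ (intg_cos (- w) y Fi)) => // x _; rewrite mulNr.
Qed.

Lemma phase_ae w y F G : intg setT F -> intg setT G ->
  {ae mu, forall x, F x = G x} -> phase F w y = phase G w y.
Proof.
move=> Fi Gi FG; rewrite -!phaseE// /Rintegral; congr fine.
apply: ae_eq_integral => //.
- apply/measurable_EFinP; apply: (intg_measurable (intg_eq _ _ (intg_cos (- w) y Fi))) => // x _.
  by rewrite mulNr.
- apply/measurable_EFinP; apply: (intg_measurable (intg_eq _ _ (intg_cos (- w) y Gi))) => // x _.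
  by rewrite mulNr.
- move: FG; apply: filterS; first exact: (ae_filter_ringOfSetsType mu).
  by move=> x ->.
Qed.

Lemma phaseDpi f w y : phase f w (y + pi) = - phase f w y.
Proof. by rewrite /phase cosDpi sinDpi; ring. Qed.

(** Translation by half a period reverses the sign of the phase. *)
Lemma fdiff_phase w y F : 0 < w -> intg setT F ->
  phase (fdiff (pi / w) F) w y = - 2 * phase F w y.
Proof.
move=> w0 Fi; rewrite phaseB//; last exact: intg_shift.
by rewrite shift_phase// mulrC divfK ?gt_eqF// phaseDpi; ring.
Qed.

End differences.

(** * Spectral decay from the left derivative *)

(** The kernel t_+^(s - 1) of the fractional integral is not integrable at
    infinity, but its differences are, being O(t^(s - 2)); their transform is
    that of the kernel, obtained by damping, times the factor - 2 of a
    difference with step pi / w. *)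
Section kernel.
Context {R : realType}.
Local Notation mT := (measurableTypeR R).
Local Notation D := (`]0, +oo[%classic : set mT).
Variable s : R.
Hypothesis s01 : 0 < s < 1.

Let s0 : 0 < s. Proof. by case/andP : s01. Qed.
Let s1 : s < 1. Proof. by case/andP : s01. Qed.
Let mD : measurable D. Proof. exact: measurable_itv. Qed.

Definition pos_pow (t : R) : R := t `^ (s - 1) * \1_(`]0, +oo[%classic : set R) t.
Definition pos_pow_diff (h t : R) : R := pos_pow (t + h) - pos_pow t.

Lemma pos_pow_gt0 (t : R) : 0 < t -> pos_pow t = t `^ (s - 1).
Proof. by move=> t0; rewrite /pos_pow indicE mem_set ?mulr1//= in_itv/= t0. Qed.

Lemma pos_pow_le0 (t : R) : t <= 0 -> pos_pow t = 0.
Proof. by move=> t0; rewrite /pos_pow indicE memNset ?mulr0//= in_itv/= andbT; apply/negP; rewrite -leNgt. Qed.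

Lemma pos_pow_ge0 (t : R) : 0 <= pos_pow t.
Proof. by rewrite mulr_ge0 ?powR_ge0// indicE; case: (_ \in _). Qed.

Lemma measurable_pos_pow (E : set mT) : measurable_fun E pos_pow.
Proof.
apply: measurable_funTS; apply: measurable_funM; first exact: measurable_powR.
exact: measurable_indic.
Qed.

Lemma measurable_pos_pow_diff h (E : set mT) : measurable_fun E (pos_pow_diff h).
Proof.
apply: measurable_funTS; apply: measurable_funB; last exact: measurable_pos_pow.
apply: (@measurableT_comp _ _ _ mT mT _ pos_pow setT (fun t => t + h : mT)).
  exact: measurable_pos_pow.
exact: measurable_shift.
Qed.

Let p (e t : R) := pos_pow t * expR (- (e * t)).

Let p_intg (e : R) : 0 < e -> intg setT (p e).
Proof.
move=> e0; have := intg_laplace s0 e0.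
move=> /(integrable_mkcond _ mD); apply: eq_integrable => // t _.
by rewrite /= patchE /p /pos_pow indicE; case: ifPn => _; rewrite /= ?mulr1 ?mulr0 ?mul0r.
Qed.

Let p_phase (e w y : R) : 0 < e -> 0 < w ->
  phase (p e) w y = Gamma s * damp e w `^ (- s) * cos (- y + s * atan (w / e)).
Proof.
move=> e0 w0; rewrite -phaseE; last exact: p_intg.
rewrite -laplace_damped// [RHS]Rintegral_mkcond; apply: eq_Rintegral => t _.
rewrite patchE /p /pos_pow indicE; case: ifPn => _ /=; rewrite ?mulr0 ?mul0r// mulr1.
by rewrite -[in LHS]cosN; congr (_ * cos _); ring.
Qed.

Let pos_pow_diff_le (h t : R) : 0 < h ->
  `|pos_pow_diff h t| <= expR h * p 1 (t + h) + expR 1 * p 1 t + h * (t `^ (s - 2) * \1_(`[1, +oo[%classic : set R) t).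
Proof.
move=> h0; have pp u : 0 <= p 1 u by rewrite mulr_ge0 ?pos_pow_ge0 ?expR_ge0.
have e1 := expR_ge0 h; have e2 := expR_ge0 (1 : R).
have k3 : 0 <= h * (t `^ (s - 2) * \1_(`[1, +oo[%classic : set R) t).
  by rewrite mulr_ge0 ?(ltW h0)// mulr_ge0 ?powR_ge0// indicE; case: (_ \in _).
have pe (c u : R) : u <= c -> pos_pow u <= expR c * p 1 u.
  move=> uc; rewrite /p mulrCA -expRD mul1r ler_peMr ?pos_pow_ge0//.
  by rewrite -expR0 ler_expR; lra.
have k1 := mulr_ge0 e1 (pp (t + h)); have k2 := mulr_ge0 e2 (pp t).
have [t0|t0] := leP t 0.
  rewrite /pos_pow_diff (pos_pow_le0 t0) subr0 ger0_norm ?pos_pow_ge0//.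
  have := pe h (t + h) ltac:(lra); lra.
have th0 : 0 < t + h by rewrite addr_gt0.
have kt : pos_pow (t + h) <= pos_pow t.
  rewrite !pos_pow_gt0// -!(opprB 1 s) !powRN lef_pV2 ?posrE ?powR_gt0//.
  by rewrite ge0_ler_powR ?nnegrE ?ltW// ?subr_gt0// ltrDl.
rewrite /pos_pow_diff distrC ger0_norm ?subr_ge0//.
have [t1|t1] := leP t 1.
  have := pe 1 t t1; have := pos_pow_ge0 (t + h); lra.
have dk (u : R) : 0 < u -> is_derive u 1 (fun u => - u `^ (s - 1)) ((1 - s) * u `^ (s - 2)).
  move=> u0; apply: (der_eq (der_opp (is_derive1_powR (s - 1) u0))).
  by rewrite (_ : s - 1 - 1 = s - 2); ring.
have tth : t <= t + h by rewrite lerDl ltW.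
have [||z] := @MVT_segment R (fun u => - u `^ (s - 1)) (fun u => (1 - s) * u `^ (s - 2)) t (t + h) tth.
- by move=> u; rewrite in_itv/= => /andP[tu _]; apply: dk; rewrite (lt_trans t0).
- apply: continuous_in_subspaceT => u; rewrite inE/= in_itv/= => /andP[tu _].
  by apply: (is_derive_continuous (dk u _)); rewrite (lt_le_trans t0).
rewrite in_itv/= => /andP[tz _]; rewrite !pos_pow_gt0// => E.
have th : t + h - t = h by ring.
rewrite th in E.
have {}E : t `^ (s - 1) - (t + h) `^ (s - 1) = (1 - s) * z `^ (s - 2) * h by rewrite -E; ring.
rewrite E.
have zp : z `^ (s - 2) <= t `^ (s - 2).
  have zpos : 0 < z := lt_le_trans t0 tz.
  rewrite -!(opprB 2 s) !powRN lef_pV2 ?posrE ?powR_gt0//.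
  apply: ge0_ler_powR; rewrite ?nnegrE ?(ltW t0) ?(ltW zpos)//.
  by have := s1; lra.
rewrite indicE mem_set/=; last by rewrite in_itv/= ltW.
rewrite mulr1; have := powR_ge0 z (s - 2) => z0.
have : (1 - s) * z `^ (s - 2) * h <= t `^ (s - 2) * h.
  rewrite ler_wpM2r ?(ltW h0)// (le_trans _ zp)// ler_piMl//; have := s0; lra.
lra.
Qed.

Lemma pos_pow_diff_intg (h : R) : 0 < h -> intg setT (pos_pow_diff h).
Proof.
move=> h0; apply: (@intg_le R setT (pos_pow_diff h)
  (fun t => expR h * p 1 (t + h) + expR 1 * p 1 t + h * (t `^ (s - 2) * \1_(`[1, +oo[%classic : set R) t))
  measurableT (@measurable_pos_pow_diff h setT) (fun t _ => @pos_pow_diff_le h t h0)).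
apply: intgD => //; first apply: intgD => //.
- by apply: intgZl => //; exact: (intg_shift h (p_intg ltr01)).
- by apply: intgZl => //; exact: p_intg.
- apply: intgZl => //.
  have m1 : measurable (`[1, +oo[%classic : set mT) by exact: measurable_itv.
  have /(integrable_mkcond _ m1) : intg `[1, +oo[ (fun t => t `^ (s - 2)) by apply: intg_powR1y; have := s1; lra.
  apply: eq_integrable => // t _; rewrite /= patchE indicE.
  by case: ifPn => _; rewrite ?mulr1 ?mulr0.
Qed.

(** Damping the difference by e^(- e t) leaves a combination of damped kernels,
    with the weight e^(e h) on the translated one; their transforms are
    given by [laplace_damped], and e tends to 0. *)
Lemma pos_pow_diff_phase (w y : R) : 0 < w ->
  phase (pos_pow_diff (pi / w)) w y = - 2 * Gamma s * w `^ (- s) * cos (- y + s * (pi / 2)).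
Proof.
move=> w0; set h := pi / w; have h0 : 0 < h by rewrite divr_gt0// pi_gt0.
have wh : w * h = pi by rewrite /h mulrC divfK// gt_eqF.
have ki := pos_pow_diff_intg h0.
have ninv n : 0 < n.+2%:R^-1 :> R by rewrite invr_gt0.
pose e n : R := n.+2%:R^-1.
have [|||| _ L1] := @Rintegral_dominated_cvg R setT (fun n t => pos_pow_diff h t * expR (- (e n * t)) * cos (y - w * t))
   (fun t => pos_pow_diff h t * cos (y - w * t)) (fun t => expR h * `|pos_pow_diff h t|) measurableT.
- move=> n; apply: measurable_funM; first apply: measurable_funM.
  + exact: measurable_pos_pow_diff.
  + by apply: measurableT_comp => //; apply: measurableT_comp => //; exact: measurable_scal.
  + by apply: measurable_fun_cos; apply: measurable_funB => //; exact: measurable_scal.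
- move=> t _; apply: cvgM; last exact: cvg_cst.
  have E1 : pos_pow_diff h t = pos_pow_diff h t * expR (- (0 * t)) by rewrite mul0r oppr0 expR0 mulr1.
  rewrite [X in _ --> X]E1; apply: cvgM; first exact: cvg_cst.
  apply: (@cvg_comp _ _ _ (fun n => - (e n * t)) (@expR R)); last exact: continuous_expR.
  by apply: cvgN; apply: cvgM; [exact: cvg_inv2|exact: cvg_cst].
- move=> n t _; rewrite normrM (le_trans (ler_piMr _ (cos_max _)))// normrM mulrC.
  rewrite ger0_norm ?expR_ge0//.
  have [th|th] := leP t (- h).
    by rewrite /pos_pow_diff !pos_pow_le0 ?subrr ?normr0 ?mulr0//; lra.
  rewrite ler_wpM2r// ler_expR.
  have en1 : e n <= 1 by rewrite invf_le1// ler1n.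
  have [t0|t0] := leP 0 t.
    by have := mulr_ge0 (ltW (ninv n)) t0; rewrite -/(e n); lra.
  rewrite -mulrN (@le_trans _ _ (1 * - t))//; last by lra.
  by rewrite ler_wpM2r// oppr_ge0 ltW.
- by apply: intgZl => //; exact: integrable_norm.
have E n : \int[mu]_t (pos_pow_diff h t * expR (- (e n * t)) * cos (y - w * t)) =
   expR (e n * h) * phase (p (e n)) w (y + w * h) - phase (p (e n)) w y.
  have pin := p_intg (ninv n).
  rewrite -shift_phase// -phaseZ; last exact: intg_shift.
  rewrite -phaseB//; last by apply: intgZl => //; exact: intg_shift.
  rewrite -phaseE; last first.
    by apply: intgB => //; apply: intgZl => //; exact: intg_shift.
  apply: eq_Rintegral_on => t _; congr (_ * _).
  rewrite /pos_pow_diff /p mulrBl mulrCA -expRD; congr (_ * expR _ - _); ring.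
rewrite (_ : (fun _ => _) = (fun n => expR (e n * h) * phase (p (e n)) w (y + w * h) - phase (p (e n)) w y)) in L1; last first.
  by apply/funext.
have L2 : (fun n => expR (e n * h) * phase (p (e n)) w (y + w * h) - phase (p (e n)) w y) @ \oo -->
   1 * (Gamma s * w `^ (- s) * cos (- (y + w * h) + s * (pi / 2))) - Gamma s * w `^ (- s) * cos (- y + s * (pi / 2)).
  apply: cvgB.
    apply: cvgM.
      have E1 : 1 = expR (0 * h) :> R by rewrite mul0r expR0.
      rewrite [X in _ --> X]E1.
      apply: (@cvg_comp _ _ _ (fun n => e n * h) (@expR R)); last exact: continuous_expR.
      by apply: cvgM; [exact: cvg_inv2|exact: cvg_cst].
    rewrite (_ : (fun n => phase _ _ _) = (fun n => Gamma s * damp (e n) w `^ (- s) * cos (- (y + w * h) + s * atan (w / e n)))).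
      exact: damp_cvg.
    by apply/funext => n; rewrite p_phase//; exact: ninv.
  rewrite (_ : (fun n => phase _ _ _) = (fun n => Gamma s * damp (e n) w `^ (- s) * cos (- y + s * atan (w / e n)))).
    exact: damp_cvg.
  by apply/funext => n; rewrite p_phase//; exact: ninv.
have := cvg_unique (@Rhausdorff R) L1 L2; rewrite phaseE// => ->.
rewrite wh (_ : - (y + pi) + s * (pi / 2) = - y + s * (pi / 2) - pi); last by ring.
rewrite -(opprK (cos (_ - pi))) -cosDpi subrK; ring.
Qed.

End kernel.

Section spectral_decay.
Context {R : realType}.
Local Notation mT := (measurableTypeR R).
Local Notation D := (`]0, +oo[%classic : set mT).

Lemma times_derivable_is_derive n (F : R -> R) k (x : R) : times_derivable n F -> (k < n)%N ->
  is_derive x 1 (derive1n k F) (derive1n k.+1 F x).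
Proof.
move=> dF kn; split; first exact: dF.
by rewrite derive1nS derive1E.
Qed.

Lemma is_derive_Rintegral (f : R -> R) (a x : R) : continuous f -> a < x ->
  is_derive x 1 (fun y => \int[mu]_(t in `[a, y]) f t) (f x).
Proof.
move=> cf ax; have x1 : x < x + 1 by rewrite ltrDl.
have [dG GE] := @continuous_FTC1_closed R f a x (x + 1) x1 (intg_continuous_seg a (x + 1) cf) ax (cf x).
by split; [exact: dG|rewrite -derive1E; exact: GE].
Qed.

Lemma inversion_intg (g : R -> R) : intg setT g -> intg D (amp g) -> intg setT (synth g 0 0).
Proof.
move=> gi ai.
have mv : measurable_fun (setT : set mT) (synth g 0 0).
  apply: continuous_measurable_fun; apply: synth_continuous => //; exact: amp_powR0.
apply/integrableP; split; first exact/measurable_EFinP.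
rewrite -(@ge0_ae_eq_integral _ _ _ mu setT (fun x => `|(g x)%:E|)%E) //.
- by move/integrableP : gi => [].
- by apply: measurableT_comp => //; exact: (measurable_int _ gi).
- by apply: measurableT_comp => //; exact/measurable_EFinP.
- move: (inversion_ae gi ai); apply: filterS; first exact: (ae_filter_ringOfSetsType mu).
  by move=> x -> _.
Qed.

(** The fourth derivative [c * g] exists everywhere but is not assumed
    continuous, so its primitive is first identified: the third derivative minus
    the integral of the continuous representative [v] of [g] is differentiable
    with derivative zero almost everywhere, hence constant. The fourfold
    difference is then a fourfold average of [v], that is, four quarter turns and
    the factor (2 / w)^4. *)
Lemma fdiff4_phase (I g : R -> R) (c : R) : times_derivable 4 I ->
  (forall x, derive1n 4 I x = c * g x) ->
  intg setT g -> intg D (amp g) ->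
  forall w, 0 < w ->
    intg setT (fdiff (pi / w) (fdiff (pi / w) (fdiff (pi / w) (fdiff (pi / w) I)))) /\
    forall y, phase (fdiff (pi / w) (fdiff (pi / w) (fdiff (pi / w) (fdiff (pi / w) I)))) w y =
      16 * c * w ^- 4 * phase g w y.
Proof.
move=> dI I4 gi ai w w0; set h := pi / w.
have h0 : 0 < h by rewrite divr_gt0// pi_gt0.
pose v := synth g 0 0.
have ai0 := amp_powR0 ai.
have vc : continuous v by exact: synth_continuous.
have gv := inversion_ae gi ai.
have vi : intg setT v by exact: inversion_intg.
have ftc (a b : R) : a <= b -> derive1n 3 I b - derive1n 3 I a = \int[mu]_(t in `[a, b]) (c * v t).
  move=> ab; have cvc : continuous (fun t => c * v t).
    by move=> t; apply: cvgM; [exact: cvg_cst|exact: vc].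
  pose W x := derive1n 3 I x - \int[mu]_(t in `[a - 1, x]) (c * v t).
  have dW (x : R) : a <= x <= b -> is_derive x 1 W (c * g x - c * v x).
    move=> /andP[ax _]; rewrite -I4; apply: der_sub.
      exact: (times_derivable_is_derive x dI).
    by apply: (@is_derive_Rintegral (fun t => c * v t)) => //; lra.
  have WE : W a = W b.
    apply: derive_ae0_cst => //.
      by move=> x xab; have := dW x xab => ?; exact: ex_derive.
    move: gv; apply: filterS; first exact: (ae_filter_ringOfSetsType mu).
    by move=> x gx xab; rewrite (derive1_is_derive (dW x xab)) gx subrr.
  have ai1 := intg_continuous_seg (a - 1) b cvc.
  have := @Rintegral_itvB R (fun t => c * v t) (BLeft (a - 1)) (BRight b) a ai1.
  rewrite !bnd_simp => /(_ ltac:(lra) ab) E.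
  rewrite Rintegral_itv_obnd_cbnd in E; last first.
    apply: (integrableS _ _ _ ai1) => //; apply: subset_itvr; rewrite bnd_simp; lra.
  rewrite -E.
  have rearrange (p q r u : R) : p - r = q - u -> q - p = u - r by move=> ?; lra.
  exact: rearrange WE.
have -> : fdiff h (fdiff h (fdiff h (fdiff h I))) = avg h (avg h (avg h (avg h (fun x => c * v x)))).
  have d k (x : R) : (k < 4)%N -> is_derive x 1 (derive1n k I) (derive1n k.+1 I x).
    exact: times_derivable_is_derive.
  apply: (@fdiff4_avg4 R h I (derive1n 1 I) (derive1n 2 I) (derive1n 3 I) (fun x => c * v x)).
  - exact: ltW.
  - by move=> x; exact: (d 0).
  - by move=> x; exact: (d 1%N).
  - by move=> x; exact: (d 2%N).
  - by move=> x; exact: (is_derive_continuous (d 3%N x isT)).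
  - by apply/funext => x; rewrite /avg -ftc// lerDl ltW.
have cvi : intg setT (fun x => c * v x) by exact: intgZl.
split; first by do 4 apply: avg_intg.
move=> y; rewrite !avg_phase//; [|by do ! apply: avg_intg..].
rewrite phaseZ// (_ : y + _ + _ + _ + _ = y + pi + pi); last by field.
rewrite !phaseDpi opprK (phase_ae w y vi gi); last first.
  move: gv; apply: filterS; first exact: (ae_filter_ringOfSetsType mu).
  by move=> x ->.
by field; rewrite gt_eqF.
Qed.

Lemma RL_orderE (a : R) n : n%:R < a <= n.+1%:R -> RL_order a = n.+1.
Proof.
move=> na; rewrite /RL_order (@ceil_def _ a n.+1%:Z)//.
by rewrite (_ : n.+1%:Z - 1 = n%:Z)// -addn1 PoszD addrK.
Qed.

Lemma phase0 (f : R -> R) w : phase f w 0 = cosT f w.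
Proof. by rewrite /phase cos0 sin0 mulr1 mulr0 addr0. Qed.

Lemma phase_pihalf (f : R -> R) w : phase f w (pi / 2) = sinT f w.
Proof. by rewrite /phase cos_pihalf sin_pihalf mulr1 mulr0 add0r. Qed.

Lemma amp_bound_phase (f : R -> R) w A : (forall z, `|phase f w z| <= A) -> amp f w <= 2 * A.
Proof.
move=> h; rewrite /amp -phase0 -phase_pihalf.
have := h 0; have := h (pi / 2); lra.
Qed.

(** The fractional integral need not be integrable, but its difference is a
    convolution of two integrable functions. *)
Lemma left_RL_integral_fdiff (s h : R) (f : R -> R) : 0 < s < 1 -> 0 < h -> intg setT f ->
  (forall x, intg `]-oo, x[ (left_kernel (s - 1) f x)) ->
  fdiff h (left_RL_integral (s - 1) f) = conv f (pos_pow_diff s h).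
Proof.
move=> s01 h0 fi ki; apply/funext => x; rewrite /fdiff /conv.
have m1 y : measurable (`]-oo, y[%classic : set mT) by exact: measurable_itv.
have E y : (fun t => f t * pos_pow s (y - t)) = (left_kernel (s - 1) f y) \_ `]-oo, y[.
  apply/funext => t; rewrite patchE /left_kernel.
  case: ifPn => [/set_mem/=|/negP]; rewrite ?in_itv/= => yt.
    by rewrite pos_pow_gt0 ?subr_gt0// mulrC.
  rewrite pos_pow_le0 ?mulr0// subr_le0 leNgt; apply/negP => ty; apply: yt.
  by apply/mem_set; rewrite /= in_itv.
have ik y : intg setT (fun t => f t * pos_pow s (y - t)).
  have /(integrable_mkcond _ (m1 y)) := ki y.
  by apply: eq_integrable => // t _; rewrite E restrict_EFin.
have IE y : left_RL_integral (s - 1) f y = \int[mu]_t (f t * pos_pow s (y - t)).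
  by rewrite /left_RL_integral Rintegral_mkcond -E.
rewrite !IE -RintegralB//.
by apply: eq_Rintegral_on => t _; rewrite /pos_pow_diff mulrBr; congr (_ * pos_pow _ _ - _); ring.
Qed.

(** Both evaluations of the fourfold difference at the frequency w are compared:
    four averages of the derivative on one side, three differences of the
    convolution on the other. In the case a = 2 the derivative is the ordinary
    fourth one, and the four differences apply to f itself. *)
Lemma left_RL_spectral_decay (a : R) (f : R -> R) : 1 < a <= 2 -> intg setT f ->
  left_RL_exists (a + 2) f -> intg setT (left_RL (a + 2) f) ->
  intg D (amp (left_RL (a + 2) f)) ->
  intg D (fun w => w `^ (a + 2) * amp f w).
Proof.
move=> /andP[a1 a2] fi; rewrite /left_RL_exists /left_RL.
have -> : RL_order (a + 2) = 4%N.
  apply: RL_orderE; apply/andP; split; lra.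
have mD : measurable D by exact: measurable_itv.
have suffices_phase (g : R -> R) : intg D (amp g) ->
   (forall w z, 0 < w -> w `^ (a + 2) * `|phase f w z| <= amp g w) ->
   intg D (fun w => w `^ (a + 2) * amp f w).
  move=> gi h; apply: (@intg_le _ _ _ (fun w => 2 * amp g w)) => //.
  - apply: measurable_funM; first exact: measurable_funTS (measurable_powR _).
    exact: measurable_amp.
  - move=> w /=; rewrite in_itv/= andbT => w0.
    have p0 := powR_gt0 (a + 2) w0.
    rewrite ger0_norm ?mulr_ge0 ?amp_ge0 ?(ltW p0)//.
    rewrite -ler_pdivlMl// mulrCA; apply: amp_bound_phase => z.
    by rewrite ler_pdivlMl// h.
  - exact: intgZl.
have [aE|aE] := eqVneq (a + 2) 4%:R.
  move=> dI gi ai; apply: (suffices_phase _ ai) => w z w0.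
  have I4 x : derive1n 4 f x = 1 * derive1n 4 f x by rewrite mul1r.
  have [_ /(_ z)] := fdiff4_phase dI I4 gi ai w0.
  rewrite !fdiff_phase//; [|by do ! apply: fdiff_intg..].
  move=> E.
  have -> : phase f w z = w ^- 4 * phase (derive1n 4 f) w z by lra.
  rewrite aE powR_mulrn ?(ltW w0)// normrM ger0_norm; last by rewrite invr_ge0 exprn_ge0// ltW.
  have w4 : w ^+ 4 != 0 by rewrite expf_neq0// gt_eqF.
  rewrite (mulVKf w4); exact: phase_le.
pose s := 2 - a.
have s01 : 0 < s < 1.
  have : a != 2 by apply: contra aE => /eqP->; rewrite -natrD.
  by move=> /negPf an; rewrite /s; apply/andP; split; [rewrite subr_gt0 lt_neqAle an|lra].
have /andP[s0 s1] := s01.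
have -> : 4%:R - (a + 2) = s by rewrite /s; ring.
move=> [ki dI] gi ai; apply: (suffices_phase _ ai) => w z w0.
have G0 : 0 < Gamma s by apply: Gamma_gt0; rewrite s0 ltW.
set g := (fun x => _) in gi ai *.
have I4 x : derive1n 4 (left_RL_integral (s - 1) f) x = Gamma s * g x.
  by rewrite /g mulVKf// gt_eqF.
have h0 : 0 < pi / w by rewrite divr_gt0// pi_gt0.
(* The kernel turns the phase by s * (pi / 2); starting from the turned phase
   leaves phase f w z in the end. *)
have [_ /(_ (z + s * (pi / 2)))] := fdiff4_phase dI I4 gi ai w0.
rewrite (left_RL_integral_fdiff s01 h0 fi ki).
have khi := pos_pow_diff_intg s01 h0.
have ci : intg setT (conv f (pos_pow_diff s (pi / w))).
  by have [] := @conv_integrable R f (pos_pow_diff s (pi / w)) (fun=> 0) 0 fi khi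
   (measurable_cst _) (fun _ => ltac:(by rewrite normr0)).
rewrite !fdiff_phase//; [|by do ! apply: fdiff_intg..].
rewrite phase_conv// -[cosT _ _]phase0 -[sinT _ _]phase_pihalf !pos_pow_diff_phase// oppr0 add0r.
set C := cos (s * (pi / 2)).
have -> : cos (- (pi / 2) + s * (pi / 2)) = sin (s * (pi / 2)) by rewrite -cosBpihalf addrC.
set S := sin (s * (pi / 2)).
have -> : phase f w z = C * phase f w (z + s * (pi / 2)) + S * phase f w (z + s * (pi / 2) - pi / 2).
  have {1}-> : z = (z + s * (pi / 2)) - s * (pi / 2) by ring.
  by rewrite /phase cosBpihalf sinBpihalf cosB sinB -/C -/S; ring.
set p1 := phase f w _; set p2 := phase f w _; set P := phase g w _ => E.
have ws : 0 < w `^ (- s) by rewrite powR_gt0.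
have wE : w `^ (a + 2) = w ^+ 4 * w `^ (- s).
  by rewrite -powR_mulrn ?(ltW w0)// -powRD; [congr (_ `^ _); rewrite /s; ring|rewrite (gt_eqF w0) implybT].
have {}E : w `^ (- s) * (C * p1 + S * p2) = w ^- 4 * P.
  apply: (mulfI (lt0r_neq0 G0)); apply: (@mulfI _ 16) => //.
  transitivity (16 * Gamma s * w ^- 4 * P); last by ring.
  by rewrite -E; ring.
rewrite wE -(ger0_norm (ltW ws)) -mulrA -normrM E.
rewrite normrM ger0_norm; last by rewrite invr_ge0 exprn_ge0// ltW.
have w4 : w ^+ 4 != 0 by rewrite expf_neq0// gt_eqF.
by rewrite (mulVKf w4); exact: phase_le.
Qed.

End spectral_decay.

(** * The right fractional integral in frequency space *)

(** The fractional integral of v is an absolutely convergent integral of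
    integrals over frequencies, but exchanging the two needs the
    damping e^(- e t); the frequency integral is dominated by w^(- s) [amp f]
    uniformly in e. *)
Section right_integral.
Context {R : realType}.
Local Notation mT := (measurableTypeR R).
Local Notation D := (`]0, +oo[%classic : set mT).
Variables (s : R) (f : R -> R).
Hypothesis s01 : 0 < s < 1.
Hypothesis fi : intg setT f.
Hypothesis ai0 : intg D (fun w => w `^ 0 * amp f w).
Hypothesis ais : intg D (fun w => w `^ (- s) * amp f w).
Let v := synth f 0 0.
Hypothesis vi : intg setT v.

Let s0 : 0 < s. Proof. by case/andP : s01. Qed.
Let s1 : s < 1. Proof. by case/andP : s01. Qed.
Let mD : measurable D. Proof. exact: measurable_itv. Qed.
Let vc : continuous v. Proof. exact: synth_continuous. Qed.

Let p (t : R) := pos_pow s t * expR (- (1 * t)).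
Let p_intg : intg setT p.
Proof.
have := intg_laplace s0 ltr01.
move=> /(integrable_mkcond _ mD); apply: eq_integrable => // t _.
by rewrite /= patchE /p /pos_pow indicE; case: ifPn => _; rewrite /= ?mulr1 ?mulr0 ?mul0r.
Qed.

Let kv_intg (x : R) : intg setT (fun t => pos_pow s t * v (t + x)).
Proof.
pose B := pi^-1 * \int[mu]_(w in D) (w `^ 0 * amp f w).
have vB t : `|v t| <= B by exact: synth_bounded.
have B0 : 0 <= B by rewrite (le_trans _ (vB 0)).
have vxi := intg_shift x vi.
apply: (@intg_le _ _ _ (fun t => B * expR 1 * p t + `|v (t + x)|)) => //.
- apply: measurable_funM; first exact: measurable_pos_pow.
  exact: (intg_measurable vxi).
- move=> t _; rewrite normrM (ger0_norm (pos_pow_ge0 _ _)).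
  have [t1|t1] := leP t 1.
    rewrite (@le_trans _ _ (B * expR 1 * p t))// ?lerDl//.
    rewrite mulrC -mulrA ler_pM// ?pos_pow_ge0//.
    rewrite /p mulrCA -expRD mul1r ler_peMr ?pos_pow_ge0//.
    by have := expR_ge1Dx (1 - t); lra.
  rewrite (@le_trans _ _ (`|v (t + x)|))//.
    rewrite ler_piMl//; have t0 : 0 < t by lra.
    rewrite pos_pow_gt0// -[leRHS](powRr0 t); apply: ler_powR; [exact: ltW|have := s1; lra].
  rewrite lerDr; apply: mulr_ge0; first by apply: mulr_ge0 => //; exact: expR_ge0.
  by apply: mulr_ge0; [exact: pos_pow_ge0|exact: expR_ge0].
- by apply: intgD => //; [exact: intgZl|exact: integrable_norm].
Qed.

Let kvE (x : R) : (fun t => pos_pow s (t - x) * v t) = (right_kernel (s - 1) v x) \_ `]x, +oo[.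
Proof.
apply/funext => t; rewrite patchE /right_kernel.
case: ifPn => [/set_mem/=|/negP]; rewrite ?in_itv/= ?andbT => xt.
  by rewrite pos_pow_gt0 ?subr_gt0.
rewrite pos_pow_le0 ?mul0r// subr_le0 leNgt; apply/negP => tx; apply: xt.
by apply/mem_set; rewrite /= in_itv/= tx.
Qed.

Let kv_intg' (x : R) : intg setT (fun t => pos_pow s (t - x) * v t).
Proof.
have := intg_shift (- x) (kv_intg x); apply: intg_eq => // t _.
by rewrite subrK.
Qed.

Lemma right_kernel_synth_intg (x : R) : intg `]x, +oo[ (right_kernel (s - 1) v x).
Proof.
apply/(integrable_mkcond _ _) => //.
have := kv_intg' x; apply: eq_integrable => // t _.
by rewrite restrict_EFin -kvE.
Qed.

Let right_intE (x : R) : right_RL_integral (s - 1) v x = \int[mu]_(t in D) (t `^ (s - 1) * v (t + x)).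
Proof.
rewrite /right_RL_integral Rintegral_mkcond -kvE -(Rintegral_shift x (kv_intg' x)).
rewrite [RHS]Rintegral_mkcond; apply: eq_Rintegral => t _.
rewrite addrK patchE /pos_pow indicE; case: ifPn => _; rewrite ?mulr1//.
by rewrite mulr0 mul0r.
Qed.

Let damped (e x : R) : 0 < e ->
  \int[mu]_(t in D) (t `^ (s - 1) * expR (- (e * t)) * v (t + x)) =
  pi^-1 * \int[mu]_(w in D) (Gamma s * damp e w `^ (- s) * phase f w (w * x + s * atan (w / e))).
Proof.
move=> e0.
have Li := intg_laplace s0 e0.
transitivity (\int[mu]_(t in D) (pi^-1 * \int[mu]_(w in D) (t `^ (s - 1) * expR (- (e * t)) * (w `^ 0 * phase f w (w * (t + x) + 0))))).
  apply: eq_Rintegral_on => t _; rewrite /v /synth mulrCA RintegralZl//.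
  exact: synth_integrable.
have mF : measurable_fun (setT : set (mT * mT)) (fun z => z.1 `^ (s - 1) * expR (- (e * z.1)) * (z.2 `^ 0 * phase f z.2 (z.2 * (z.1 + x) + 0))).
  apply: measurable_funM.
    apply: (@measurableT_comp _ _ _ _ mT _ (fun t => t `^ (s - 1) * expR (- (e * t))) setT fst) => //.
    exact: measurable_laplace.
  apply: measurable_funM.
    by apply: (@measurableT_comp _ _ _ _ mT _ (fun t : mT => t `^ 0) setT snd) => //; exact: measurable_powR.
  apply: measurable_phase => //; apply: measurable_funD => //; apply: measurable_funM => //.
  exact: measurable_funD.
have bF (t w : R) : D t -> D w -> `|t `^ (s - 1) * expR (- (e * t)) * (w `^ 0 * phase f w (w * (t + x) + 0))| <=
    t `^ (s - 1) * expR (- (e * t)) * (w `^ 0 * amp f w).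
  move=> _ _; rewrite normrM ger0_norm ?mulr_ge0 ?powR_ge0 ?expR_ge0//.
  by apply: ler_wpM2l; [rewrite mulr_ge0 ?powR_ge0 ?expR_ge0|exact: synth_le].
rewrite RintegralZl//; last first.
  have vB t : `|v (t + x)| <= pi^-1 * \int[mu]_(w in D) (w `^ 0 * amp f w) by exact: synth_bounded.
  have mv : measurable_fun D (fun t => v (t + x)).
    by apply: measurable_funTS; exact: (intg_measurable (intg_shift x vi)).
  have := intgZl pi mD (intgM_bounded mD Li mv (fun t _ => vB t)).
  apply: intg_eq => // t _; rewrite RintegralZl//; last exact: synth_integrable.
  by rewrite /v /synth mulrCA; congr (_ * _); rewrite mulrA mulfV ?mul1r// gt_eqF// pi_gt0.
congr (_ * _).
rewrite (@Rintegral_Fubini R D D (fun z => z.1 `^ (s - 1) * expR (- (e * z.1)) * (z.2 `^ 0 * phase f z.2 (z.2 * (z.1 + x) + 0)))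
  (fun t => t `^ (s - 1) * expR (- (e * t))) (fun w => w `^ 0 * amp f w)) //.
apply: eq_Rintegral_on => w /=; rewrite in_itv/= andbT => w0.
have trig_i (y : R) : intg D (fun t => t `^ (s - 1) * expR (- (e * t)) * cos (y + w * t)).
  apply: (@intgM_bounded _ _ _ _ 1) => //.
    by apply: measurable_fun_cos; exact: measurable_lin.
  by move=> t _; exact: cos_max.
rewrite /phase mulrDr mulrCA (mulrCA _ (sinT f w)) -laplace_damped//.
have -> : sin (w * x + s * atan (w / e)) = cos (w * x - pi / 2 + s * atan (w / e)).
  by rewrite -cosBpihalf addrAC.
rewrite -laplace_damped// -!RintegralZl// -RintegralD//; [|exact: intgZl..].
apply: eq_Rintegral_on => t _; rewrite /= powRr0 addr0.
have -> : w * (t + x) = w * x + w * t by ring.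
have -> : sin (w * x + w * t) = cos (w * x - pi / 2 + w * t) by rewrite -cosBpihalf addrAC.
by ring.
Qed.

Lemma right_RL_integral_synth (x : R) :
  right_RL_integral (s - 1) v x = Gamma s * synth f (- s) (s * (pi / 2)) x.
Proof.
rewrite right_intE.
have ninv n : 0 < n.+2%:R^-1 :> R by rewrite invr_gt0.
pose e n : R := n.+2%:R^-1.
have kv : intg D (fun t => t `^ (s - 1) * v (t + x)).
  apply/(integrable_mkcond _ mD); have := kv_intg x; apply: eq_integrable => // t _.
  rewrite restrict_EFin /= patchE /pos_pow indicE; case: ifPn => _; rewrite ?mulr1//.
  by rewrite mulr0 mul0r.
have [|||| _ L1] := @Rintegral_dominated_cvg R D (fun n t => t `^ (s - 1) * expR (- (e n * t)) * v (t + x))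
   (fun t => t `^ (s - 1) * v (t + x)) (fun t => `|t `^ (s - 1) * v (t + x)|) mD.
- move=> n; apply: measurable_funM; first exact: measurable_laplace.
  by apply: measurable_funTS; exact: (intg_measurable (intg_shift x vi)).
- move=> t _; apply: cvgM; last exact: cvg_cst.
  have E1 : t `^ (s - 1) = t `^ (s - 1) * expR (- (0 * t)) by rewrite mul0r oppr0 expR0 mulr1.
  rewrite [X in _ --> X]E1; apply: cvgM; first exact: cvg_cst.
  apply: (@cvg_comp _ _ _ (fun n => - (e n * t)) (@expR R)); last exact: continuous_expR.
  by apply: cvgN; apply: cvgM; [exact: cvg_inv2|exact: cvg_cst].
- move=> n t /=; rewrite in_itv/= andbT => t0.
  rewrite mulrAC normrM ler_piMr// ger0_norm ?expR_ge0// -expR0 ler_expR oppr_le0.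
  by rewrite mulr_ge0 ?(ltW t0)// ltW// ninv.
- exact: integrable_norm.
have G0 : 0 < Gamma s by apply: Gamma_gt0; rewrite s0 ltW.
have [|||| _ L2] := @Rintegral_dominated_cvg R D (fun n w => Gamma s * damp (e n) w `^ (- s) * phase f w (w * x + s * atan (w / e n)))
   (fun w => Gamma s * (w `^ (- s) * phase f w (w * x + s * (pi / 2)))) (fun w => Gamma s * (w `^ (- s) * amp f w)) mD.
- move=> n; apply: measurable_funM.
    apply: measurable_funM => //.
    apply: (@measurableT_comp _ _ _ mT mT _ (fun z : mT => z `^ (- s)) D (fun w => damp (e n) w : mT)).
      exact: measurable_powR.
    rewrite (_ : (fun w => _) = (fun w => e n * Num.sqrt (1 + (w / e n) ^+ 2))); last first.
      by apply/funext => w; rewrite /damp cos_atan invrK.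
    apply: measurable_funM => //.
    have msq : measurable_fun (setT : set mT) (@Num.sqrt R) by apply: continuous_measurable_fun; exact: sqrt_continuous.
    have min : measurable_fun D (fun w => 1 + (w / e n) ^+ 2 : mT).
      by apply: measurable_funD => //; apply: measurable_funX; exact: measurable_funM.
    exact: (measurableT_comp msq min).
  apply: measurable_phase => //; apply: measurable_funD; first exact: measurable_funM.
  apply: measurable_funM => //; apply: measurable_funTS; apply: continuous_measurable_fun => w.
  exact: (is_derive_continuous (der_comp (is_derive1_atan _) (der_mul (der_id w) (der_cst (e n)^-1 w)))).
- move=> w /=; rewrite in_itv/= andbT => w0.
  rewrite /phase.
  rewrite (_ : (fun n => _) = (fun n => cosT f w * (Gamma s * damp (e n) w `^ (- s) * cos (w * x + s * atan (w / e n))) +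
     sinT f w * (Gamma s * damp (e n) w `^ (- s) * cos (w * x - pi / 2 + s * atan (w / e n))))); last first.
    apply/funext => n; have <- : sin (w * x + s * atan (w / e n)) = cos (w * x - pi / 2 + s * atan (w / e n)).
      by rewrite -cosBpihalf addrAC.
    by ring.
  have -> : Gamma s * (w `^ (- s) * (cosT f w * cos (w * x + s * (pi / 2)) + sinT f w * sin (w * x + s * (pi / 2)))) =
     cosT f w * (Gamma s * w `^ (- s) * cos (w * x + s * (pi / 2))) +
     sinT f w * (Gamma s * w `^ (- s) * cos (w * x - pi / 2 + s * (pi / 2))).
    have <- : sin (w * x + s * (pi / 2)) = cos (w * x - pi / 2 + s * (pi / 2)).
      by rewrite -cosBpihalf addrAC.
    by ring.
  by apply: cvgD; apply: cvgM; [exact: cvg_cst|exact: damp_cvg|exact: cvg_cst|exact: damp_cvg].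
- move=> n w /=; rewrite in_itv/= andbT => w0.
  rewrite -mulrA normrM (gtr0_norm G0) ler_wpM2l ?(ltW G0)// normrM (ger0_norm (powR_ge0 _ _)).
  by rewrite ler_pM ?powR_ge0 ?phase_le// damp_le// ninv.
- exact: intgZl.
have L2' : (fun n => pi^-1 * \int[mu]_(w in D) (Gamma s * damp (e n) w `^ (- s) * phase f w (w * x + s * atan (w / e n))))
    @ \oo --> pi^-1 * \int[mu]_(w in D) (Gamma s * (w `^ (- s) * phase f w (w * x + s * (pi / 2)))).
  by apply: cvgM; [exact: cvg_cst|exact: L2].
rewrite (_ : (fun n => _) =
  (fun n => pi^-1 * \int[mu]_(w in D) (Gamma s * damp (e n) w `^ (- s) * phase f w (w * x + s * atan (w / e n))))) in L1; last first.
  by apply/funext => n; rewrite damped// ninv.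
rewrite (cvg_unique (@Rhausdorff R) L1 L2') RintegralZl//; last exact: synth_integrable.
by rewrite /synth mulrCA.
Qed.

End right_integral.

(** * The generating function of the Grunwald weights *)

Lemma der_pow {R : realType} n (x : R) : is_derive x 1 (fun x : R => x ^+ n) (n%:R * x ^+ n.-1).
Proof.
elim: n => [|n IH].
  by rewrite mul0r; apply: (der_eq (der_cst 1 x)).
rewrite [X in is_derive _ _ X _](_ : _ = (fun x : R => x * x ^+ n)); last first.
  by apply/funext => z; rewrite exprS.
apply: (der_eq (der_mul (der_id x) IH)).
case: n {IH} => [|n] /=; first by rewrite !expr0 mul0r mulr0 addr0.
by rewrite exprS; ring.
Qed.

Section generating_function.
Context {R : realType}.
Variable a : R.
Hypothesis a12 : 1 < a <= 2.
Let a1 : 1 < a. Proof. by case/andP : a12. Qed.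
Let a2 : a <= 2. Proof. by case/andP : a12. Qed.

Local Notation w := (@grunwald_weight R a).

Lemma gbinomS k : k.+1%:R * gbinom a k.+1 = (a - k%:R) * gbinom a k.
Proof.
rewrite /gbinom big_ord_recr/=; set P := \prod_(_ < k) _.
by rewrite mulrCA mulrA -mulrA [k.+1%:R * _]mulrC divfK ?pnatr_eq0// mulrC.
Qed.

Lemma weightS k : k.+1%:R * w k.+1 = (k%:R - a) * w k.
Proof. by rewrite /grunwald_weight mulrCA gbinomS exprS; ring. Qed.

Lemma weight0 : w 0%N = 1.
Proof. by rewrite /grunwald_weight /gbinom big_ord0 expr0 mul1r. Qed.

Lemma weight1 : w 1%N = - a.
Proof. by have := weightS 0; rewrite weight0 mul1r sub0r mulr1. Qed.

(** As 1 < a <= 2, the weights from index 2 on are nonnegative and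
    n (n - 1) w_n does not increase; hence w_n = O(1 / n^2). *)
Lemma weight_bound n : 0 <= n.+2%:R * n.+1%:R * w n.+2 <= 2.
Proof.
elim: n => [|n IH].
  have h1 := a1; have h2 := a2.
  rewrite mulrAC weightS weight1; apply/andP; split; nra.
have n1 : 0 < n.+1%:R :> R by [].
have n2 : 0 < n.+2%:R :> R by [].
have n3 : n.+2%:R = n.+1%:R + 1 :> R by rewrite -natr1.
have n4 : 1 <= n.+1%:R :> R by rewrite ler1n.
rewrite mulrAC weightS.
set z := n.+2%:R * n.+1%:R * w n.+2 in IH *.
have -> : (n.+2%:R - a) * w n.+2 * n.+2%:R = (n.+2%:R - a) / n.+1%:R * z.
  by rewrite /z; field; rewrite gt_eqF// ltr_pwDl.
have h1 := a1; have h2 := a2.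
have k0 : 0 <= (n.+2%:R - a) / n.+1%:R by rewrite divr_ge0//; lra.
have k1 : (n.+2%:R - a) / n.+1%:R <= 1 by rewrite ler_pdivrMr// mul1r; lra.
case/andP : IH => z0 z2; apply/andP; split; first exact: mulr_ge0.
by rewrite (le_trans _ z2)// ler_piMl.
Qed.

(** Telescoping of 2 / (n (n - 1)); the first two weights contribute 1 + a,
    which is at most 3. *)
Lemma weight_sum n : \sum_(0 <= k < n) `|w k| <= 5.
Proof.
have H m : \sum_(0 <= k < m.+2) `|w k| <= 5 - 2 / m.+1%:R.
  elim: m => [|m IH].
    rewrite !big_nat_recr//= big_geq// weight0 weight1 normr1 normrN gtr0_norm; last by have := a1; lra.
    by have := a2; lra.
  rewrite big_nat_recr//=.
  have p1 : 0 < m.+1%:R :> R by [].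
  have p2 : 0 < m.+2%:R :> R by [].
  have /andP[b0 b2] := weight_bound m.
  have w0 : 0 <= w m.+2 by move: b0; rewrite pmulr_rge0// mulr_gt0.
  have wb : w m.+2 <= 2 / (m.+2%:R * m.+1%:R).
    by rewrite ler_pdivlMr ?mulr_gt0// mulrC.
  rewrite ger0_norm//.
  have E : 5 - 2 / m.+1%:R + 2 / (m.+2%:R * m.+1%:R) = 5 - 2 / m.+2%:R :> R.
    have -> : m.+2%:R = m.+1%:R + 1 :> R by rewrite -natr1.
    by field; rewrite !gt_eqF// addr_gt0.
  by rewrite -E lerD.
have mono m : \sum_(0 <= k < m) `|w k| <= \sum_(0 <= k < m.+2) `|w k|.
  by rewrite !big_nat_recr//= -addrA lerDl addr_ge0.
rewrite (le_trans (mono n))// (le_trans (H n))//.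
by rewrite gerBl divr_ge0.
Qed.

(** The quantity n w_n is what remains of the partial sums when they are inserted
    in the differential equation of (1 + x)^a or of (1 - e^(ix))^a. *)
Lemma weight_cvg0 : (fun n => n%:R * `|w n|) @ \oo --> (0 : R).
Proof.
have h : (fun n => 2 * n.+1%:R^-1 : R) @ \oo --> (0 : R).
  by rewrite -(mulr0 2); apply: cvgM; [exact: cvg_cst|exact: cvg_harmonic].
rewrite -(cvg_shiftn 2); apply: (@squeeze_cvgr _ _ _ _ (fun=> 0) (fun n => 2 * n.+1%:R^-1)).
- apply: nearW => n /=; rewrite addn2 mulr_ge0//=.
  have p1 : 0 < n.+1%:R :> R by [].
  have /andP[b0 b2] := weight_bound n.
  have w0 : 0 <= w n.+2 by move: b0; rewrite pmulr_rge0// mulr_gt0.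
  by rewrite ger0_norm// ler_pdivlMr// mulrAC.
- exact: cvg_cst.
- exact: h.
Qed.

Lemma weight_series_abs (c : nat -> R) : (forall k, `|c k| <= 1) ->
  cvgn (series (fun k => w k * c k)).
Proof.
move=> c1; apply: normed_cvg.
apply: nondecreasing_is_cvgn.
  by apply: nondecreasing_series => n _ _; exact: normr_ge0.
exists 5 => _ [n _ <-]; rewrite /series/=.
apply: le_trans (weight_sum n); apply: ler_sum => k _.
by rewrite normrM ler_piMr.
Qed.

Lemma weight_series_bound (c : nat -> R) n : (forall k, `|c k| <= 1) ->
  `|\sum_(0 <= k < n) w k * c k| <= 5.
Proof.
move=> c1; apply: le_trans (ler_norm_sum _ _ _) _.
apply: le_trans (weight_sum n); apply: ler_sum => k _.
by rewrite normrM ler_piMr.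
Qed.

(** The real part of e^(iy) (1 - e^(i th))^a, as a series. *)
Definition grunwald_series (th y : R) : R := limn (series (fun k => w k * cos (k%:R * th + y))).

Lemma grunwald_series_cvg th y : series (fun k => w k * cos (k%:R * th + y)) @ \oo --> grunwald_series th y.
Proof. by apply: weight_series_abs => k; exact: cos_max. Qed.

Lemma grunwald_series_le th y : `|grunwald_series th y| <= 5.
Proof.
have h : (fun n => `|series (fun k => w k * cos (k%:R * th + y)) n|) @ \oo --> `|grunwald_series th y|.
  by apply: cvg_norm; exact: grunwald_series_cvg.
rewrite -(cvg_lim (@Rhausdorff R) h).
apply: limr_le; first by apply/cvg_ex; exists `|grunwald_series th y|.
by apply: nearW => n; apply: weight_series_bound => k; exact: cos_max.
Qed.

(** A substitute for differentiating the limit: if the derivatives tend to zero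
    uniformly then, by the mean value theorem, the limit takes equal values at
    both end points. *)
Lemma cvg_eq_vanishing_derivative (Q : nat -> R -> R) (dQ : nat -> R -> R) (z : nat -> R) (b c A B : R) :
  b <= c ->
  (forall n x, b <= x <= c -> is_derive x 1 (Q n) (dQ n x)) ->
  (forall n x, b <= x <= c -> `|dQ n x| <= z n) ->
  z @ \oo --> (0 : R) -> Q ^~ b @ \oo --> A -> Q ^~ c @ \oo --> B -> A = B.
Proof.
move=> bc hQ hz z0 QA QB.
have E n : `|Q n c - Q n b| <= z n * (c - b).
  have [||x] := @MVT_segment R (Q n) (dQ n) b c bc.
  - by move=> x; rewrite in_itv/= => /andP[/ltW bx /ltW xc]; apply: hQ; rewrite bx.
  - apply: continuous_in_subspaceT => x; rewrite inE/= in_itv/= => xbc.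
    exact: (is_derive_continuous (hQ n x xbc)).
  rewrite in_itv/= => xbc ->; rewrite normrM (ger0_norm (_ : 0 <= c - b)) ?subr_ge0//.
  by rewrite ler_wpM2r ?subr_ge0// hz.
have L : (fun n => Q n c - Q n b) @ \oo --> B - A by exact: cvgB.
have L0 : (fun n => Q n c - Q n b) @ \oo --> (0 : R).
  apply: (@squeeze_cvgr _ _ _ _ (fun n => - (z n * (c - b))) (fun n => z n * (c - b))).
  - by apply: nearW => n; rewrite -ler_norml.
  - by rewrite -oppr0 -(mul0r (c - b)); apply: cvgN; apply: cvgM; [exact: z0|exact: cvg_cst].
  - by rewrite -(mul0r (c - b)); apply: cvgM; [exact: z0|exact: cvg_cst].
by apply/eqP; rewrite eq_sym -subr_eq0; apply/eqP; exact: (cvg_unique (@Rhausdorff R) L L0).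
Qed.

Lemma gbinom_weight k : gbinom a k = w k * cos (k%:R * pi + 0).
Proof.
have -> : cos (k%:R * pi + 0) = (-1) ^+ k :> R.
  rewrite addr0; elim: k => [|k IH]; first by rewrite mul0r cos0.
  by rewrite -natr1 mulrDl mul1r cosDpi IH exprS mulN1r.
by rewrite /grunwald_weight mulrAC -exprMn mulrNN mulr1 expr1n mul1r.
Qed.

(** At th = pi the signs cancel and the series is the binomial series at 1, a
    boundary point of its disc. The partial sums divided by (1 + x)^a have on
    [0, 1] a derivative with the single term n binom(a, n) x^(n - 1),
    since the recurrence of the binomial coefficients cancels all others. *)
Lemma grunwald_series_pi0 : grunwald_series pi 0 = 2 `^ a.
Proof.
pose Q n (x : R) := (1 + x) `^ (- a) * \sum_(0 <= k < n) gbinom a k * x ^+ k.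
pose dQ n (x : R) := - ((1 + x) `^ (- a - 1) * (n%:R * gbinom a n * x ^+ n.-1)).
have d n (x : R) : 0 <= x <= 1 -> is_derive x 1 (Q n) (dQ n x).
  move=> /andP[x0 _]; have x1 : 0 < 1 + x by rewrite ltr_pwDl.
  have d1 : is_derive x 1 (fun x => (1 + x) `^ (- a)) (- a * (1 + x) `^ (- a - 1)).
    apply: (der_eq (der_comp (is_derive1_powR (- a) x1) (der_add (der_cst 1 x) (der_id x)))).
    by rewrite add0r mulr1.
  have d2 : is_derive x 1 (fun x => \sum_(0 <= k < n) gbinom a k * x ^+ k) (\sum_(0 <= k < n) gbinom a k * (k%:R * x ^+ k.-1)).
    rewrite [X in is_derive _ _ X _](_ : _ = (fun x => \sum_(k < n) gbinom a k * x ^+ k)); last first.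
      by apply/funext => z; rewrite big_mkord.
    rewrite big_mkord; apply: (@der_sum R n (fun k x => gbinom a k * x ^+ k)) => k.
    by apply: der_scale; exact: der_pow.
  apply: (der_eq (der_mul d1 d2)).
  rewrite /dQ.
  have -> : (1 + x) `^ (- a) = (1 + x) * (1 + x) `^ (- a - 1).
    rewrite mulrC -{3}(powRr1 (ltW x1)) -powRD ?subrK//.
    by rewrite (gt_eqF x1) implybT.
  have T : \sum_(0 <= k < n) gbinom a k * (k%:R * x ^+ k.-1) * (1 + x) - a * \sum_(0 <= k < n) gbinom a k * x ^+ k =
       - (n%:R * gbinom a n * x ^+ n.-1).
    elim: n {d2} => [|m IH].
      by rewrite !big_geq// mulr0 subrr !mul0r oppr0.
    rewrite !big_nat_recr//=.
    rewrite gbinomS.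
    move: IH; set S1 := \sum_(0 <= _ < m) _; set S2 := \sum_(0 <= _ < m) _ => IH.
    have -> : S1 + gbinom a m * (m%:R * x ^+ m.-1) * (1 + x) - a * (S2 + gbinom a m * x ^+ m) =
       (S1 - a * S2) + gbinom a m * (m%:R * x ^+ m.-1) * (1 + x) - a * (gbinom a m * x ^+ m) by ring.
    rewrite IH; case: m {S1 S2 IH} => [|m]; first by rewrite !mul0r expr0; ring.
    by rewrite /= exprS; ring.
  move: T; rewrite -mulr_suml => T.
  by rewrite -mulrN -T; ring.
have b n x : 0 <= x <= 1 -> `|dQ n x| <= n%:R * `|w n|.
  move=> /andP[x0 x1]; have xp : 1 <= 1 + x by rewrite lerDl.
  rewrite normrN normrM ger0_norm ?powR_ge0//.
  rewrite -[leRHS]mul1r ler_pM ?powR_ge0//.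
    by rewrite -[leRHS](powRr0 (1 + x)); apply: ler_powR => //; have := a1; lra.
  have gw : `|gbinom a n| <= `|w n| by rewrite gbinom_weight [leLHS]normrM ler_piMr// cos_max.
  rewrite -[leRHS]mulr1 normrM; apply: ler_pM; rewrite ?normr_ge0//.
    by rewrite normrM normr_nat ler_wpM2l.
  by rewrite normrX ger0_norm// exprn_ile1.
have Q0 : Q ^~ 0 @ \oo --> (1 : R).
  rewrite -(cvg_shiftS _); apply: cvg_near_cst; apply: nearW => n.
  rewrite /= /Q addr0 powR1 /= mul1r big_nat_recl//= expr0 mulr1 big1 ?addr0.
    by rewrite /gbinom big_ord0.
  by move=> k _; rewrite exprS mul0r mulr0.
have Q1 : Q ^~ 1 @ \oo --> 2 `^ (- a) * grunwald_series pi 0.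
  rewrite /Q; apply: cvgM; first by rewrite -natr1; exact: cvg_cst.
  have := @grunwald_series_cvg pi 0; rewrite /series/=.
  rewrite (_ : (fun n => _) = (fun n => \sum_(0 <= k < n) gbinom a k * 1 ^+ k))//.
  by apply/funext => n; apply: eq_bigr => k _; rewrite expr1n mulr1 gbinom_weight.
have := cvg_eq_vanishing_derivative ler01 d b weight_cvg0 Q0 Q1.
rewrite powRN => /(congr1 (fun z => 2 `^ a * z)).
by rewrite mulr1 mulrA mulfV ?mul1r// gt_eqF// powR_gt0.
Qed.

Lemma grunwald_series_pi y : grunwald_series pi y = 2 `^ a * cos y.
Proof.
rewrite -grunwald_series_pi0 -[RHS](cvg_lim (@Rhausdorff R) (cvgM (@grunwald_series_cvg pi 0) (cvg_cst (cos y)))).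
congr (limn _); apply/funext => n; rewrite /series/= mulr_suml; apply: eq_bigr => k _.
rewrite -[RHS]mulrA.
have sk : sin (k%:R * pi) = 0 :> R.
  elim: k => [|k IH]; first by rewrite mul0r sin0.
  by rewrite -natr1 mulrDl mul1r sinDpi IH oppr0.
by rewrite addr0 cosD sk mul0r subr0.
Qed.

(** The same argument on the arc from th to pi: the phase is turned along with x
    so that the quotient of the series by (2 sin (x / 2))^a should be
    constant, and the derivative of the partial sums collapses to their last
    term. The value at pi fixes the constant. *)
Lemma grunwald_seriesE th y : 0 < th <= pi ->
  grunwald_series th y = (2 * sin (th / 2)) `^ a * cos (y + a * (th - pi) / 2).
Proof.
move=> /andP[th0 thpi].
pose r (x : R) := 2 * sin (x / 2).
have sin_lb (x : R) : th <= x <= pi -> sin (th / 2) <= sin (x / 2).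
  move=> /andP[h1 h2]; have p0 := pi_gt0 R.
  move: h1; rewrite le_eqVlt => /predU1P[->//|h1].
  by apply/ltW; rewrite ltr_sin ?in_itv/=; lra.
have rth : 0 < r th.
  rewrite /r mulr_gt0// sin_gt0_pi//; have := pi_gt0 R; lra.
have r_ge (x : R) : th <= x <= pi -> r th <= r x.
  by move=> h; rewrite /r ler_wpM2l// sin_lb.
pose y0 := y + a * th / 2.
pose psi k x := k%:R * x + (y0 - a * x / 2).
pose Q n (x : R) := r x `^ (- a) * \sum_(k < n) w k * cos (psi k x).
pose dQ n (x : R) := r x `^ (- a - 1) * (n%:R * w n * cos (psi n x - x / 2)).
have d n (x : R) : th <= x <= pi -> is_derive x 1 (Q n) (dQ n x).
  move=> hx; have rx : 0 < r x by rewrite (lt_le_trans rth)// r_ge.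
  have dr : is_derive x 1 r (cos (x / 2)).
    apply: (der_eq (der_scale 2 (der_comp (is_derive_sin _) (der_mul (der_id x) (der_cst 2^-1 x))))).
    by field.
  have d1 := der_comp (is_derive1_powR (- a) rx) dr.
  have dpsi k : is_derive x 1 (psi k) (k%:R - a / 2).
    apply: (der_eq (der_add (der_scale k%:R (der_id x)) (der_sub (der_cst y0 x) (der_mul (der_scale a (der_id x)) (der_cst 2^-1 x))))).
    by ring.
  have d2 := @der_sum R n (fun k x => w k * cos (psi k x)) x _
    (fun k => der_scale (w k) (der_comp (is_derive_cos _) (dpsi k))).
  apply: (der_eq (der_mul d1 d2)).
  have -> : r x `^ (- a) = r x * r x `^ (- a - 1).
    rewrite mulrC -{3}(powRr1 (ltW rx)) -powRD ?subrK//.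
    by rewrite (gt_eqF rx) implybT.
  have T : - a * cos (x / 2) * (\sum_(k < n) w k * cos (psi k x)) +
      r x * (\sum_(k < n) w k * (- sin (psi k x) * (k%:R - a / 2))) = n%:R * w n * cos (psi n x - x / 2).
    elim: n {d2} => [|m IH]; first by rewrite !big_ord0 !mulr0 !mul0r addr0.
    rewrite !big_ord_recr/= weightS.
    have -> : psi m.+1 x - x / 2 = psi m x + x / 2 by rewrite /psi -natr1; field.
    move: IH; set S1 := \sum_(_ < m) _; set S2 := \sum_(_ < m) _ => IH.
    have -> : - a * cos (x / 2) * (S1 + w m * cos (psi m x)) + r x * (S2 + w m * (- sin (psi m x) * (m%:R - a / 2))) =
      (- a * cos (x / 2) * S1 + r x * S2) + w m * (- a * cos (x / 2) * cos (psi m x) - r x * sin (psi m x) * (m%:R - a / 2)) by ring.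
    by rewrite IH /r; move: (psi m x) => P; rewrite !(cosD P) cosN sinN; field.
  by rewrite /dQ -T; ring.
pose K := r th `^ (- a - 1).
have b n x : th <= x <= pi -> `|dQ n x| <= K * (n%:R * `|w n|).
  move=> hx; have rx : 0 < r x by rewrite (lt_le_trans rth)// r_ge.
  rewrite normrM ger0_norm ?powR_ge0// ler_pM ?powR_ge0//.
    rewrite /K -!opprD !powRN lef_pV2 ?posrE ?powR_gt0//.
    apply: ge0_ler_powR; rewrite ?nnegrE ?(ltW rx) ?(ltW rth) ?r_ge//.
    by have := a1; lra.
  by rewrite !normrM ger0_norm// ler_piMr ?mulr_ge0// cos_max.
have z0 : (fun n => K * (n%:R * `|w n|)) @ \oo --> (0 : R).
  by rewrite -(mulr0 K); apply: cvgM; [exact: cvg_cst|exact: weight_cvg0].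
have QL x : Q ^~ x @ \oo --> r x `^ (- a) * grunwald_series x (y0 - a * x / 2).
  rewrite /Q; apply: cvgM; first exact: cvg_cst.
  have := @grunwald_series_cvg x (y0 - a * x / 2); rewrite /series/=.
  rewrite (_ : (fun n => _) = (fun n => \sum_(k < n) w k * cos (psi k x)))//.
  by apply/funext => n; rewrite big_mkord.
have := cvg_eq_vanishing_derivative thpi d b z0 (QL th) (QL pi).
have rpi : r pi = 2 by rewrite /r sin_pihalf mulr1.
rewrite rpi grunwald_series_pi powRN mulrA powRN mulVf ?mul1r ?gt_eqF ?powR_gt0//.
move=> /(congr1 (fun z => r th `^ a * z)).
rewrite mulrA mulfV ?mul1r ?gt_eqF ?powR_gt0// /y0 addrK => ->.
by rewrite -/(r th); congr (_ * cos _); field.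
Qed.

End generating_function.

(** * The symbol of the weighted difference *)

Section symbol.
Context {R : realType}.
Implicit Types (x d z : R).

Lemma MVT_origin (F dF : R -> R) x : 0 <= x -> (forall u : R, is_derive u 1 F (dF u)) ->
  exists2 c, 0 <= c <= x & F x - F 0 = dF c * x.
Proof.
move=> x0 d.
have cF : {within `[0, x], continuous F}.
  by apply: continuous_in_subspaceT => u _; exact: (is_derive_continuous (d u)).
have [c cx] := MVT_segment x0 (fun u _ => d u) cF.
by rewrite subr0 => E; exists c => //; move: cx; rewrite in_itv.
Qed.

Lemma sin_le_id x : 0 <= x -> `|sin x| <= x.
Proof.
move=> x0; have [c cx] := MVT_origin x0 (@is_derive_sin R).
rewrite sin0 subr0 => ->; rewrite normrM (ger0_norm x0) ler_piMl// cos_max//.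
Qed.

Lemma cos_quadratic x : 0 <= x -> `|1 - cos x| <= x ^+ 2.
Proof.
move=> x0; have [c /andP[c0 cx]] := MVT_origin x0 (@is_derive_cos R).
rewrite cos0 distrC => ->; rewrite mulNr normrN normrM (ger0_norm x0) expr2 ler_wpM2r//.
by rewrite (le_trans (sin_le_id c0)).
Qed.

Lemma sin_cubic x : 0 <= x -> `|x - sin x| <= x ^+ 3.
Proof.
move=> x0; have [c /andP[c0 cx]] := @MVT_origin (fun u => u - sin u) (fun u => 1 - cos u) x x0
  (fun u => der_sub (der_id u) (is_derive_sin u)).
rewrite sin0 !subr0 => ->; rewrite normrM (ger0_norm x0) exprSr ler_wpM2r//.
by rewrite (le_trans (cos_quadratic c0))// ler_pXn2r.
Qed.

Lemma sin_quadratic x : 0 <= x -> `|x - sin x| <= x ^+ 2.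
Proof.
move=> x0; have [c /andP[c0 cx]] := @MVT_origin (fun u => u - sin u) (fun u => 1 - cos u) x x0
  (fun u => der_sub (der_id u) (is_derive_sin u)).
rewrite sin0 !subr0 => ->; rewrite normrM (ger0_norm x0) expr2 ler_wpM2r//.
have [b /andP[b0 bc]] := MVT_origin c0 (@is_derive_cos R).
rewrite cos0 distrC => ->; rewrite mulNr normrN normrM (ger0_norm c0).
by rewrite (le_trans _ cx)// ler_piMl// sin_max.
Qed.

Lemma cos_taylor z d : `|cos (z + d) - cos z + d * sin z| <= 2 * d ^+ 2.
Proof.
have H : forall d, 0 <= d -> forall z, `|cos (z + d) - cos z + d * sin z| <= 2 * d ^+ 2.
  move=> {}d d0 {}z.
  have -> : cos (z + d) - cos z + d * sin z = - ((1 - cos d) * cos z) + (d - sin d) * sin z.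
    by rewrite cosD; ring.
  rewrite (le_trans (ler_normD _ _))// normrN !normrM mulr2n mulrDl mul1r lerD//.
    by rewrite (le_trans (ler_piMr _ (cos_max _)))// cos_quadratic.
  by rewrite (le_trans (ler_piMr _ (sin_max _)))// sin_quadratic.
have [d0|d0] := leP 0 d; first exact: H.
have := H (- d) ltac:(lra) (- z).
by rewrite -opprD !cosN sinN sqrrN mulrNN.
Qed.

Variables (a : R) (m : nat) (q g : 'I_m -> R).
Hypothesis a12 : 1 < a <= 2.
Hypothesis g1 : \sum_(j < m) g j = 1.
Hypothesis gq : \sum_(j < m) g j * (q j - a / 2) = 0.

(* Taylor expansion for th <= 1. With r = 2 sin (th / 2) the symbol is
   r^a times a weighted sum of cos (z + d_j th), d_j = a / 2 - q_j.
   The linear conditions turn the sum into cos z plus second-order remainders,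
   and (r / th)^a is 1 + O(th^2). *)
Let symb_small (th y : R) : 0 < th <= 1 ->
  `|\sum_(j < m) g j * grunwald_series a th (y - q j * th) - th `^ a * cos (y - a * (pi / 2))|
    <= (\sum_(j < m) `|g j| * (2 * (a / 2 - q j) ^+ 2) + 1) * th `^ (a + 2).
Proof.
move=> /andP[t0 t1]; have /andP[a1 a2] := a12.
pose r := 2 * sin (th / 2); pose z := y - a * (pi / 2); pose d j := a / 2 - q j.
have tpi : 0 < th <= pi by rewrite t0/=; have := pi_ge2 R; lra.
have th2 : 0 <= th / 2 by rewrite divr_ge0// ltW.
have r0 : 0 < r.
  by rewrite mulr_gt0// sin_gt0_pi//; have := pi_ge2 R; lra.
have rle : r <= th.
  by have := sin_le_id th2; rewrite ler_norml => /andP[_]; rewrite /r; lra.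
have rge : th - th ^+ 3 / 4 <= r.
  have := sin_cubic th2; rewrite ler_norml => /andP[_].
  have -> : (th / 2) ^+ 3 = th ^+ 3 / 8 by field.
  by rewrite /r; lra.
have Ea : th `^ (a + 2) = th `^ a * th ^+ 2.
  rewrite powRD; last by rewrite (gt_eqF t0) implybT.
  by rewrite (powR_mulrn 2 (ltW t0)).
have tha0 := powR_gt0 a t0.
have gE j : grunwald_series a th (y - q j * th) = r `^ a * cos (z + d j * th).
  by rewrite grunwald_seriesE//; congr (_ * cos _); rewrite /z /d; field.
have -> : \sum_(j < m) g j * grunwald_series a th (y - q j * th) =
  \sum_(j < m) g j * (r `^ a * cos (z + d j * th)) by apply: eq_bigr => j _; rewrite gE.
have -> : \sum_(j < m) g j * (r `^ a * cos (z + d j * th)) - th `^ a * cos z =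
  r `^ a * (\sum_(j < m) g j * (cos (z + d j * th) - cos z + d j * th * sin z)) + (r `^ a - th `^ a) * cos z.
  have -> : \sum_(j < m) g j * (cos (z + d j * th) - cos z + d j * th * sin z) =
     \sum_(j < m) g j * cos (z + d j * th) - (\sum_(j < m) g j) * cos z - th * sin z * (\sum_(j < m) g j * (q j - a / 2)).
    rewrite mulr_suml mulr_sumr -!sumrB; apply: eq_bigr => j _; rewrite /d; ring.
  rewrite g1 gq.
  have -> : \sum_(j < m) g j * (r `^ a * cos (z + d j * th)) = r `^ a * \sum_(j < m) g j * cos (z + d j * th).
    by rewrite mulr_sumr; apply: eq_bigr => j _; ring.
  by ring.
rewrite (le_trans (ler_normD _ _))// [leRHS]mulrDl mul1r; apply: lerD.
  rewrite normrM (gtr0_norm (powR_gt0 _ r0)) Ea mulrCA; apply: ler_pM.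
  - exact: powR_ge0.
  - exact: normr_ge0.
  - by apply: ge0_ler_powR; rewrite ?nnegrE ?(ltW r0) ?(ltW t0)//; lra.
  - rewrite (le_trans (ler_norm_sum _ _ _))// mulr_suml; apply: ler_sum => j _.
    rewrite normrM -[leRHS]mulrA ler_wpM2l// (le_trans (cos_taylor _ _))//.
    by rewrite /d exprMn mulrA.
have ra : r `^ a <= th `^ a by apply: ge0_ler_powR; rewrite ?nnegrE ?(ltW r0) ?(ltW t0)//; lra.
rewrite normrM distrC (ger0_norm (_ : 0 <= th `^ a - r `^ a)) ?subr_ge0//.
apply: (le_trans (ler_piMr _ (cos_max _))); first by rewrite subr_ge0.
pose sg := r / th.
have sg0 : 0 < sg by rewrite divr_gt0.
have sg1 : sg <= 1 by rewrite ler_pdivrMr// mul1r.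
have sgl : 1 - th ^+ 2 / 4 <= sg.
  by rewrite ler_pdivlMr// (le_trans _ rge)//; have -> : (1 - th ^+ 2 / 4) * th = th - th ^+ 3 / 4 by field.
have rE : r `^ a = th `^ a * sg `^ a.
  rewrite -powRM ?(ltW t0) ?(ltW sg0)//; congr (_ `^ _); rewrite /sg; field; exact: lt0r_neq0.
(* As r / th <= 1 and a <= 2, the square is a lower bound of the power. *)
have s2 : sg ^+ 2 <= sg `^ a.
  rewrite -powR_mulrn ?(ltW sg0)//; apply: ger_powR => //; exact/andP.
rewrite rE Ea -{1}(mulr1 (th `^ a)) -mulrBr ler_wpM2l ?(ltW tha0)//.
have := sqr_ge0 th; nra.
Qed.

(** For th > 1 no expansion is needed: the series is bounded by 5, and both 1 and
    th^a are at most th^(a + 2). *)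
Lemma symbol_estimate : exists2 C, 0 <= C & forall th y : R, 0 < th ->
  `|\sum_(j < m) g j * grunwald_series a th (y - q j * th) - th `^ a * cos (y - a * (pi / 2))|
    <= C * th `^ (a + 2).
Proof.
have /andP[a1 a2] := a12.
pose C1 := \sum_(j < m) `|g j| * (2 * (a / 2 - q j) ^+ 2) + 1.
pose C2 := \sum_(j < m) `|g j| * 5 + 1.
have C10 : 0 <= C1.
  by rewrite addr_ge0// sumr_ge0// => j _; rewrite mulr_ge0// mulr_ge0// sqr_ge0.
have C20 : 0 <= C2 by rewrite addr_ge0// sumr_ge0// => j _; rewrite mulr_ge0.
exists (C1 + C2); first exact: addr_ge0.
move=> th y t0; rewrite [leRHS]mulrDl.
have p0 : 0 <= th `^ (a + 2) by exact: powR_ge0.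
have [t1|t1] := leP th 1.
  apply: (le_trans (symb_small y _)); first by rewrite t0.
  by rewrite lerDl mulr_ge0.
have p1 : 1 <= th `^ (a + 2).
  by rewrite -[leLHS](powRr0 th); apply: ler_powR; [exact: ltW|lra].
have pa : th `^ a <= th `^ (a + 2) by apply: ler_powR; [exact: ltW|lra].
rewrite (@le_trans _ _ (C2 * th `^ (a + 2)))//; last by rewrite lerDr mulr_ge0.
rewrite (le_trans (ler_normB _ _))// [leRHS]mulrDl mul1r lerD//.
  rewrite (@le_trans _ _ (\sum_(j < m) `|g j| * 5))//; last first.
    by rewrite ler_peMr// sumr_ge0// => j _; rewrite mulr_ge0.
  apply: (le_trans (ler_norm_sum _ _ _)); apply: ler_sum => j _.
  by rewrite normrM ler_wpM2l// grunwald_series_le.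
rewrite normrM (ger0_norm (powR_ge0 _ _)) (le_trans _ pa)//.
by rewrite ler_piMr ?powR_ge0// cos_max.
Qed.

End symbol.

(** * The estimate for real-valued functions *)

Lemma two_derivatives {R : realType} (F0 F1 F2 : R -> R) :
  (forall x : R, is_derive x 1 F0 (F1 x)) -> (forall x : R, is_derive x 1 F1 (F2 x)) ->
  times_derivable 2 F0 /\ derive1n 2 F0 = F2.
Proof.
move=> d0 d1.
have E1 : derive1 F0 = F1 by apply/funext => x; exact: derive1_is_derive.
have E2 : derive1 F1 = F2 by apply/funext => x; exact: derive1_is_derive.
split; last by rewrite derive1nS derive1n1 E1 E2.
move=> [|[|//]] x _; first by have := d0 x => ?; exact: ex_derive.
by rewrite derive1n1 E1; have := d1 x => ?; exact: ex_derive.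
Qed.

Section representative.
Context {R : realType}.
Local Notation mT := (measurableTypeR R).
Local Notation D := (`]0, +oo[%classic : set mT).
Let mD : measurable D. Proof. exact: measurable_itv. Qed.

Lemma intg_lincomb (I : eqType) (r : seq I) (c : I -> R) (F : I -> R -> R) :
  (forall i, intg D (F i)) ->
  intg D (fun w => \sum_(i <- r) c i * F i w) /\
  \int[mu]_(w in D) (\sum_(i <- r) c i * F i w) = \sum_(i <- r) c i * \int[mu]_(w in D) F i w.
Proof.
move=> Fi; elim: r => [|i r [IHi IHe]].
  split; last by rewrite big_nil /Rintegral integral0_eq// => w _; rewrite big_nil.
  by apply: (@intg_eq _ _ (fun=> 0)) => //; [move=> w _; rewrite big_nil|exact: integrable0].
have ciF := intgZl (c i) mD (Fi i).
split.
  by apply: (@intg_eq _ _ _ _ mD _ (intgD mD ciF IHi)) => w _; rewrite big_cons.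
rewrite big_cons -IHe -RintegralZl// -RintegralD//.
by apply: eq_Rintegral_on => w _; rewrite big_cons.
Qed.

Variables (a : R) (f : R -> R).
Hypothesis a12 : 1 < a <= 2.
Hypothesis fi : intg setT f.
Hypothesis aih : intg D (fun w => w `^ (a + 2) * amp f w).
Local Notation v := (synth f 0 0).

(** Near 0 the amplitude is bounded by twice the L^1 norm, and beyond 1 the power
    w^(a + 2) dominates. *)
Lemma amp_powers b : -1 < b <= a + 2 -> intg D (fun w => w `^ b * amp f w).
Proof.
move=> /andP[b1 b2].
have mF E : measurable_fun (E : set mT) (fun w => w `^ b * amp f w).
  by apply: measurable_funM; [exact: measurable_funTS (measurable_powR _)|exact: measurable_amp].
have -> : D = `]0, 1] `|` `[1, +oo[.
  apply/seteqP; split => x /=; rewrite !in_itv/= ?andbT.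
    by move=> x0; case: (leP x 1) => x1; [left; apply/andP|right; exact: ltW].
  by move=> [/andP[]//|]; exact: lt_le_trans.
apply: intg_setU => //.
  apply: (@intg_le _ _ _ (fun w => (2 * \int[mu]_x `|f x|) * w `^ b)) => //.
    move=> w _; rewrite normrM (ger0_norm (powR_ge0 _ _)) (ger0_norm (amp_ge0 _ _)) mulrC.
    by rewrite ler_wpM2r ?powR_ge0// amp_le.
  by apply: intgZl => //; exact: intg_powR01.
apply: (@intg_le _ _ _ (fun w => w `^ (a + 2) * amp f w)) => //.
  move=> w /=; rewrite in_itv/= andbT => w1.
  rewrite normrM (ger0_norm (powR_ge0 _ _)) (ger0_norm (amp_ge0 _ _)).
  by rewrite ler_wpM2r ?amp_ge0// ler_powR.
apply: (integrableS _ _ _ aih) => // x /=; rewrite !in_itv/= !andbT; exact: lt_le_trans.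
Qed.

Lemma amp_intg : intg D (amp f).
Proof.
have := @amp_powers 0 ltac:(have /andP[? ?] := a12; lra).
by apply: intg_eq => // w _; rewrite powRr0 mul1r.
Qed.

Let ai0 := amp_powR0 amp_intg.

Lemma synth_derive2 c b phi : -1 < b <= a ->
  times_derivable 2 (fun x => c * synth f b phi x) /\
  derive1n 2 (fun x => c * synth f b phi x) = (fun x => c * synth f (b + 2) (phi + pi) x).
Proof.
move=> /andP[b1 b2].
have -> : b + 2 = b + 1 + 1 by ring.
have -> : phi + pi = phi + pi / 2 + pi / 2 by field.
by have a1 := a12; apply: two_derivatives => x; apply: der_scale; apply: (synth_der _ _ fi); apply: amp_powers; lra.
Qed.

Lemma synth_period b phi x : synth f b (phi + pi + pi) x = synth f b phi x.
Proof.
rewrite /synth; congr (_ * _); apply: eq_Rintegral_on => w _.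
by rewrite (addrA (w * x)) (addrA (w * x) phi) !phaseDpi opprK.
Qed.

(** With s = 2 - a the fractional integral has the pair (- s, s pi / 2), and
    two derivatives lead to (a, s pi / 2 + pi), where the phase is
    - a pi / 2 up to a full turn. For a = 2 only the two derivatives
    remain. *)
Lemma right_RL_synth : right_RL_exists a v /\
  forall x, right_RL a v x = synth f a (- (a * (pi / 2))) x.
Proof.
have /andP[a1 a2] := a12.
have aO : RL_order a = 2%N by apply: RL_orderE; exact/andP.
rewrite /right_RL_exists /right_RL aO.
have [E|ne] := eqVneq a 2.
  have [] := @synth_derive2 1 0 0 ltac:(lra).
  have -> : (fun x => 1 * v x) = v by apply/funext => x; rewrite mul1r.
  move=> td dE; split=> // x; rewrite sqrrN expr1n dE !mul1r !add0r E.
  have E2 : pi = - (2 * (pi / 2)) + pi + pi :> R by field.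
  by rewrite {1}E2 synth_period.
have s01 : 0 < 2%:R - a < 1 by move: ne; rewrite neq_lt; lra.
have aiz : intg D (fun w => w `^ (- (2%:R - a)) * amp f w) by apply: amp_powers; lra.
have vi := inversion_intg fi amp_intg.
have RE : right_RL_integral (2%:R - a - 1) v =
    (fun x => Gamma (2%:R - a) * synth f (- (2%:R - a)) ((2%:R - a) * (pi / 2)) x).
  by apply/funext => x; exact: right_RL_integral_synth.
have [td dE] := @synth_derive2 (Gamma (2%:R - a)) (- (2%:R - a)) ((2%:R - a) * (pi / 2)) ltac:(lra).
rewrite RE; split.
  by split => // x; exact: right_kernel_synth_intg.
move=> x; rewrite dE sqrrN expr1n div1r mulKf; last first.
  by rewrite gt_eqF// Gamma_gt0//; lra.
have E1 : - (2%:R - a) + 2 = a by ring.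
have E2 : (2%:R - a) * (pi / 2) + pi = - (a * (pi / 2)) + pi + pi by field.
by rewrite E1 E2 synth_period.
Qed.

(** The frequency density of the series at x: [f] at the frequency w times the
    symbol of the shifted operator, in the form cosT + sinT of [phase]. *)
Definition grunwald_symbol h q x w : R :=
  cosT f w * grunwald_series a (w * h) (w * x - q * (w * h)) +
  sinT f w * grunwald_series a (w * h) (w * x - pi / 2 - q * (w * h)).

Lemma grunwald_term_cvg h q : right_grunwald_cvg a h q v.
Proof.
move=> x; set B := pi^-1 * \int[mu]_(w in D) (w `^ 0 * amp f w) + 1.
have B0 : 0 < B.
  by rewrite ltr_pwDr// mulr_ge0 ?invr_ge0 ?pi_ge0// Rintegral_ge0// => w _; rewrite mulr_ge0 ?powR_ge0 ?amp_ge0.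
(* The samples of v are bounded by B, so after division by B the absolutely
   summable weights apply. *)
have := @weight_series_abs _ _ a12 (fun k => B^-1 * v (x + (k%:R - q) * h)).
have -> : grunwald_term a h q v x = (fun k => B * (grunwald_weight a k * (B^-1 * v (x + (k%:R - q) * h)))).
  by apply/funext => k; rewrite /grunwald_term [RHS]mulrCA (mulVKf (lt0r_neq0 B0)).
move=> H; apply: is_cvg_seriesZ; apply: H => k.
rewrite normrM gtr0_norm ?invr_gt0// ler_pdivrMl// mulr1.
by rewrite (le_trans (synth_bounded _ _ fi ai0))// lerDl.
Qed.

(** The partial sums pass under the integral over frequencies, where they are
    dominated by 5 [amp f]. *)
Lemma grunwald_synth h q x : intg D (grunwald_symbol h q x) /\
  limn (series (grunwald_term a h q v x)) = pi^-1 * \int[mu]_(w in D) grunwald_symbol h q x w.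
Proof.
pose F n w := cosT f w * \sum_(0 <= k < n) grunwald_weight a k * cos (k%:R * (w * h) + (w * x - q * (w * h)))
  + sinT f w * \sum_(0 <= k < n) grunwald_weight a k * cos (k%:R * (w * h) + (w * x - pi / 2 - q * (w * h))).
have FE n w : F n w = \sum_(0 <= k < n) grunwald_weight a k *
    (w `^ 0 * phase f w (w * (x + (k%:R - q) * h) + 0)).
  rewrite /F !mulr_sumr -big_split/=; apply: eq_bigr => k _.
  rewrite powRr0 mul1r addr0 /phase -cosBpihalf.
  have -> : w * (x + (k%:R - q) * h) = k%:R * (w * h) + (w * x - q * (w * h)) by ring.
  have -> : k%:R * (w * h) + (w * x - pi / 2 - q * (w * h)) = k%:R * (w * h) + (w * x - q * (w * h)) - pi / 2 by ring.
  by rewrite mulrDr !(mulrCA (grunwald_weight a k)).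
have lc n := @intg_lincomb nat (index_iota 0 n) (grunwald_weight a)
  (fun k w => w `^ 0 * phase f w (w * (x + (k%:R - q) * h) + 0)) (fun k => synth_integrable _ _ fi ai0).
have [||||ig cv] := @Rintegral_dominated_cvg _ D F (grunwald_symbol h q x) (fun w => 5 * amp f w) mD.
- move=> n; apply: intg_measurable; have [i _] := lc n; apply: intg_eq i => // w _; exact/esym/FE.
- move=> w _; apply: cvgD; apply: cvgM; try exact: cvg_cst; exact: grunwald_series_cvg.
- move=> n w _; rewrite (le_trans (ler_normD _ _))// /amp mulrDr !normrM ![5 * _]mulrC.
  by apply: lerD; apply: ler_wpM2l => //; apply: weight_series_bound => // k; exact: cos_max.
- exact: intgZl amp_intg.
split=> //.
have sE : series (grunwald_term a h q v x) = (fun n => pi^-1 * \int[mu]_(w in D) F n w).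
  apply/funext => n; rewrite (eq_Rintegral_on (fun w _ => FE n w)) (lc n).2 mulr_sumr.
  by apply: eq_bigr => k _; rewrite /grunwald_term mulrCA.
rewrite sE; apply: (cvg_lim (@Rhausdorff R)); apply: cvgM => //; exact: cvg_cst.
Qed.

(** The difference of the two sides is one integral over frequencies, and its
    integrand is bounded by h^(- a) C (w h)^(a + 2) [amp f] w
    = C h^2 w^(a + 2) [amp f] w. *)
Lemma WSGD_error (m : nat) (q g : 'I_m -> R) :
  \sum_(j < m) g j = 1 -> \sum_(j < m) g j * (q j - a / 2) = 0 ->
  exists2 C, 0 <= C & forall h x : R, 0 < h ->
    `|\sum_(j < m) g j * right_grunwald a h (q j) v x - right_RL a v x| <= C * h ^+ 2.
Proof.
move=> g1 gq; have [C C0 CP] := symbol_estimate a12 g1 gq.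
exists (pi^-1 * (C * \int[mu]_(w in D) (w `^ (a + 2) * amp f w))).
  rewrite mulr_ge0 ?invr_ge0 ?pi_ge0// mulr_ge0// Rintegral_ge0// => w _.
  by rewrite mulr_ge0 ?powR_ge0 ?amp_ge0.
move=> h x h0; have [_ ->] := right_RL_synth.
have aia : intg D (fun w => w `^ a * amp f w) by have a1 := a12; apply: amp_powers; lra.
have [si sE] := @intg_lincomb 'I_m (index_enum 'I_m) g (fun j => grunwald_symbol h (q j) x)
  (fun j => (grunwald_synth h (q j) x).1).
have pi2 := synth_integrable (- (a * (pi / 2))) x fi aia.
pose E w := (h `^ a)^-1 * (\sum_(j < m) g j * grunwald_symbol h (q j) x w) - w `^ a * phase f w (w * x - a * (pi / 2)).
have -> : \sum_(j < m) g j * right_grunwald a h (q j) v x - synth f a (- (a * (pi / 2))) x =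
    pi^-1 * \int[mu]_(w in D) E w.
  rewrite RintegralB//; last exact: intgZl si.
  rewrite RintegralZl// sE mulrBr; congr (_ - _).
  rewrite mulrA mulr_sumr; apply: eq_bigr => j _.
  by rewrite /right_grunwald (grunwald_synth h (q j) x).2; ring.
have iE : intg D E by apply: intgB => //; exact: intgZl si.
have ha : 0 < h `^ a by exact: powR_gt0.
rewrite normrM gtr0_norm ?invr_gt0 ?pi_gt0// -!mulrA ler_wpM2l ?invr_ge0 ?pi_ge0//.
have -> : C * (\int[mu]_(w in D) (w `^ (a + 2) * amp f w) * h ^+ 2) =
    \int[mu]_(w in D) (C * h ^+ 2 * (w `^ (a + 2) * amp f w)).
  by rewrite RintegralZl//; ring.
apply: le_norm_Rintegral => //; [exact: intg_measurable| |exact: intgZl].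
move=> w /=; rewrite in_itv/= andbT => w0.
have th0 : 0 < w * h by rewrite mulr_gt0.
pose S y := \sum_(j < m) g j * grunwald_series a (w * h) (y - q j * (w * h)) - (w * h) `^ a * cos (y - a * (pi / 2)).
have -> : E w = (h `^ a)^-1 * (cosT f w * S (w * x) + sinT f w * S (w * x - pi / 2)).
  rewrite /E /S /grunwald_symbol /phase -cosBpihalf.
  have -> : w * x - a * (pi / 2) - pi / 2 = w * x - pi / 2 - a * (pi / 2) by ring.
  rewrite powRM ?(ltW w0) ?(ltW h0)//.
  have -> : \sum_(j < m) g j * (cosT f w * grunwald_series a (w * h) (w * x - q j * (w * h)) +
      sinT f w * grunwald_series a (w * h) (w * x - pi / 2 - q j * (w * h))) =
    cosT f w * (\sum_(j < m) g j * grunwald_series a (w * h) (w * x - q j * (w * h))) +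
    sinT f w * (\sum_(j < m) g j * grunwald_series a (w * h) (w * x - pi / 2 - q j * (w * h))).
    by rewrite !mulr_sumr -big_split/=; apply: eq_bigr => j _; ring.
  by field; rewrite gt_eqF.
rewrite normrM gtr0_norm ?invr_gt0// ler_pdivrMl//.
have -> : h `^ a * (C * h ^+ 2 * (w `^ (a + 2) * amp f w)) = C * (w * h) `^ (a + 2) * amp f w.
  rewrite powRM ?(ltW w0) ?(ltW h0)// [h `^ (a + 2)]powRD ?(gt_eqF h0) ?implybT//.
  by rewrite (powR_mulrn 2 (ltW h0)); ring.
rewrite (le_trans (ler_normD _ _))// /amp [leRHS]mulrDr.
by apply: lerD; rewrite normrM [leLHS]mulrC ler_wpM2r//; exact: CP.
Qed.

End representative.

(** * Complex-valued functions *)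

Section complex_valued.
Context {R : realType}.
Local Notation mT := (measurableTypeR R).
Local Notation D := (`]0, +oo[%classic : set mT).
Implicit Types (f : R -> R) (z : R -> R[i]).

Lemma cosT_even f w : cosT f (- w) = cosT f w.
Proof. by apply: eq_Rintegral_on => x _; rewrite mulNr cosN. Qed.

Lemma sinT_odd f w : intg setT f -> sinT f (- w) = - sinT f w.
Proof.
move=> fi; rewrite -[RHS]mulN1r /sinT -RintegralZl//; last exact: intg_sin0.
by apply: eq_Rintegral_on => x _; rewrite mulNr sinN mulrN mulN1r.
Qed.

Lemma fourier_re z w : L1 z ->
  re_part (fourier z) w = cosT (re_part z) w + sinT (im_part z) w.
Proof.
move=> [z1 z2]; rewrite /cosT /sinT -RintegralD//; [|exact: intg_cos0|exact: intg_sin0].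
apply: eq_Rintegral_on => x _; rewrite /re_part /im_part /cis; case: (z x) => r i /=.
by rewrite cosN sinN; ring.
Qed.

Lemma fourier_im z w : L1 z ->
  im_part (fourier z) w = cosT (im_part z) w - sinT (re_part z) w.
Proof.
move=> [z1 z2]; rewrite /cosT /sinT -RintegralB//; [|exact: intg_cos0|exact: intg_sin0].
apply: eq_Rintegral_on => x _; rewrite /re_part /im_part /cis; case: (z x) => r i /=.
by rewrite cosN sinN; ring.
Qed.

Lemma even_odd_intg (e o : R -> R) :
  (forall w, e (- w) = e w) -> (forall w, o (- w) = - o w) ->
  intg setT (fun w => e w + o w) -> intg setT e /\ intg setT o.
Proof.
move=> eE oE i; have j := intg_reflect 0 i.
split.
  have := intgZl (2^-1) (@measurableT _ mT) (intgD (@measurableT _ mT) i j).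
  by apply: intg_eq => // w _; rewrite sub0r eE oE; field.
have := intgZl (2^-1) (@measurableT _ mT) (intgB (@measurableT _ mT) i j).
by apply: intg_eq => // w _; rewrite sub0r eE oE; field.
Qed.

(** The real part of the transform of z is cosT (Re z) + sinT (Im z), an even plus
    an odd function of w, and the imaginary part is of the same kind; the even
    and odd parts of an integrable function are integrable. *)
Lemma fourier_amp z : L1 z -> L1 (fourier z) ->
  intg D (amp (re_part z)) /\ intg D (amp (im_part z)).
Proof.
move=> zi [F1 F2]; have [z1 z2] := zi.
have [c1 s2] : intg setT (cosT (re_part z)) /\ intg setT (sinT (im_part z)).
  apply: even_odd_intg => [w|w|]; [exact: cosT_even|exact: sinT_odd|].
  by move: F1; apply: intg_eq => // w _; exact: fourier_re.
have [c2 s1] : intg setT (cosT (im_part z)) /\ intg setT (fun w => - sinT (re_part z) w).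
  apply: even_odd_intg => [w|w|]; [exact: cosT_even|by rewrite sinT_odd|].
  by move: F2; apply: intg_eq => // w _; exact: fourier_im.
have H f : intg setT (cosT f) -> intg setT (fun w => `|sinT f w|) -> intg D (amp f).
  move=> c s; apply: (@integrableS _ _ _ _ setT) => //.
  by apply: intgD => //; exact: intg_norm.
split; apply: H => //; last exact: intg_norm.
have := intg_norm (@measurableT _ mT) s1.
by apply: intg_eq => // w _; rewrite normrN.
Qed.

Lemma norm_complex_le (x y : R) : `|x +i* y| <= (`|x| + `|y|)%:C.
Proof.
rewrite normc_def lecR /= -(ger0_norm (_ : 0 <= `|x| + `|y|)) ?addr_ge0// -sqrtr_sqr.
rewrite ler_wsqrtr// sqrrD !real_normK ?num_real//.
by rewrite lerD2r lerDl mulrn_wge0// mulr_ge0.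
Qed.

Lemma sum_complex (I : Type) (r : seq I) (c A B : I -> R) :
  \sum_(j <- r) (c j)%:C * (A j +i* B j) =
  (\sum_(j <- r) c j * A j) +i* (\sum_(j <- r) c j * B j).
Proof.
elim: r => [|j r IH]; first by rewrite !big_nil.
rewrite !big_cons IH; apply/eqP; rewrite eq_complex /=.
by rewrite !mul0r subr0 addr0 !eqxx.
Qed.

End complex_valued.

(* An element u of L^1 is only given almost everywhere, whereas the shifted
   differences sample it at points, so the estimate, which holds at every x,
   is stated for the continuous representative v of u; if u is continuous then
   v = u. Convergence of the series and existence of the right derivative,
   implicit in the estimate, are part of the conclusion. *)
Theorem theorem3 (R : realType) (alpha : R) (u : R -> R[i])
    (m : nat) (q g : 'I_m -> R) :
  1 < alpha <= 2 ->
  L1 u ->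
  both_parts (left_RL_exists (alpha + 2)) u ->
  L1 (cext (left_RL (alpha + 2)) u) ->
  L1 (fourier (cext (left_RL (alpha + 2)) u)) ->
  (2 <= m)%N ->
  \sum_(j < m) g j = 1 ->
  \sum_(j < m) g j * (q j - alpha / 2) = 0 ->
  exists v : R -> R[i],
    [/\ both_parts (fun f => continuous f) v,
        {ae (@lebesgue_measure R), forall x, u x = v x},
        both_parts (right_RL_exists alpha) v,
        (forall (h : R) (j : 'I_m), 0 < h ->
           both_parts (right_grunwald_cvg alpha h (q j)) v) &
        exists C : R, \forall h \near 0^'+, forall x : R,
          `| right_WSGD alpha h q g v x - cext (right_RL alpha) v x |
            <= (C * h ^+ 2)%:C].
Proof.
move=> a12 [u1i u2i] [ex1 ex2] di Fi _ g1 gq.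
have [d1i d2i] := di; have [ai1 ai2] := fourier_amp di Fi.
have S1 := left_RL_spectral_decay a12 u1i ex1 d1i ai1.
have S2 := left_RL_spectral_decay a12 u2i ex2 d2i ai2.
have A1 := amp_intg a12 u1i S1; have A2 := amp_intg a12 u2i S2.
have [C1 C10 E1] := WSGD_error a12 u1i S1 g1 gq.
have [C2 C20 E2] := WSGD_error a12 u2i S2 g1 gq.
exists (fun x => synth (re_part u) 0 0 x +i* synth (im_part u) 0 0 x); split.
- by split; apply: synth_continuous => //; exact: amp_powR0.
- have := inversion_ae u1i A1; apply: filterS2 (inversion_ae u2i A2).
    exact: (ae_filter_ringOfSetsType mu).
  by move=> x; rewrite /re_part /im_part; case: (u x) => r i /= -> ->.
- by split; [exact: (right_RL_synth a12 u1i S1).1|exact: (right_RL_synth a12 u2i S2).1].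
- by move=> h j h0; split; exact: grunwald_term_cvg.
- exists (C1 + C2); near=> h => x; have h0 : 0 < h by near: h; exact: nbhs_right_gt.
  rewrite /right_WSGD /cext sum_complex.
  apply: (le_trans (norm_complex_le _ _)).
  by rewrite lecR mulrDl lerD//; [exact: E1|exact: E2].
Unshelve. all: by end_near.
Qed.
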